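(* Let $k\ge 1$ be an integer, $f_1,\dots,f_m:\mathbb{R}^n\to\mathbb{R}^n$ vector fields, $\mathcal{T}\subset\mathbb{R}^n$ a target, $A=\{\pm e_1,\dots,\pm e_m\}$ where $e_1,\dots,e_m$ is the canonical basis of $\mathbb{R}^m$, and $l:\mathbb{R}^n\times A\to[0,+\infty[$ a Lagrangian. Assume that: (H1) $\mathcal{T}$ is closed with compact boundary; (H2) for every $a\in A$ the function $l(\cdot,a)$ is locally Lipschitz continuous on $\mathbb{R}^n$, and for every bounded nonempty (open) set $\Omega\subset\mathbb{R}^n$ the vector fields $f_1,\dots,f_m$ belong to $C^{k-1,1}_b(\Omega)$, i.e. they are of class $C^{k-1}$ with bounded derivatives up to order $k-1$ and with $(k-1)$-th derivative Lipschitz continuous on $\Omega$. Consider the control system $\dot y(s)=\sum_{i=1}^m f_i(y(s))\,\alpha^i(s)$, $\alpha(s)\in A$. Then (all notions being as defined in the context): (i) If the control system is degree-$k$ sample stabilizable to $\mathcal{T}$, then it is globally asymptotically controllable to $\mathcal{T}$. (ii) If the control system is degree-$k$ $U$-sample stabilizable to $\mathcal{T}$ with $\mathbf{\Psi}$-regulated cost, where $\mathbf{\Psi}(R,v_1,v_2)=\Lambda(R)\Psi(v_1,v_2)$ is an integral-cost-bound function, then the control system is globally asymptotically controllable to $\mathcal{T}$ with $\mathbf{W}$-regulated cost, where $$\mathbf{W}(x)=\Lambda\big(\varphi^{-1}(U(x))\big)\,\mathbf{\Phi}(U(x)),$$ with $\varphi$ the function appearing in the definition of degree-$k$ $U$-sample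 stabilizability with $\mathbf{\Psi}$-regulated cost, and $\mathbf{\Phi}$ the function associated with $\Psi$ as described in the context (and $\mathbf{W}(x)=0$ where $U(x)=0$).
   Context: Notation: $\mathbb{R}_{\ge0}=[0,+\infty[$, $\mathbb{R}_{>0}=]0,+\infty[$, $s\wedge t=\min\{s,t\}$, $\mathbf{d}(x)=\inf_{y\in\mathcal{T}}|x-y|$. A continuous $G:\overline{\Omega}\to\mathbb{R}$ ($\Omega\subset\mathbb{R}^n$ open) is positive definite if $G>0$ on $\Omega$ and $G=0$ on $\partial\Omega$; it is proper if $G^{-1}(K)$ is compact for every compact $K\subset\mathbb{R}_{\ge0}$. Admissible pairs and triples. $(\alpha,y)$ is an admissible control-trajectory pair from $x\in\mathbb{R}^n\setminus\mathcal{T}$ if there is $S_y\le+\infty$ such that $\alpha:[0,S_y[\to A$ is Lebesgue measurable, and $y:[0,S_y[\to\mathbb{R}^n\setminus\mathcal{T}$ is a Carathéodory solution of $\dot y=\sum_i f_i(y)\alpha^i$ with $y(0)=x$, satisfying, if $S_y<+\infty$, $\lim_{s\to S_y^-}\mathbf{d}(y(s))=0$. With $\mathfrak{I}(s)=\int_0^s l(y(\sigma),\alpha(\sigma))\,d\sigma$, $(\alpha,y,\mathfrak{I})$ is an admissible control-trajectory-cost triple from $x$. If $S_y<+\infty$, one extends $\alpha,y,\mathfrak{I}$ to $\mathbb{R}_{\ge0}$ by $\alpha(s)=\bar a$ ($\bar a\in A$ arbitrary) and $(y,\mathfrak{I})(s)=\lim_{\sigma\to S_y^-}(y,\mathfrak{I})(\sigma)$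 for $s\ge S_y$. Formal brackets. The Lie bracket is $[g_1,g_2]=Dg_2\cdot g_1-Dg_1\cdot g_2$. An iterated formal bracket $B=B(X_{c+1},\dots,X_{c+\ell})$ ($c\ge0$, $\ell\ge1$) is a bracketing of the sequence of letters $X_{c+1},\dots,X_{c+\ell}$ in this order, each used once; $\ell_B=\ell$ is its degree (a single letter $X_i$ has degree 1). If $\ell_B\ge2$, $B$ factorizes uniquely as $B=[B_1,B_2]$. The switch number is $\mathfrak{s}_B=1$ if $\ell_B=1$, and $\mathfrak{s}_B=2(\mathfrak{s}_{B_1}+\mathfrak{s}_{B_2})$ if $B=[B_1,B_2]$. For a string $\mathbf{g}=(g_1,\dots,g_q)$, $q\ge c+\ell$, of continuous vector fields, $B(\mathbf{g})$ is obtained by replacing each $X_j$ by $g_j$. $(B,\mathbf{g})$ is an admissible bracket pair (of degree $\ell_B$) if $\mathbf{g}$ is of class $C^B$: there are integers $k_1,\dots,k_q\ge0$ with $g_i$ of class $C^{k_i}$ such that from this information alone one deduces that $B(\mathbf{g})$ is a continuous vector field (i.e. each $g_j$ whose letter $X_j$ occurs in $B$ is of class $C^{d_j}$, where $d_j$ is the number of bracket pairs of $B$ enclosing $X_j$). Control labels. For $h\ge1$, $\mathcal{F}^{(h)}$ is the set of triples $(B,\mathbf{g},\mathrm{sgn})$ with $\mathrm{sgn}\in\{+,-\}$ and $(B,\mathbf{g})$ an admissible bracket pair of degree $\ell_B\le h$ such that every component of $\mathbf{g}$ belongs to $\{f_1,\dots,f_m\}$. Oriented controls. For $t>0$ and $(B,\mathbf{g},\pm)\in\mathcal{F}^{(k)}$,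 define $\alpha_{(B,\mathbf{g},\pm),t}:[0,t]\to A$ recursively: if $B=X_j$, $\alpha_{(B,\mathbf{g},+),t}\equiv e_i$, where $i$ is such that $g_j=f_i$; for every $B$, $\alpha_{(B,\mathbf{g},-),t}(s)=-\alpha_{(B,\mathbf{g},+),t}(t-s)$; if $B=[B_1,B_2]$, with $\mathfrak{s}_i=\mathfrak{s}_{B_i}$ and $\mathfrak{s}=\mathfrak{s}_B$, $\alpha_{(B,\mathbf{g},+),t}$ is the concatenation, in this order, of $\alpha_{(B_1,\mathbf{g},+),\mathfrak{s}_1t/\mathfrak{s}}$, $\alpha_{(B_2,\mathbf{g},+),\mathfrak{s}_2t/\mathfrak{s}}$, $\alpha_{(B_1,\mathbf{g},-),\mathfrak{s}_1t/\mathfrak{s}}$, $\alpha_{(B_2,\mathbf{g},-),\mathfrak{s}_2t/\mathfrak{s}}$ (suitably translated in time to consecutive intervals). Feedback generators and multiflows. A degree-$k$ feedback generator is any map $\mathcal{V}:\mathbb{R}^n\setminus\mathcal{T}\to\mathcal{F}^{(k)}$, $\mathcal{V}(x)=(B_x,\mathbf{g}_x,\mathrm{sgn}_x)$; put $\ell(x)=\ell_{B_x}$. For $x\in\mathbb{R}^n\setminus\mathcal{T}$, $t>0$, let $\alpha_{x,t}(s)=\alpha_{\mathcal{V}(x),t}(s\wedge t)$, $s\ge0$. The $\mathcal{V}$-multiflow $y_{x,t}$ is the maximal (forward) solution of $\dot y=\sum_i f_i(y)\alpha^i_{x,t}(s)$, $y(0)=x$. Sampling processes. A partition of $\mathbb{R}_{\ge0}$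 is $\pi=\{s_j\}_{j\ge0}$ with $s_0=0$, $s_j<s_{j+1}$, $s_j\to+\infty$. Given $\mathcal{V}$, $x\in\mathbb{R}^n\setminus\mathcal{T}$ and $\pi$, the $\mathcal{V}$-sampling trajectory $y_x^\pi$ and control $\alpha_x^\pi$ are defined recursively: $x_1=x$, and for $j\ge1$, $t_j=s_j-s_{j-1}$, $x_j=y_x^\pi(s_{j-1})$, let $\sigma_j$ be the supremum of the $\sigma\ge s_{j-1}$ such that $s\mapsto y_{x_j,t_j}(s-s_{j-1})$ is defined on $[s_{j-1},\sigma[$ with values in $\mathbb{R}^n\setminus\mathcal{T}$; set $y_x^\pi(s)=y_{x_j,t_j}(s-s_{j-1})$ and $\alpha_x^\pi(s)=\alpha_{x_j,t_j}(s-s_{j-1})$ for $s\in[s_{j-1},s_j\wedge\sigma_j[$; if $\sigma_j>s_j$ continue from $x_{j+1}=y_{x_j,t_j}(t_j)$, otherwise stop and set $\mathbf{j}=j$. Here $\mathbf{j}=\inf\{j:\sigma_j\le s_j\}$ ($\mathbf{j}=+\infty$, $\sigma_{\mathbf{j}}=+\infty$ if this set is empty), and $y_x^\pi,\alpha_x^\pi$ are defined on $[0,\sigma_{\mathbf{j}}[$. The $\mathcal{V}$-sampling cost is $\mathfrak{I}_x^\pi(s)=\int_0^s l(y_x^\pi,\alpha_x^\pi)\,d\sigma$. $(x,\pi,\alpha_x^\pi,y_x^\pi)$ is a $\mathcal{V}$-sampling process and $(x,\pi,\alpha_x^\pi,y_x^\pi,\mathfrak{I}_x^\pi)$ a $\mathcal{V}$-sampling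 process-cost; they are admissible if $(\alpha_x^\pi,y_x^\pi)$, resp. $(\alpha_x^\pi,y_x^\pi,\mathfrak{I}_x^\pi)$, is an admissible pair, resp. triple, from $x$ (with $S_y=\sigma_{\mathbf{j}}$; in that case, if $\sigma_{\mathbf j}<+\infty$, they are extended to $\mathbb{R}_{\ge0}$ by setting $\alpha_x^\pi(s)=\bar a$ ($\bar a\in A$ arbitrary) and $(y_x^\pi,\mathfrak{I}_x^\pi)(s)=\lim_{\sigma\to\sigma_{\mathbf{j}}^-}(y_x^\pi,\mathfrak{I}_x^\pi)(\sigma)$ for $s\ge\sigma_{\mathbf{j}}$). For a multirank $\mathfrak{d}=(\delta_1,\dots,\delta_k)\in\mathbb{R}_{>0}^k$, they are called $\mathfrak{d}$-scaled if $\frac{k-1}{k}\,\delta_{\ell_j}\le s_j-s_{j-1}\le\delta_{\ell_j}$, $\ell_j=\ell(y_x^\pi(s_{j-1}))$, for all integers $j\ge1$ with $j\le\mathbf{j}$. Integral-cost-bound function: a map $\mathbf{\Psi}:\mathbb{R}_{>0}^3\to\mathbb{R}_{\ge0}$, $\mathbf{\Psi}(R,v_1,v_2)=\Lambda(R)\Psi(v_1,v_2)$, where $\Lambda:\mathbb{R}_{>0}\to\mathbb{R}_{>0}$ is continuous, increasing, with $\Lambda\equiv1$ if $k=1$; $\Psi:\mathbb{R}_{>0}^2\to\mathbb{R}_{\ge0}$ is continuous, increasing and unbounded in the first variable, strictly decreasing in the second; and there is a strictly decreasing bilateral sequence $(u_i)_{i\in\mathbb{Z}}\subset\mathbb{R}_{>0}$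 with $\lim_{i\to-\infty}u_i=+\infty$, $\lim_{i\to+\infty}u_i=0$ and $\sum_{i=j}^{+\infty}\Psi(u_i,u_{i+1})<+\infty$ for some (hence any) $j\in\mathbb{Z}$. The function $\mathbf{\Phi}$: given $\Psi$ and such a sequence $(u_i)_i$, let $\mathbf{\Phi}_0(0)=0$ and $\mathbf{\Phi}_0(u)=\Psi(u,u_{i+1})+\sum_{j=i+1}^{+\infty}\Psi(u_j,u_{j+1})$ if $u\in\,]u_{i+1},u_i]$, $i\in\mathbb{Z}$. Then $\mathbf{\Phi}:\mathbb{R}_{\ge0}\to\mathbb{R}_{\ge0}$ denotes a continuous, strictly increasing, unbounded function with $\mathbf{\Phi}\ge\mathbf{\Phi}_0$ and $\mathbf{\Phi}(0)=\lim_{u\to0}\mathbf{\Phi}(u)=0$ (an approximation of $\mathbf{\Phi}_0$ from above). Degree-$k$ sample stabilizability. Let $\mathcal{V}$ be a degree-$k$ feedback generator and $U:\overline{\mathbb{R}^n\setminus\mathcal{T}}\to\mathbb{R}_{\ge0}$ continuous, proper, positive definite. $\mathcal{V}$ degree-$k$ $U$-sample stabilizes the control system to $\mathcal{T}$ if there exist a multirank map $\mathfrak{d}:\mathbb{R}_{>0}^2\to\mathbb{R}_{>0}^k$, continuous, strictly increasing, unbounded functions $\Gamma,\varphi:\mathbb{R}_{\ge0}\to\mathbb{R}_{\ge0}$ with $\Gamma(0)=\varphi(0)=0$, and a function $\mathbf{T}:\mathbb{R}_{>0}^2\to\mathbb{R}_{>0}$ increasing in the first and decreasing in the second variable, such that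 for any $0<r<R$ every $\mathfrak{d}(R,r)$-scaled $\mathcal{V}$-sampling process $(x,\pi,\alpha_x^\pi,y_x^\pi)$ with $\mathbf{d}(x)\le R$ is admissible and satisfies: (i) $\mathbf{d}(y_x^\pi(s))\le\Gamma(R)$ for all $s\ge0$; (ii) $\mathbf{t}(y_x^\pi,r):=\inf\{s\ge0: U(y_x^\pi(s))\le\varphi(r)\}\le\mathbf{T}(R,r)$; (iii) if $U(y_x^\pi(\tau))\le\varphi(r)$ for some $\tau>0$, then $\mathbf{d}(y_x^\pi(s))\le r$ for all $s\ge\tau$. If in addition there is an integral-cost-bound function $\mathbf{\Psi}$ such that the associated process-cost satisfies (iv) $\mathfrak{I}_x^\pi(\mathbf{t}(y_x^\pi,r))\le\mathbf{\Psi}\big(R,U(x),U(y_x^\pi(\mathbf{t}(y_x^\pi,r)))\big)$, then $\mathcal{V}$ degree-$k$ $U$-sample stabilizes the system to $\mathcal{T}$ with $\mathbf{\Psi}$-regulated cost. The system is degree-$k$ $U$-sample stabilizable to $\mathcal{T}$ [with $\mathbf{\Psi}$-regulated cost] if some degree-$k$ feedback generator $\mathcal{V}$ has the corresponding property, and degree-$k$ sample stabilizable to $\mathcal{T}$ if this holds (without cost condition) for some $U$. Global asymptotic controllability (GAC). The control system is GAC to $\mathcal{T}$ if for any $0<r<R$ there exist $\mathbf{\Gamma}=\mathbf{\Gamma}(R)>0$ and $\mathbf{S}=\mathbf{S}(R,r)>0$, with $\lim_{R\to0}\mathbf{\Gamma}(R)=0$, such that for every $x\in\mathbb{R}^n\setminus\mathcal{T}$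 with $\mathbf{d}(x)\le R$ there is an admissible control-trajectory pair $(\alpha,y)$ from $x$ with: (i) $\mathbf{d}(y(s))\le\mathbf{\Gamma}(R)$ for all $s\ge0$; (ii) $\mathbf{d}(y(s))\le r$ for all $s\ge\mathbf{S}(R,r)$; (iii) $\lim_{s\to+\infty}\mathbf{d}(y(s))=0$. If moreover there is a continuous, proper, positive definite function $\mathbf{W}:\overline{\mathbb{R}^n\setminus\mathcal{T}}\to\mathbb{R}_{\ge0}$ such that the associated triple satisfies (iv) $\int_0^{S_y}l(y(s),\alpha(s))\,ds\le\mathbf{W}(x)$, the system is GAC to $\mathcal{T}$ with $\mathbf{W}$-regulated cost. *)

(* Defs.v *)
From HB Require Import structures.
From mathcomp Require Import all_boot all_order all_algebra.
From mathcomp Require Import all_classical all_reals all_analysis.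
Import Order.TTheory GRing.Theory Num.Theory.
Import numFieldNormedType.Exports.

Set Implicit Arguments.
Unset Strict Implicit.
Unset Printing Implicit Defensive.

Local Open Scope classical_set_scope.
Local Open Scope ring_scope.

Section Space.
Context {R : realType} {n : nat}.
Implicit Types (T O : set 'rV[R]_n) (x : 'rV[R]_n) (G : 'rV[R]_n -> R).

Definition enorm x : R := Num.sqrt (\sum_i x ord0 i ^+ 2).

(* Extended-real valued, so that inf over the empty set is +oo. *)
Definition dist T x : \bar R := ereal_inf [set (enorm (x - y))%:E | y in T].

Definition boundary T : set 'rV[R]_n := closure T `\` T°.

(* G is only meaningful on closure O. *)
Definition pos_definite O G : Prop :=
  (forall x, O x -> 0 < G x) /\ (forall x, boundary O x -> G x = 0).

Definition proper_on O G : Prop :=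
  forall K : set R, compact K -> K `<=` [set v | 0 <= v] ->
    compact (closure O `&` G @^-1` K).

Definition cont_proper_posdef O G : Prop :=
  [/\ {within closure O, continuous G}, proper_on O G & pos_definite O G].

Fixpoint pderiv (s : seq 'I_n) (f : 'rV[R]_n -> 'rV[R]_n) : 'rV[R]_n -> 'rV[R]_n :=
  if s is i :: s' then 'D_(delta_mx ord0 i) (pderiv s' f) else f.

Definition class_C (j : nat) O (f : 'rV[R]_n -> 'rV[R]_n) : Prop :=
  (forall s, (size s < j)%N -> forall x, O x -> differentiable (pderiv s f) x) /\
  (forall s, (size s <= j)%N -> forall x, O x -> {for x, continuous (pderiv s f)}).

(* The class C^{j,1}_b(O), for O open. *)
Definition class_C1b (j : nat) O (f : 'rV[R]_n -> 'rV[R]_n) : Prop :=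
  [/\ class_C j O f,
      forall s, (size s <= j)%N -> [bounded pderiv s f x | x in O]
    & forall s, size s = j -> [lipschitz pderiv s f x | x in O]].

End Space.

Section RealFunctions.
Context {R : realType}.
Implicit Types (g : R -> R).

Definition class_Kinf g : Prop :=
  [/\ g 0 = 0, {within [set s | 0 <= s], continuous g},
      forall s t, 0 <= s -> s < t -> g s < g t
    & forall M, exists2 s, 0 <= s & M < g s].

(* An integral-cost-bound function is the product Lam rad * Psi v1 v2. *)
Record cost_factors (k : nat) (Lam : R -> R) (Psi : R -> R -> R) : Prop := {
  Lam_gt0 : forall s, 0 < s -> 0 < Lam s ;
  Lam_cont : forall s, 0 < s -> {for s, continuous Lam} ;
  Lam_incr : forall s t, 0 < s -> s <= t -> Lam s <= Lam t ;
  Lam_eq1 : k = 1%N -> forall s, 0 < s -> Lam s = 1 ;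
  Psi_ge0 : forall v1 v2, 0 < v1 -> 0 < v2 -> 0 <= Psi v1 v2 ;
  Psi_cont : forall v1 v2, 0 < v1 -> 0 < v2 ->
    {for (v1, v2), continuous (fun v : R * R => Psi v.1 v.2)} ;
  Psi_incr : forall v1 w1 v2, 0 < v1 -> v1 <= w1 -> 0 < v2 ->
    Psi v1 v2 <= Psi w1 v2 ;
  Psi_unbounded : forall v2, 0 < v2 -> forall M, exists2 v1, 0 < v1 & M < Psi v1 v2 ;
  Psi_decr : forall v1 v2 w2, 0 < v1 -> 0 < v2 -> v2 < w2 ->
    Psi v1 w2 < Psi v1 v2
}.

(* \sum_(i >= j) Psi (u_i) (u_(i+1)) *)
Definition Psi_tail (Psi : R -> R -> R) (u : int -> R) (j : int) : \bar R :=
  (\sum_(0 <= i <oo) (Psi (u (j + i%:Z)%R) (u (j + i%:Z + 1)%R))%:E)%E.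

Record cost_sequence (Psi : R -> R -> R) (u : int -> R) : Prop := {
  useq_gt0 : forall i, 0 < u i ;
  useq_decr : forall i j : int, i < j -> u j < u i ;
  useq_ninfty : u (- (i%:Z)) @[i --> \oo] --> +oo ;
  useq_pinfty : u i%:Z @[i --> \oo] --> 0 ;
  useq_summable : exists j, (Psi_tail Psi u j < +oo)%E
}.

Definition cost_bound (k : nat) (Lam : R -> R) (Psi : R -> R -> R) : Prop :=
  cost_factors k Lam Psi /\ exists u, cost_sequence Psi u.

Definition Phi0 (Psi : R -> R -> R) (u : int -> R) (v : R) : \bar R :=
  if v == 0 then 0%E else
  let i := xget 0 [set i : int | u (i + 1) < v <= u i] in
  ((Psi v (u (i + 1)%R))%:E + Psi_tail Psi u (i + 1)%R)%E.

Definition Phi_approx (Psi : R -> R -> R) (u : int -> R) (Phi : R -> R) : Prop :=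
  class_Kinf Phi /\ forall v, 0 <= v -> (Phi0 Psi u v <= (Phi v)%:E)%E.

(* The half-open time interval [0, S[. *)
Definition tdom (S : \bar R) : set R := [set s | 0 <= s /\ (s%:E < S)%E].

(* Extension beyond a finite final time S by the left limit at S. *)
Definition ext {W : ptopologicalType} (S : \bar R) (g : R -> W) (s : R) : W :=
  if (s%:E < S)%E then g s else lim (g t @[t --> (fine S)^'-]).

Definition partition (p : nat -> R) : Prop :=
  [/\ p 0%N = 0, forall j, p j < p j.+1 & p j @[j --> \oo] --> +oo].

End RealFunctions.

(* The real line with the sigma-algebra of Lebesgue-measurable sets. *)
Notation lebR R := (caratheodory_type ((@wlength R idfun)^*)%mu).

Notation leb := completed_lebesgue_measure.

Section ControlSystem.
Context {R : realType} {n m : nat}.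
Variable f : 'I_m -> 'rV[R]_n -> 'rV[R]_n.
Variable l : 'rV[R]_n -> 'rV[R]_m -> R.
Variable T : set 'rV[R]_n.
Implicit Types (x : 'rV[R]_n) (S : \bar R).
Implicit Types (alpha : R -> 'rV[R]_m) (y : R -> 'rV[R]_n).

Definition ctrl_basis (i : 'I_m) : 'rV[R]_m := delta_mx ord0 i.

Definition ctrl_set : set 'rV[R]_m :=
  [set a | exists i, a = ctrl_basis i \/ a = - ctrl_basis i].

Definition abs_continuous (a b : R) y : Prop :=
  forall e, 0 < e -> exists2 d, 0 < d &
    forall (N : nat) (u v : 'I_N -> R),
      (forall i, [/\ a <= u i, u i <= v i & v i <= b]) ->
      (forall i j, i != j -> v i <= u j \/ v j <= u i) ->
      \sum_i (v i - u i) < d -> \sum_i `|y (v i) - y (u i)| < e.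

(* Caratheodory solution on [0, S[ of the control system in the whole space. *)
Record solution x S alpha y : Prop := {
  sol_dom : (0 < S)%E ;
  sol_init : y 0 = x ;
  sol_ac : forall c, tdom S c -> abs_continuous 0 c y ;
  sol_ode : {ae leb, forall s : lebR R, tdom S s ->
    is_derive (s : R) 1 y (\sum_i alpha s ord0 i *: f i (y s))}
}.

(* Borel sets of R^m are generated by the coordinates, hence the coordinatewise
   measurability. *)
Record admissible_pair x S alpha y : Prop := {
  adm_ctrl : forall s, tdom S s -> ctrl_set (alpha s) ;
  adm_meas : forall i, measurable_fun (tdom S : set (lebR R))
    (fun s : lebR R => alpha s ord0 i) ;
  adm_sol : solution x S alpha y ;
  adm_out : forall s, tdom S s -> ~ T (y s) ;
  adm_end : (S < +oo)%E -> dist T (y s) @[s --> (fine S)^'-] --> 0%E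
}.

Definition cost alpha y (s : R) : \bar R :=
  (\int[leb]_(t in ([set t | (0 <= t <= s)%R] : set (lebR R)))
     (l (y t) (alpha t))%:E)%E.

(* Formal brackets; the letter number j (from 0) stands for X_(j+1). *)
Inductive bracket : Type :=
| Letter of nat
| Bracket of bracket & bracket.

Fixpoint letters (B : bracket) : seq nat :=
  match B with
  | Letter j => [:: j]
  | Bracket B1 B2 => letters B1 ++ letters B2
  end.

Definition degree (B : bracket) : nat := size (letters B).

Fixpoint switch (B : bracket) : nat :=
  match B with
  | Letter _ => 1
  | Bracket B1 B2 => 2 * (switch B1 + switch B2)
  end.

(* Number of bracket pairs enclosing the letter j; 0 if j does not occur. *)
Fixpoint depth (j : nat) (B : bracket) : nat :=
  match B with
  | Letter _ => 0
  | Bracket B1 B2 =>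
      if j \in letters B1 then (depth j B1).+1
      else if j \in letters B2 then (depth j B2).+1 else 0
  end.

(* lab_str is the string g: its j-th component (from 0) is f_i for i the j-th
   index of lab_str.  Recording indices rather than vector fields fixes the
   choice of i such that g_j = f_i when the f_i are not pairwise distinct.
   lab_sgn = true stands for +. *)
Record label : Type := Label {
  lab_br : bracket ;
  lab_str : seq 'I_m ;
  lab_sgn : bool
}.

Record label_set (h : nat) (L : label) : Prop := {
  lab_consecutive : exists c, letters (lab_br L) = iota c (degree (lab_br L)) /\
    (c + degree (lab_br L) <= size (lab_str L))%N ;
  lab_degree : (degree (lab_br L) <= h)%N ;
  lab_regular : forall j i, onth (lab_str L) j = Some i ->
    class_C (depth j (lab_br L)) setT (f i)
}.

Fixpoint octrl_pos (B : bracket) (g : seq 'I_m) (t s : R) : 'rV[R]_m :=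
  match B with
  | Letter j => if onth g j is Some i then ctrl_basis i else 0
  | Bracket B1 B2 =>
      let t1 := (switch B1)%:R * t / (switch B)%:R in
      let t2 := (switch B2)%:R * t / (switch B)%:R in
      if s < t1 then octrl_pos B1 g t1 s
      else if s < t1 + t2 then octrl_pos B2 g t2 (s - t1)
      else if s < t1 + t2 + t1 then - octrl_pos B1 g t1 (t1 - (s - (t1 + t2)))
      else - octrl_pos B2 g t2 (t2 - (s - (t1 + t2 + t1)))
  end.

Definition octrl (L : label) (t s : R) : 'rV[R]_m :=
  if lab_sgn L then octrl_pos (lab_br L) (lab_str L) t s
  else - octrl_pos (lab_br L) (lab_str L) t (t - s).

Section Sampling.
Variable V : 'rV[R]_n -> label.

Definition feedback_generator (k : nat) : Prop :=
  forall x, ~ T x -> label_set k (V x).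

Definition flow_ctrl x (t s : R) : 'rV[R]_m := octrl (V x) t (Num.min s t).

(* Y is the multiflow y_{x,t}, with maximal interval of definition [0, b[. *)
Definition multiflow x (t : R) (b : \bar R) (Y : R -> 'rV[R]_n) : Prop :=
  solution x b (flow_ctrl x t) Y /\
  forall b' Y', solution x b' (flow_ctrl x t) Y' -> (b <= b')%E ->
    (forall s, tdom b s -> Y' s = Y s) -> b' = b.

Definition exit_time (b : \bar R) (Y : R -> 'rV[R]_n) : \bar R :=
  ereal_sup [set s%:E | s in [set s : R | [/\ 0 <= s, (s%:E <= b)%E
                              & forall s', 0 <= s' < s -> ~ T (Y s')]]].

(* The j-th step (from 0) of the sampling procedure, on [p_j, p_(j+1)[. *)
Definition sampling_step (p : nat -> R) alpha y (j : nat) (sigma : \bar R) : Prop :=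
  let x := y (p j) in let t := p j.+1 - p j in
  exists b Y, [/\ multiflow x t b Y,
    sigma = ((p j)%:E + exit_time b Y)%E,
    forall s, p j <= s -> (s%:E < Order.min (p j.+1)%:E sigma)%E ->
      y s = Y (s - p j) /\ alpha s = flow_ctrl x t (s - p j)
  & ((p j.+1)%:E < sigma)%E -> y (p j.+1) = Y t].

(* N is the index (from 0) of the step at which the procedure stops, None if it
   never does; with steps numbered from 1 the stopping index is N + 1.  The
   trajectory and the control are prescribed on [0, S[ only. *)
Definition step_reached (N : option nat) (j : nat) : bool :=
  if N is Some N' then (j <= N')%N else true.

Record sampling_process x p (N : option nat) S alpha y : Prop := {
  samp_start : ~ T x ;
  samp_part : partition p ;
  samp_init : y 0 = x ;
  samp_steps : exists sigma : nat -> \bar R,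
    [/\ forall j, step_reached N j -> sampling_step p alpha y j (sigma j),
        forall j, step_reached N j -> N != Some j -> ((p j.+1)%:E < sigma j)%E
      & if N is Some N' then (sigma N' <= (p N'.+1)%:E)%E /\ S = sigma N'
        else S = +oo%E]
}.

Definition scaled k (delta : k.-tuple R) (p : nat -> R) (N : option nat) y : Prop :=
  forall j, step_reached N j ->
    let dl := nth 0 delta (degree (lab_br (V (y (p j))))).-1 in
    k.-1%:R / k%:R * dl <= p j.+1 - p j <= dl.

End Sampling.

Section Stabilizability.
Variables (k : nat) (V : 'rV[R]_n -> label) (U : 'rV[R]_n -> R).

(* inf {s >= 0 : U (y s) <= c}, with inf over the empty set equal to +oo. *)
Definition hitting_time y (c : R) : \bar R :=
  ereal_inf [set s%:E | s in [set s : R | 0 <= s /\ U (y s) <= c]].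

Record stabilizes (d : R -> R -> k.-tuple R) (Gam phi : R -> R)
    (Tm : R -> R -> R) : Prop := {
  stab_feedback : feedback_generator V k ;
  stab_U : cont_proper_posdef (~` T) U ;
  stab_d : forall a b, 0 < a -> 0 < b -> forall i, 0 < tnth (d a b) i ;
  stab_Gam : class_Kinf Gam ;
  stab_phi : class_Kinf phi ;
  stab_Tm_gt0 : forall a b, 0 < a -> 0 < b -> 0 < Tm a b ;
  stab_Tm_incr : forall a a' b, 0 < a -> a <= a' -> 0 < b -> Tm a b <= Tm a' b ;
  stab_Tm_decr : forall a b b', 0 < a -> 0 < b -> b <= b' -> Tm a b' <= Tm a b ;
  stab_proc : forall r rad x p N S alpha y, 0 < r < rad ->
    sampling_process V x p N S alpha y -> scaled V (d rad r) p N y ->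
    (dist T x <= rad%:E)%E ->
    let ye := ext S y in
    [/\ admissible_pair x S alpha y,
        forall s, 0 <= s -> (dist T (ye s) <= (Gam rad)%:E)%E,
        (hitting_time ye (phi r) <= (Tm rad r)%:E)%E
      & forall tau, 0 < tau -> U (ye tau) <= phi r ->
          forall s, tau <= s -> (dist T (ye s) <= r%:E)%E]
}.

Definition cost_regulated (d : R -> R -> k.-tuple R) (phi Lam : R -> R)
    (Psi : R -> R -> R) : Prop :=
  forall r rad x p N S alpha y, 0 < r < rad ->
    sampling_process V x p N S alpha y -> scaled V (d rad r) p N y ->
    (dist T x <= rad%:E)%E ->
    let ye := ext S y in let t := fine (hitting_time ye (phi r)) in
    (ext S (cost alpha y) t <= (Lam rad * Psi (U x) (U (ye t)))%:E)%E.

End Stabilizability.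

Definition sample_stabilizable (k : nat) : Prop :=
  exists V U d Gam phi Tm, @stabilizes k V U d Gam phi Tm.

(* Degree-k U-sample stabilizability with (Lam * Psi)-regulated cost, for the
   given function phi. *)
Definition sample_stabilizable_cost (k : nat) (U : 'rV[R]_n -> R)
    (phi Lam : R -> R) (Psi : R -> R -> R) : Prop :=
  cost_bound k Lam Psi /\
  exists V d Gam Tm, @stabilizes k V U d Gam phi Tm /\
    cost_regulated V U d phi Lam Psi.

(* Global asymptotic controllability, with an additional requirement P on the
   admissible pairs. *)
Definition GAC_such_that
    (P : 'rV[R]_n -> \bar R -> (R -> 'rV[R]_m) -> (R -> 'rV[R]_n) -> Prop) : Prop :=
  exists (Gam : R -> R) (St : R -> R -> R),
    [/\ forall rad, 0 < rad -> 0 < Gam rad,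
        forall rad r, 0 < r < rad -> 0 < St rad r,
        Gam rad @[rad --> 0^'+] --> 0
      & forall r rad x, 0 < r < rad -> ~ T x -> (dist T x <= rad%:E)%E ->
          exists S alpha y, let ye := ext S y in
          [/\ admissible_pair x S alpha y,
              forall s, 0 <= s -> (dist T (ye s) <= (Gam rad)%:E)%E,
              forall s, St rad r <= s -> (dist T (ye s) <= r%:E)%E,
              dist T (ye s) @[s --> +oo] --> 0%E
            & P x S alpha y]].

Definition GAC : Prop := GAC_such_that (fun _ _ _ _ => True).

Definition GAC_cost (W : 'rV[R]_n -> R) : Prop :=
  cont_proper_posdef (~` T) W /\
  GAC_such_that (fun x S alpha y =>
    (\int[leb]_(s in (tdom S : set (lebR R))) (l (y s) (alpha s))%:E
       <= (W x)%:E)%E).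

End ControlSystem.

(* Lam (phi^-1 (U x)) * Phi (U x), set to 0 where U x = 0. *)
Definition W_bound {R : realType} {n : nat} (Lam phi Phi : R -> R)
    (U : 'rV[R]_n -> R) (x : 'rV[R]_n) : R :=
  if U x == 0 then 0
  else Lam ('pinv_(fun=> 0) [set s : R | 0 <= s] phi (U x)) * Phi (U x).

(* Main.v *)
From HB Require Import structures.
Require Import Defs.
From mathcomp Require Import all_boot all_order all_algebra.
From mathcomp Require Import all_classical all_reals all_analysis.
From mathcomp Require Import measurable_realfun ring lra zify.
Import Order.TTheory GRing.Theory Num.Theory.
Import numFieldNormedType.Exports.
Set Implicit Arguments.
Unset Strict Implicit.
Unset Printing Implicit Defensive.
Local Open Scope classical_set_scope.
Local Open Scope ring_scope.

(** Both parts concatenate pieces of sampling trajectories.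
    Fix levels rho_0 > rho_1 > ... tending to 0.  From the current point, at
    distance at most rho_i from the target, run a sampling process for the pair
    (rho_i, rho_(i+1)) and stop it as soon as U reaches phi(rho_(i+1)).  Stability
    (iii) forces d(z) <= r whenever U(z) <= phi(r), so the next stage may start from
    the point reached; each stage takes time at most T(rho_i, rho_(i+1)) and stays
    within Gamma(rho_i) of the target.  For (i) the levels are R, r_1, r_1/2, ...
    For (ii) they are phi^-1(U(x)), phi^-1(u_(i+1)), phi^-1(u_(i+2)), ..., where
    u_(i+1) < U(x) <= u_i: as U decreases through exactly these values, the stage
    costs add up to at most Lambda(phi^-1(U(x))) Phi_0(U(x)).

    Sampling processes exist because oriented controls are piecewise constant, so
    that Picard's theorem on each piece and Zorn's lemma give maximal solutions. *)

(** * Local existence for Lipschitz vector fields *)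

(** Gluing dictates the notion of trajectory: [traj] asks, at every time, for a right derivative and
    left continuity, both local conditions. Absolute continuity, the ODE almost everywhere and
    measurability are deduced afterwards, from the countability of the times at which the control is
    not locally constant.

    Multiflows are maximal among all Caratheodory solutions, not only among such trajectories; the
    gap is closed by the unboundedness of a maximal trajectory with finite life. Stages may have
    length zero, so the gluing must allow empty slots [[p j, p j.+1[].

    The functions [d] and [U] must control each other: compactness of the boundary bounds [U] on the
    points outside the target within a given distance, and [U <= phi r] bounds [d]. In (ii) the
    levels depend on the starting point, so a uniform settling time is obtained by counting terms of
    [u] between the largest possible value of [U] and a value good for [r]. *)

Section norms.
Context {R : realType} {n : nat}.
Implicit Types x y : 'rV[R]_n.

Lemma normv_le x (e : R) : 0 <= e -> (`|x| <= e) = [forall i, `|x ord0 i| <= e].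
Proof.
move=> e0; rewrite [`|x|]mx_normrE; apply/idP/forallP => [/bigmax_leP[_ H] i|H].
  exact: (H (ord0, i)).
by apply/bigmax_leP; split => // -[i j] _ /=; rewrite (ord1 i).
Qed.

Lemma coord_le_normv x i : `|x ord0 i| <= `|x|.
Proof. by move: (lexx `|x|); rewrite {1}normv_le// => /forallP. Qed.

End norms.

Lemma continuous_lip {R : realType} {V W : normedModType R} (g : V -> W) (L : R) :
  0 <= L -> (forall a b, `|g a - g b| <= L * `|a - b|) -> continuous g.
Proof.
move=> L0 gL x; apply/cvgrPdist_lt => e e0.
have M1 : 0 < L + 1 by lra.
near=> t; apply: le_lt_trans (gL _ _) _.
apply: (@le_lt_trans _ _ ((L + 1) * `|x - t|)); first by rewrite ler_wpM2r// lerDl.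
rewrite mulrC -ltr_pdivlMr//; near: t.
by apply: (@cvgr_dist_lt _ V); [exact: cvg_id|rewrite divr_gt0].
Unshelve. all: by end_near. Qed.

(** * A mean value inequality by real induction *)

Section continuous_induction.
Context {R : realType} {V : normedModType R}.
Implicit Types y : R -> V.

(** Left continuity puts the supremum of the times where the bound holds into that set of times, and
    the right bound pushes past it unless it is [b]. This is a mean value inequality for functions
    known through estimates to the right. *)
Lemma continuous_induction y (C a b : R) : a <= b ->
  (forall s, a < s <= b -> forall e, 0 < e -> exists2 h, 0 < h &
    forall s', a <= s' -> s - h < s' <= s -> `|y s' - y s| < e) ->
  (forall s, a <= s < b -> exists2 h, 0 < h &
    forall s', s <= s' < s + h -> `|y s' - y s| <= C * (s' - s)) ->
  `|y b - y a| <= C * (b - a).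
Proof.
move=> ab lc rc.
pose E := [set s : R | a <= s <= b /\ `|y s - y a| <= C * (s - a)].
have Ea : E a by split; rewrite ?lexx ?ab// !subrr normr0 mulr0.
have hE : has_sup E.
  by split; [exists a | exists b => s [/andP[]]].
set c := sup E.
have ac : a <= c by apply: sup_upper_bound.
have cb : c <= b by apply: ge_sup; [exists a|move=> s [/andP[]]].
have Ec : E c.
  split; first by rewrite ac cb.
  apply/ler_addgt0Pr => e e0.
  have [<-|ac'] := eqVneq a c.
    by rewrite !subrr normr0 mulr0 add0r ltW.
  have {}ac' : a < c by rewrite lt_neqAle ac' ac.
  have e30 : 0 < e / 2 by rewrite divr_gt0.
  have [||h h0 H] := lc c _ (e / 2) => //; first by rewrite ac' cb.
  have C0 : 0 < `|C| + 1 by rewrite ltr_wpDl.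
  (* [C] may be negative, hence [|C| + 1]; both errors, in [y] and in [C * (s - a)], are then at
     most [e / 2]. *)
  set h' := Num.min h (e / 2 / (`|C| + 1)).
  have h'0 : 0 < h' by rewrite lt_min h0 divr_gt0.
  have [s [Es1 Es2] cs] := sup_adherent h'0 hE.
  have sc : s <= c by apply: sup_upper_bound => //; split.
  have := H s; rewrite (andP Es1).1 sc andbT => /(_ erefl).
  have -> : c - h < s.
    by apply: le_lt_trans cs; rewrite lerB// ge_min lexx.
  move=> /(_ erefl) ysc.
  have : `|y c - y a| <= `|y s - y c| + `|y s - y a|.
    by rewrite (distrC (y s)); apply: ler_distD.
  move=> /le_trans; apply.
  have K : C * (s - a) <= C * (c - a) + e / 2.
    rewrite -lerBlDl -mulrBr.
    have -> : s - a - (c - a) = - (c - s) by ring.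
    apply: (le_trans (ler_norm _)); rewrite normrM normrN.
    rewrite (ger0_norm (x := c - s)) ?subr_ge0//.
    have : c - s <= e / 2 / (`|C| + 1).
      have : c - s <= h' by rewrite lerBlDl -lerBlDr ltW.
      by move=> /le_trans; apply; rewrite ge_min lexx orbT.
    rewrite ler_pdivlMr// => /(le_trans _); apply.
    by rewrite mulrC ler_wpM2l ?subr_ge0// lerDl.
  apply: (le_trans (lerD (ltW ysc) (le_trans Es2 K))).
  by rewrite [leRHS](_ : _ = e / 2 + (C * (c - a) + e / 2))//; field.
have [cb'|cb'] := eqVneq c b; first by rewrite -cb'; case: Ec.
have {}cb' : c < b by rewrite lt_neqAle cb' cb.
have [|h h0 H] := rc c; first by rewrite ac.
set s := Num.min b (c + h / 2).
have cs : c < s by rewrite lt_min cb' ltrDl divr_gt0.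
have : E s.
  split; first by rewrite (le_trans ac (ltW cs)) /= ge_min lexx.
  have -> : C * (s - a) = C * (s - c) + C * (c - a) by ring.
  apply: (le_trans (ler_distD (y c) _ _)); apply: lerD; last by case: Ec.
  apply: H; rewrite (ltW cs)/=.
  rewrite gt_min ltrD2l; apply/orP; right; lra.
by move=> /(sup_upper_bound hE); rewrite leNgt cs.
Qed.

End continuous_induction.

(** * Primitives and Picard iteration *)

Section picard.
Context {R : realType} {n : nat}.
Notation mu := (@lebesgue_measure R).

Lemma primitive_ex (phi : R -> R) : continuous phi ->
  exists Phi : R -> R, Phi 0 = 0 /\ forall x : R, 0 <= x -> is_derive x 1 Phi (phi x).
Proof.
move=> cphi.
(* Integrating from -1 makes every [x >= 0] interior, so the derivative at 0 is two-sided;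
   subtracting [F 0] normalizes. *)
pose F (x : R) : R := (\int[mu]_(t in [set` `[(-1)%R, x]%R]) (phi t))%R.
exists (fun x => F x - F 0); split; first by rewrite subrr.
move=> x x0.
have itg : mu.-integrable `[(-1)%R, (x+1)%R] (EFin \o phi).
  apply: continuous_compact_integrable; first exact: segment_compact.
  by apply: continuous_subspaceT.
have [D1 D2] : derivable F x 1 /\ derive1 F x = phi x.
  apply: (@continuous_FTC1 R phi (BLeft (-1)%R) x (x + 1)) => //.
  - by rewrite ltrDl.
  - by rewrite lte_fin; lra.
  - exact: cphi.
have DF : is_derive x 1 F (phi x) by apply: (DeriveDef D1); rewrite -derive1E.
by have := @is_deriveB _ _ _ F (fun=> F 0) x 1 _ _ DF (is_derive_cst _ _ _); rewrite subr0.
Qed.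

Lemma primitive_dist (phi psi Phi Psi : R -> R) (s t e : R) : s <= t ->
  (forall x : R, s <= x <= t -> is_derive x 1 Phi (phi x)) ->
  (forall x : R, s <= x <= t -> is_derive x 1 Psi (psi x)) ->
  (forall x, s <= x <= t -> `|phi x - psi x| <= e) ->
  `|(Phi t - Phi s) - (Psi t - Psi s)| <= e * (t - s).
Proof.
move=> st d1 d2 H.
have d3 (x : R) : s <= x <= t -> is_derive x 1 (Phi - Psi) (phi x - psi x).
  by move=> sx; have := is_deriveB (d1 _ sx) (d2 _ sx).
have [||c ct E] := @MVT_segment R (Phi - Psi) (fun x => phi x - psi x) s t st.
- move=> x /[!in_itv]/= /andP[sx xt]; apply: d3; lra.
- apply: derivable_within_continuous => x /[!in_itv]/= sx.
  by have [] := d3 _ sx.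
have -> : (Phi t - Phi s) - (Psi t - Psi s) = (phi c - psi c) * (t - s).
  by rewrite -E/= !fctE/=; ring.
rewrite normrM (ger0_norm (x := t - s)) ?subr_ge0//.
by rewrite ler_wpM2r ?subr_ge0// H// -in_itv.
Qed.

(** Coordinates suffice because rows carry the maximum norm: the scalar mean value theorem in each
    coordinate gives the vector estimate with the same constant. *)
Definition is_prim (Phi phi : R -> 'rV[R]_n) := forall (j : 'I_n) (x : R),
  0 <= x -> is_derive x 1 (fun s => Phi s ord0 j) (phi x ord0 j).

Lemma is_prim_linear (c : 'rV[R]_n) : is_prim (fun s => s *: c) (fun=> c).
Proof.
move=> j x _; rewrite (_ : (fun s : R => _) = (fun s : R => s * c ord0 j)); last first.
  by apply/funext => s; rewrite mxE.
have := @is_deriveM R _ id (fun=> c ord0 j) x 1 _ _ (is_derive_id _ _) (is_derive_cst _ _ _).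
by rewrite /= scaler0 add0r /GRing.scale/= mulr1.
Qed.

Lemma is_prim_ex (phi : R -> 'rV[R]_n) : continuous phi ->
  exists2 Phi, Phi 0 = 0 & is_prim Phi phi.
Proof.
move=> cphi.
have H (j : 'I_n) : continuous (fun s => phi s ord0 j).
  move=> s; apply: (@continuous_comp _ _ _ phi (fun v : 'rV[R]_n => v ord0 j)).
    exact: cphi.
  exact: coord_continuous.
have /choice[P HP] := fun j => primitive_ex (phi := fun s => phi s ord0 j) (H j).
exists (fun s => \row_j P j s).
  by apply/rowP => j; rewrite !mxE (HP j).1.
move=> j x x0; rewrite (_ : (fun s : R => _) = P j); first exact: (HP j).2.
by apply/funext => s; rewrite mxE.
Qed.

Lemma is_prim_dist (Phi phi Psi psi : R -> 'rV[R]_n) (s t e : R) :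
  is_prim Phi phi -> is_prim Psi psi -> 0 <= s -> s <= t -> 0 <= e ->
  (forall x, s <= x <= t -> `|phi x - psi x| <= e) ->
  `|(Phi t - Phi s) - (Psi t - Psi s)| <= e * (t - s).
Proof.
move=> p1 p2 s0 st e0 H; rewrite normv_le ?mulr_ge0 ?subr_ge0//.
apply/forallP => j; rewrite !mxE.
apply: (@primitive_dist (fun x => phi x ord0 j) (fun x => psi x ord0 j)
  (fun x => Phi x ord0 j) (fun x => Psi x ord0 j)) => // x xst.
- by apply: p1; apply: le_trans s0 _; case/andP: xst.
- by apply: p2; apply: le_trans s0 _; case/andP: xst.
- by apply: le_trans (H x xst); have := coord_le_normv (phi x - psi x) j; rewrite !mxE.
Qed.

Lemma geometric_limit (v : nat -> 'rV[R]_n) (A : R) : 0 <= A ->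
  (forall k, `|v k.+1 - v k| <= A / 2 ^+ k) ->
  exists l, forall k, `|l - v k| <= 2 * A / 2 ^+ k.
Proof.
move=> A0 H.
have B k p : `|v (k + p)%N - v k| <= 2 * A / 2 ^+ k.
  (* The factor [1 - 2^-p] comes from the exact geometric partial sum, with which the induction on
     [p] closes. *)
  suff : `|v (k + p)%N - v k| <= 2 * A / 2 ^+ k * (1 - (2 ^+ p)^-1).
    by move/le_trans; apply; rewrite ler_piMr// ?divr_ge0 ?mulr_ge0.
  elim: p => [|p IH]; first by rewrite addn0 subrr normr0 expr0 invr1 subrr mulr0.
  rewrite addnS; apply: le_trans (ler_distD (v (k + p)%N) _ _) _.
  apply: le_trans (lerD (H _) IH) _.
  rewrite exprD exprS le_eqVlt; apply/orP; left; apply/eqP.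
  by field; rewrite !expf_neq0.
have /cauchy_cvgP C : cauchy (v k @[k --> \oo]).
  apply: cauchy_exP => e e0.
  have [N _ HN] : \forall k \near \oo, 2 * A / 2 ^+ k < e.
    have /cvgrPdist_lt : (2 * A) * (2^-1 ^+ k) @[k --> \oo] --> (2 * A) * 0.
      by apply: cvgMr; apply: cvg_expr; rewrite ger0_norm ?invr_ge0//; lra.
    rewrite mulr0 => /(_ _ e0); apply: filterS => k.
    rewrite sub0r normrN exprVn ger0_norm// ?mulr_ge0 ?invr_ge0 ?exprn_ge0//.
  exists (v N); exists N => // k /= Nk.
  rewrite -ball_normE /= distrC -(subnKC Nk).
  exact: le_lt_trans (B _ _) (HN N (leqnn N)).
exists (lim (v k @[k --> \oo])) => k.
apply/ler_addgt0Pr => e e0.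
move/cvgrPdist_lt : C => /(_ _ e0) [N _ HN].
have := HN (k + N)%N (leq_addl _ _) => /= E.
apply: le_trans (ler_distD (v (k + N)%N) _ _) _.
by rewrite addrC lerD// ltW.
Qed.

(** As [L * h <= 1/2], the integral operator halves distances and its iterates converge
    geometrically. The solution is described by a quadratic remainder instead of a derivative:
    dividing by [t - s] gives right derivatives, at the starting time as well. *)
Lemma picard (g : 'rV[R]_n -> 'rV[R]_n) (L M h : R) (z : 'rV[R]_n) :
  0 <= L -> 0 <= M -> 0 < h -> L * h <= 2^-1 ->
  (forall a b, `|g a - g b| <= L * `|a - b|) -> (forall a, `|g a| <= M) ->
  exists Y : R -> 'rV[R]_n, Y 0 = z /\ forall s t, 0 <= s -> s <= t -> t <= h ->
    `|Y t - Y s - (t - s) *: g (Y s)| <= L * M * (t - s) ^+ 2.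
Proof.
move=> L0 M0 h0 Lh gL gM.
(* Clamping time to [[0, h]] makes the iterates continuous on the whole line, as [is_prim_ex]
   requires. *)
pose cl (t : R) := Num.max 0 (Num.min t h).
have cl01 t : 0 <= cl t <= h.
  by rewrite /cl le_max lexx/= ge_max (ltW h0) ge_min lexx orbT.
have clE t : 0 <= t <= h -> cl t = t.
  by case/andP => t0 th; rewrite /cl min_l// max_r.
have cl_incr s t : s <= t -> cl s <= cl t.
  move=> st; rewrite /cl ge_max le_max lexx/= le_max; apply/orP.
  have [sh|sh] := leP s h; first by right; rewrite le_min st.
  by right; rewrite le_min lexx (le_trans (ltW sh) st).
have cl_lip s t : s <= t -> cl t - cl s <= t - s.
  move=> st; rewrite /cl.
  case: (leP t h) => ?; case: (leP s h) => ?; rewrite ?(max_r (ltW h0)) ?/Num.max;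
  do ?[case: ifPn; rewrite -?leNgt => ?]; lra.
pose lipM (y : R -> 'rV[R]_n) := forall s t, s <= t -> `|y t - y s| <= M * (t - s).
have lip_cont y : lipM y -> continuous y.
  move=> yM s; apply/cvgrPdist_lt => e e0.
  have M1 : 0 < M + 1 by lra.
  exists (e / (M + 1)); first by rewrite /= divr_gt0.
  move=> t /=; rewrite ltr_pdivlMr// => st.
  apply: le_lt_trans st.
  have H : `|y s - y t| <= M * `|s - t|.
    have [ts|/ltW ts] := leP t s; first by rewrite (ger0_norm (x := s - t)) ?subr_ge0// yM.
    by rewrite distrC (distrC s) (ger0_norm (x := t - s)) ?subr_ge0// yM.
  by apply: le_trans H _; rewrite mulrC ler_wpM2l// lerDl.
have cg : continuous g := continuous_lip L0 gL.
have gcont y : lipM y -> continuous (g \o y).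
  by move=> /lip_cont cy s; apply: continuous_comp; [exact: cy|exact: cg].
have /choice[I HI] : forall v : R -> 'rV[R]_n, exists Phi : R -> 'rV[R]_n,
    continuous v -> Phi 0 = 0 /\ is_prim Phi v.
  move=> v; have [cv|] := pselect (continuous v); last by exists v.
  by have [Phi ? ?] := is_prim_ex cv; exists Phi.
pose P (y : R -> 'rV[R]_n) t := z + I (g \o y) (cl t).
have PM y : lipM y -> lipM (P y).
  move=> yM s t st; have [_ H] := HI _ (gcont _ yM).
  have := is_prim_dist H (is_prim_linear 0) (andP (cl01 s)).1 (cl_incr _ _ st) M0.
  rewrite !scaler0 !subr0 => K.
  have -> : P y t - P y s = I (g \o y) (cl t) - I (g \o y) (cl s).
    by rewrite /P opprD addrACA subrr add0r.
  apply: le_trans (K _) _; first by move=> x _; rewrite subr0 gM.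
  by rewrite ler_wpM2l// cl_lip.
have Pc y w e : lipM y -> lipM w -> 0 <= e -> (forall t, `|y t - w t| <= e) ->
    forall t, `|P y t - P w t| <= e / 2.
  move=> yM wM e0 yw t.
  have [I1 H1] := HI _ (gcont _ yM); have [I2 H2] := HI _ (gcont _ wM).
  have := is_prim_dist H1 H2 (lexx 0) (andP (cl01 t)).1 (mulr_ge0 L0 e0).
  rewrite I1 I2 !subr0 => K.
  have -> : P y t - P w t = I (g \o y) (cl t) - I (g \o w) (cl t).
    by rewrite /P opprD addrACA subrr add0r.
  apply: le_trans (K _) _.
    by move=> x _ /=; apply: le_trans (gL _ _) _; rewrite ler_wpM2l.
  rewrite mulrAC mulrC ler_wpM2l//.
  by apply: le_trans Lh; rewrite ler_wpM2l//; case/andP: (cl01 t).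
pose y k := iter k P (fun=> z).
have yM k : lipM (y k).
  elim: k => [|k IH]; last by rewrite /y iterS; apply: PM.
  by move=> s t st; rewrite subrr normr0 mulr_ge0// subr_ge0.
have Mh : 0 <= M * h by rewrite mulr_ge0// ltW.
have yd k t : `|y k.+1 t - y k t| <= M * h / 2 ^+ k.
  elim: k t => [|k IH] t.
    rewrite /y /= expr0 divr1.
    have [I1 H1] := HI _ (gcont _ (yM 0%N)).
    have := is_prim_dist H1 (is_prim_linear 0) (lexx 0) (andP (cl01 t)).1 M0.
    rewrite I1 !scaler0 !subr0 => K.
    rewrite /P addrAC subrr add0r.
    apply: le_trans (K _) _; first by move=> x _; rewrite subr0 gM.
    by rewrite ler_wpM2l//; case/andP: (cl01 t).
  have := Pc _ _ _ (yM k.+1) (yM k) _ IH t; rewrite /y -!iterS => K.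
  apply: le_trans (K _) _; first by rewrite divr_ge0// exprn_ge0.
  by rewrite exprSr invfM mulrA.
have /choice[Y HY] : forall t, exists l, forall k, `|l - y k t| <= 2 * (M * h) / 2 ^+ k.
  by move=> t; apply: geometric_limit.
have small e : 0 < e -> exists k, 2 * (M * h) / 2 ^+ k <= e.
  move=> e0.
  have /cvgrPdist_lt : (2 * (M * h)) * (2^-1 ^+ k) @[k --> \oo] --> (2 * (M * h)) * 0.
    by apply: cvgMr; apply: cvg_expr; rewrite ger0_norm ?invr_ge0//; lra.
  rewrite mulr0 => /(_ _ e0) [N _ /(_ N (leqnn N))].
  rewrite /= sub0r normrN exprVn => /ltW /(le_trans (ler_norm _)) ?.
  by exists N.
have YM : lipM Y.
  move=> s t st; apply/ler_addgt0Pr => e e0.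
  have [k Hk] := small (e / 2) (divr_gt0 e0 (ltr0Sn _ _)).
  rewrite [Y t - Y s](_ : _ = (Y t - y k t) - (Y s - y k s) + (y k t - y k s)); last first.
    by apply/rowP => j; rewrite !mxE; ring.
  apply: le_trans (ler_normD _ _) _; rewrite addrC lerD ?yM//.
  apply: le_trans (ler_normB _ _) _.
  by rewrite [leRHS](_ : _ = e/2 + e/2) ?lerD// ?(le_trans (HY _ _))//; field.
have [I1 H1] := HI _ (gcont _ YM).
have YP t : Y t = P Y t.
  apply/eqP; rewrite -subr_eq0 -normr_le0; apply/ler_addgt0Pr => e e0; rewrite add0r.
  have [k Hk] := small (e / 2) (divr_gt0 e0 (ltr0Sn _ _)).
  apply: le_trans (ler_distD (y k.+1 t) _ _) _.
  rewrite [leRHS](_ : _ = e/2 + e/2); last by field.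
  have A0 : 0 <= 2 * (M * h) / 2 ^+ k by rewrite divr_ge0 ?exprn_ge0// mulr_ge0.
  apply: lerD.
    apply: le_trans (HY _ _) (le_trans _ Hk).
    rewrite [leLHS](_ : _ = 2 * (M * h) / 2 ^+ k / 2).
      by rewrite ler_pdivrMr// ler_peMr// ler1n.
    by rewrite exprSr; field; rewrite expf_neq0.
  have := Pc _ _ _ (yM k) YM A0 _ t; rewrite /y -iterS => K.
  apply: le_trans (K _) _; first by move=> x; rewrite distrC HY.
  by apply: le_trans Hk; rewrite ler_pdivrMr// ler_peMr// ler1n.
exists Y; split.
  by rewrite YP /P clE ?I1 ?addr0// lexx ltW.
move=> s t s0 st th.
have sh : s <= h := le_trans st th.
have t0 : 0 <= t := le_trans s0 st.
(* Between [s] and [t] the integrand [g (Y x)] differs from [g (Y s)] by at most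
   [L * (M * (t - s))], as [Y] is [M]-Lipschitz; integration gives the square. *)
have := is_prim_dist H1 (is_prim_linear (g (Y s))) s0 st (e := L * (M * (t - s))).
rewrite -scalerBl => K.
rewrite {1}(YP t) {1}(YP s) /P !clE ?s0 ?t0// opprD addrACA subrr add0r.
apply: le_trans (K _ _) _.
- by rewrite !mulr_ge0// subr_ge0.
- move=> x /andP[sx xt] /=; apply: le_trans (gL _ _) _.
  by rewrite ler_wpM2l// (le_trans (YM _ _ sx))// ler_wpM2l// lerD2r.
- by rewrite expr2 !mulrA.
Qed.

End picard.

(** * Trajectories of piecewise constant controls *)

Section trajectories.
Context {R : realType} {n m : nat}.
Variable f : 'I_m -> 'rV[R]_n -> 'rV[R]_n.
Implicit Types (S : \bar R) (alpha : R -> 'rV[R]_m) (y : R -> 'rV[R]_n).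

Definition vfield (a : 'rV[R]_m) (x : 'rV[R]_n) := \sum_i a ord0 i *: f i x.

Definition lip_on_balls := forall r : R, exists2 L, 0 <= L &
  forall i x z, `|x| <= r -> `|z| <= r -> `|f i x - f i z| <= L * `|x - z|.

(* The right derivative, unlike the derivative, survives the concatenation of
   trajectories without exceptional times. *)
Definition right_ode alpha y (s : R) := exists a : 'rV[R]_m,
  [/\ `|a| <= 1,
     exists2 h, 0 < h & forall s', s < s' < s + h -> alpha s' = a
   & forall e, 0 < e -> exists2 h, 0 < h & forall s', s <= s' < s + h ->
       `|y s' - y s - (s' - s) *: vfield a (y s)| <= e * (s' - s)].

(** Continuity from the right is contained in [right_ode]. The sides are kept apart because at a
    junction they belong to different pieces. *)
Definition left_cont y (s : R) := forall e, 0 < e -> exists2 h, 0 < h &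
  forall s', 0 <= s' -> s - h < s' <= s -> `|y s' - y s| < e.

Definition traj S alpha y := forall s, tdom S s ->
  right_ode alpha y s /\ (0 < s -> left_cont y s).

Hypothesis f_lip : lip_on_balls.

(** One constant serves all controls and both estimates: the coordinates of [a] are at most 1 in
    absolute value, and [f i x] is bounded through [f i 0] and the Lipschitz constant. The radius
    [|r|] puts 0 in the ball. *)
Lemma vfield_lip (r : R) : exists2 K, 0 <= K & forall a, `|a| <= 1 ->
  (forall x, `|x| <= r -> `|vfield a x| <= K) /\
  (forall x z, `|x| <= r -> `|z| <= r -> `|vfield a x - vfield a z| <= K * `|x - z|).
Proof.
have [L L0 HL] := f_lip `|r|.
have rr := ler_norm r.
pose B := \sum_i (`|f i 0| + L * `|r|).
have B0 : 0 <= B by apply: sumr_ge0 => i _; rewrite addr_ge0// mulr_ge0.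
exists (B + m%:R * L); first by rewrite addr_ge0// mulr_ge0.
move=> a a1; have ai i : `|a ord0 i| <= 1 := le_trans (coord_le_normv a i) a1.
split=> [x xr|x z xr zr].
  apply: (@le_trans _ _ B); last by rewrite lerDl mulr_ge0.
  apply: le_trans (ler_norm_sum _ _ _) _; apply: ler_sum => i _.
  rewrite normrZ; apply: (@le_trans _ _ `|f i x|).
    by rewrite ler_piMl// ai.
  have := HL i x 0; rewrite normr0 subr0 => /(_ (le_trans xr rr) (normr_ge0 _)) H.
  rewrite -[f i x](subrK (f i 0)); apply: le_trans (ler_normD _ _) _.
  by rewrite addrC lerD2l (le_trans H)// ler_wpM2l// (le_trans xr).
rewrite /vfield -sumrB; apply: le_trans (ler_norm_sum _ _ _) _.
apply: (@le_trans _ _ (\sum_(i < m) (L * `|x - z|))); last first.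
  rewrite [leLHS](_ : _ = m%:R * L * `|x - z|); last first.
    by rewrite sumr_const card_ord -[in RHS]mulrA mulr_natl.
  by rewrite ler_wpM2r// lerDr.
apply: ler_sum => i _; rewrite -scalerBr normrZ.
apply: (@le_trans _ _ `|f i x - f i z|); first by rewrite ler_piMl// ai.
by apply: HL; apply: le_trans rr.
Qed.

Lemma tdom_le S s t : 0 <= s -> s <= t -> tdom S t -> tdom S s.
Proof. by move=> s0 st [_ tS]; split => //; apply: le_lt_trans tS; rewrite lee_fin. Qed.

Lemma tdom_right S s : tdom S s -> exists2 h, 0 < h & forall s', 0 <= s' -> s' < s + h -> tdom S s'.
Proof.
case: S => [S|_|[_]//]; last by exists 1 => // s' ? _; split => //; rewrite ltry.
move=> [s0]; rewrite lte_fin => sS; exists (S - s); first by rewrite subr_gt0.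
by move=> s' s'0; rewrite addrC subrK => ?; split => //; rewrite lte_fin.
Qed.

(** The extra 1 is the error that [right_ode] leaves with tolerance 1. *)
Lemma right_ode_bound alpha y s (r : R) : right_ode alpha y s -> `|y s| <= r ->
  forall K, (forall a, `|a| <= 1 -> forall x, `|x| <= r -> `|vfield a x| <= K) ->
  exists2 h, 0 < h & forall s', s <= s' < s + h -> `|y s' - y s| <= (K + 1) * (s' - s).
Proof.
move=> [a [a1 _ H]] yr K HK; have [h h0 Hh] := H 1 ltr01; exists h => // s' ss'.
rewrite -[y s' - y s](subrK ((s' - s) *: vfield a (y s))).
apply: le_trans (ler_normD _ _) _; rewrite mulrDl addrC lerD// ?Hh//.
case/andP : ss' => ss' _.
by rewrite normrZ ger0_norm ?subr_ge0// mulrC ler_wpM2r ?subr_ge0// HK.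
Qed.

Lemma traj_right_cont S alpha y s : traj S alpha y -> tdom S s ->
  forall e, 0 < e -> exists2 h, 0 < h & forall s', s <= s' < s + h -> `|y s' - y s| < e.
Proof.
move=> ty sS e e0; have [ode _] := ty _ sS.
have [K K0 HK] := vfield_lip `|y s|.
have [h h0 Hh] := right_ode_bound ode (lexx _) (fun a a1 => (HK a a1).1).
have K1 : 0 < K + 1 by lra.
exists (Num.min h (e / (K + 1))); first by rewrite lt_min h0 divr_gt0.
move=> s' /andP[ss']; rewrite -ltrBlDl lt_min => /andP[s'h s'e].
apply: le_lt_trans (Hh _ _) _; first by rewrite ss' -ltrBlDl.
by rewrite mulrC -ltr_pdivlMr.
Qed.

Lemma traj_cont S alpha y s : traj S alpha y -> tdom S s ->
  forall e, 0 < e -> exists2 h, 0 < h &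
  forall s', 0 <= s' -> s - h < s' < s + h -> `|y s' - y s| < e.
Proof.
move=> ty sS e e0; have [h h0 Hh] := traj_right_cont ty sS e0.
have [s0|s0] := ltP 0 s; last first.
  exists h => // s' s'0 /andP[_ s'h]; apply: Hh; rewrite s'h andbT.
  exact: le_trans s0 _.
have [h' h'0 Hh'] := (ty _ sS).2 s0 _ e0.
exists (Num.min h h'); first by rewrite lt_min h0.
move=> s' s'0; rewrite ltrBlDr -ltrBlDl -ltrBlDl !lt_min => /andP[/andP[_ ?] /andP[? _]].
have [ss'|ss'] := leP s s'; first by apply: Hh; rewrite ss' -ltrBlDl.
by apply: Hh' => //; rewrite (ltW ss') andbT; lra.
Qed.

Lemma traj_within_cont S alpha y c : traj S alpha y -> tdom S c ->
  {within `[0, c], continuous y}.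
Proof.
move=> ty cS; apply/subspace_continuousP => s /= /[!in_itv]/= /andP[s0 sc].
apply/cvgrPdist_lt => e e0.
have [h h0 Hh] := traj_cont ty (tdom_le s0 sc cS) e0.
rewrite near_withinE; exists h => // s' /= ss' /[!in_itv]/= /andP[s'0 _].
by rewrite distrC Hh//; move: ss'; rewrite ltr_norml; lra.
Qed.

Lemma traj_bounded S alpha y c : traj S alpha y -> tdom S c ->
  exists r, forall s, 0 <= s <= c -> `|y s| <= r.
Proof.
move=> ty cS; have := continuous_compact (traj_within_cont ty cS) (@segment_compact _ 0 c).
move=> /compact_bounded[M [_ HM]]; exists (M + 1) => s sc.
by apply: (HM (M + 1)); [rewrite ltrDl|exists s => //; rewrite /= in_itv].
Qed.

Lemma traj_lip S alpha y (r K u v : R) : traj S alpha y ->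
  (forall a, `|a| <= 1 -> forall x, `|x| <= r -> `|vfield a x| <= K) ->
  0 <= u -> u <= v -> tdom S v -> (forall s, u <= s <= v -> `|y s| <= r) ->
  `|y v - y u| <= (K + 1) * (v - u).
Proof.
move=> ty HK u0 uv vS yr; apply: continuous_induction => // s /andP[us sv].
  move=> e e0; have sS : tdom S s by apply: tdom_le vS => //; apply: le_trans u0 (ltW us).
  have [h h0 Hh] := traj_cont ty sS e0; exists h => // s' us' /andP[ss' s's].
  by apply: Hh; [exact: le_trans us'|rewrite ss'/= (le_lt_trans s's)// ltrDl].
have sS : tdom S s by apply: tdom_le vS; [exact: le_trans us|exact: ltW].
by apply: right_ode_bound HK; [exact: (ty _ sS).1|apply: yr; rewrite us ltW].
Qed.

(** Staying in a ball makes the trajectory Lipschitz by [traj_lip], hence Cauchy at [b]. *)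
Lemma traj_limit (b : R) alpha y (r : R) : 0 < b -> traj b%:E alpha y ->
  (forall s, 0 <= s < b -> `|y s| <= r) -> cvg (y s @[s --> b^'-]).
Proof.
move=> b0 ty yr; have [K K0 HK] := vfield_lip r.
apply/cauchy_cvgP; apply: cauchy_exP => e e0.
have K1 : 0 < K + 1 by lra.
pose h := Num.min b (e / (K + 1)).
have h0 : 0 < h by rewrite lt_min b0 divr_gt0.
have hb : h <= b by rewrite ge_min lexx.
exists (y (b - h)).
have : \forall s \near b^'-, b - h < s < b.
  near=> s; apply/andP; split; near: s; first by apply: nbhs_left_gt; rewrite ltrBlDr ltrDl.
  exact: nbhs_left_lt.
apply: filterS => s /andP[hs sb]; rewrite -ball_normE/= distrC.
apply: (@le_lt_trans _ _ ((K + 1) * (s - (b - h)))).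
  apply: (traj_lip ty (fun a a1 => (HK a a1).1)).
  - by rewrite subr_ge0.
  - exact: ltW.
  - by split; rewrite ?lte_fin// (le_trans _ (ltW hs))// subr_ge0.
  - move=> t /andP[ht ts]; apply: yr; rewrite (le_lt_trans ts)// andbT.
    by apply: le_trans ht; rewrite subr_ge0.
rewrite mulrC -ltr_pdivlMr//; apply: (@lt_le_trans _ _ h); first lra.
by rewrite ge_min lexx orbT.
Unshelve. all: by end_near. Qed.

(** Where the control is constant, all right derivatives near [s] are close to [v], by continuity of
    [y] and of the field. So [y w - w *: v] has small right slopes in a neighbourhood, and
    [continuous_induction] bounds its increments on both sides of [s]. *)
Lemma traj_is_derive S alpha y s h : traj S alpha y -> tdom S s -> 0 < h ->
  (forall s', s - h < s' < s + h -> tdom S s' /\ alpha s' = alpha s) ->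
  is_derive s 1 y (vfield (alpha s) (y s)).
Proof.
move=> ty sS h0 Hh; set v := vfield _ _.
have [K K0 HK] := vfield_lip (`|y s| + 1).
have loc u : s - h < u < s + h -> `|alpha s| <= 1 /\
  forall e, 0 < e -> exists2 h, 0 < h & forall s', u <= s' < u + h ->
       `|y s' - y u - (s' - u) *: vfield (alpha s) (y u)| <= e * (s' - u).
  move=> uh; have [uS _] := Hh _ uh.
  have [[a [a1 [h1 h10 ah1] H]] _] := ty _ uS.
  suff <- : a = alpha s by [].
  (* A point to the right of [u], near enough to see both the constant [a] of [right_ode] and the
     value [alpha s]. *)
  pose w := u + Num.min h1 (s + h - u) / 2.
  have k0 : 0 < Num.min h1 (s + h - u) by rewrite lt_min h10; lra.
  have k1 : Num.min h1 (s + h - u) <= h1 by rewrite ge_min lexx.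
  have k2 : Num.min h1 (s + h - u) <= s + h - u by rewrite ge_min lexx orbT.
  rewrite -(ah1 w); last by rewrite /w; lra.
  by apply: (Hh _ _).2; rewrite /w; lra.
have a1 : `|alpha s| <= 1 by apply: (loc s _).1; lra.
have key e : 0 < e -> exists2 d, 0 < d & forall t, `|t| < d ->
    `|y (s + t) - y s - t *: v| <= e * `|t|.
  move=> e0; have e20 : 0 < e / 2 by rewrite divr_gt0.
  have K1 : 0 < K + 1 by lra.
  (* The bound 1 keeps [y u] in the ball where [K] is valid; the other one makes the field vary by
     at most [e / 2]. *)
  have q0 : 0 < Num.min 1 (e / 2 / (K + 1)) by rewrite lt_min ltr01 divr_gt0.
  have [d1 d10 Hd1] := traj_cont ty sS q0.
  pose d := Num.min h d1.
  have d0 : 0 < d by rewrite lt_min h0.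
  have dh : d <= h by rewrite ge_min lexx.
  have dd1 : d <= d1 by rewrite ge_min lexx orbT.
  have nearv u : s - d < u < s + d -> `|vfield (alpha s) (y u) - v| <= e / 2.
    move=> ud; have uS : tdom S u by apply: (Hh _ _).1; lra.
    have := Hd1 u uS.1; rewrite lt_min => /(_ _)/andP[|y1 y2]; first lra.
    apply: le_trans ((HK _ a1).2 _ _ _ _) _.
    - rewrite -[y u](subrK (y s)) (le_trans (ler_normD _ _))// addrC lerD2l; exact: ltW.
    - by rewrite lerDl.
    - apply: (@le_trans _ _ ((K + 1) * `|y u - y s|)); first by rewrite ler_wpM2r// lerDl.
      by rewrite mulrC -ler_pdivlMr// ltW.
  have incr u w : u <= w -> s - d < u -> w < s + d ->
      `|y w - y u - (w - u) *: v| <= e * (w - u).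
    move=> uw su wd.
    rewrite (_ : _ - _ - _ = (y w - w *: v) - (y u - u *: v)); last first.
      by apply/rowP => j; rewrite !mxE; ring.
    apply: (@continuous_induction _ _ (fun w => y w - w *: v)) => // p /andP[up pw].
      move=> e' e'0; have pS : tdom S p by apply: (Hh _ _).1; lra.
      have e'20 : 0 < e' / 2 by rewrite divr_gt0.
      have [d2 d20 Hd2] := traj_cont ty pS e'20.
      have V1 : 0 < `|v| + 1 by rewrite ltr_wpDl.
      have q'0 : 0 < e' / 2 / (`|v| + 1) by rewrite divr_gt0.
      exists (Num.min d2 (e' / 2 / (`|v| + 1))); first by rewrite lt_min d20.
      move=> s' us'; rewrite ltrBlDr -ltrBlDl lt_min => /andP[/andP[k1 k2] k3].
      rewrite (_ : _ - _ = (y s' - y p) + (p - s') *: v); last first.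
        by apply/rowP => j; rewrite !mxE; ring.
      apply: le_lt_trans (ler_normD _ _) _.
      rewrite [ltRHS](_ : _ = e' / 2 + e' / 2); last by field.
      have s'0 : 0 <= s'.
        by have [|[]] := Hh s'; first lra.
      apply: ltr_leD; first by apply: Hd2 => //; lra.
      rewrite normrZ ger0_norm ?subr_ge0//.
      move: k2; rewrite ltr_pdivlMr// => k2; apply: le_trans (ltW k2).
      by rewrite ler_wpM2l ?subr_ge0// lerDl.
    have [|_ /(_ _ e20)[d2 d20 Hd2]] := loc p; first lra.
    exists (Num.min d2 (s + d - p)); first by rewrite lt_min d20; lra.
    move=> s' /andP[ps']; rewrite -ltrBlDl lt_min => /andP[k1 k2].
    rewrite (_ : _ - _ = (y s' - y p - (s' - p) *: vfield (alpha s) (y p)) +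
      (s' - p) *: (vfield (alpha s) (y p) - v)); last first.
      by apply/rowP => j; rewrite !mxE; ring.
    apply: le_trans (ler_normD _ _) _.
    rewrite [leRHS](_ : _ = e / 2 * (s' - p) + (s' - p) * (e / 2)); last by field.
    apply: lerD; first by apply: Hd2; lra.
    by rewrite normrZ ger0_norm ?subr_ge0// ler_wpM2l ?subr_ge0// nearv//; lra.
  exists d => // t; rewrite ltr_norml => td.
  have [t0|t0] := leP 0 t.
    have := incr s (s + t); rewrite (_ : s + t - s = t); last by ring.
    by rewrite (ger0_norm t0); apply; lra.
  have := incr (s + t) s; rewrite (_ : s - (s + t) = - t) ?(ltr0_norm t0); last by ring.
  move=> H.
  have <- : `|y s - y (s + t) - - t *: v| = `|y (s + t) - y s - t *: v|.
    by rewrite -normrN; congr `|_|; apply/rowP => j; rewrite !mxE; ring.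
  by apply: H; lra.
have lim : (fun t : R => t^-1 *: (y (t *: 1 + s) - y s)) t @[t --> 0^'] --> v.
  apply/cvgrPdist_le => e e0; have [d d0 Hd] := key e e0.
  exists d => // t /=; rewrite sub0r normrN => td t0.
  rewrite (_ : v - _ = t^-1 *: (t *: v - (y (s + t) - y s))); last first.
    by rewrite [RHS]scalerBr scalerA mulVf// scale1r /= [t *: 1]mulr1 [t + s]addrC.
  by rewrite normrZ normfV mulrC ler_pdivrMr ?normr_gt0// -normrN opprB Hd.
apply: DeriveDef; first by apply/cvg_ex; exists v.
by apply: cvg_lim => //; exact: norm_hausdorff.
Qed.

End trajectories.

(** * Lebesgue measurability, and trajectories as Caratheodory solutions *)

Section lebesgue_sets.
Context {R : realType}.

Lemma leb_borel (A : set R) : measurable A -> measurable (A : set (lebR R)).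
Proof. exact: sub_caratheodory. Qed.

Lemma leb_countable (A : set R) : countable A ->
  measurable (A : set (lebR R)) /\ leb (A : set (lebR R)) = 0%E.
Proof.
move=> cA; split; last by rewrite -(countable_lebesgue_measure0 cA).
by apply: leb_borel; apply: countable_measurable => // t; apply: measurable_set1.
Qed.

Lemma leb_tdom (S : \bar R) : measurable (tdom S : set (lebR R)).
Proof.
apply: leb_borel; case: S => [S| |].
- rewrite (_ : tdom _ = `[0, S[%classic); first exact: measurable_itv.
  by apply/seteqP; split=> s /=; rewrite /tdom/= in_itv/= lte_fin => /andP.
- rewrite (_ : tdom _ = `[0, +oo[%classic); first exact: measurable_itv.
  by apply/seteqP; split=> s /=; rewrite /tdom/= in_itv/= andbT ltry => // -[].
- rewrite (_ : tdom _ = set0); first exact: measurable0.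
  by apply/seteqP; split=> s //= [].
Qed.

End lebesgue_sets.

Section trajectory_solution.
Context {R : realType} {n m : nat}.
Variable f : 'I_m -> 'rV[R]_n -> 'rV[R]_n.
Hypothesis f_lip : lip_on_balls f.
Implicit Types (S : \bar R) (alpha : R -> 'rV[R]_m) (y : R -> 'rV[R]_n).

Definition locally_constant S alpha (s : R) := exists2 h, 0 < h &
  forall s', s - h < s' < s + h -> tdom S s' /\ alpha s' = alpha s.

(** Each time has on its right an interval of constancy, in which a rational is chosen. If two
    exceptional times shared it, the later one would lie inside the interval of the earlier one, and
    the control would be locally constant there. *)
Lemma traj_jumps_countable S alpha y : traj f S alpha y ->
  countable (tdom S `\` locally_constant S alpha).
Proof.
move=> ty.
have /choice[q Hq] : forall s, exists q : rat, tdom S s -> exists h a, s < ratr q < s + h /\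
    forall s', s < s' < s + h -> tdom S s' /\ alpha s' = a.
  move=> s; have [sS|//] := pselect (tdom S s); last by exists 0.
  have [[a [_ [h h0 Hh] _]] _] := ty _ sS.
  have [h' h'0 Hh'] := tdom_right sS.
  have ss : s < s + Num.min h h' by rewrite ltrDl lt_min h0.
  have [q] := rat_in_itvoo ss; rewrite in_itv/= => sq; exists q => _.
  exists (Num.min h h'), a; split=> // s' /andP[ss']; rewrite -ltrBlDl lt_min => /andP[k1 k2].
  split; last by apply: Hh; rewrite ss' -ltrBlDl.
  by apply: Hh'; [exact: le_trans sS.1 (ltW ss')|rewrite -ltrBlDl].
apply/countable_injP; exists (fun s => pickle (q s)).
have wl s s' : (tdom S `\` locally_constant S alpha) s ->
    (tdom S `\` locally_constant S alpha) s' -> q s = q s' -> ~ s < s'.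
  move=> [sS _] [s'S bad] qq ss'; apply: bad.
  have [h [a [/andP[h1 h2] h3]]] := Hq _ sS.
  have [h' [a' [/andP[h1' h2'] _]]] := Hq _ s'S.
  rewrite qq in h1 h2.
  exists (Num.min (s' - s) (s + h - s')); first by rewrite lt_min !subr_gt0 ss' (lt_trans h1').
  move=> t; rewrite ltrBlDr -ltrBlDl -ltrBlDl !lt_min => /andP[/andP[? ?] /andP[? ?]].
  have [|tS ->] := h3 t; first lra.
  by split=> //; rewrite (h3 s' _).2//; lra.
move=> s s' /set_mem sB /set_mem s'B /(pcan_inj pickleK) qq.
apply/eqP; case: (ltgtP s s') => // ss'; first by case: (wl _ _ sB s'B qq).
by case: (wl _ _ s'B sB (esym qq)).
Qed.

(** Up to a countable set the preimage is open, the control being constant around each remaining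
    point. *)
Lemma traj_measurable S alpha y i : traj f S alpha y ->
  measurable_fun (tdom S : set (lebR R)) (fun s : lebR R => alpha s ord0 i).
Proof.
move=> ty _ B mB; set A := (X in measurable X).
pose G := A `&` locally_constant S alpha.
have -> : A = G `|` (A `\` locally_constant S alpha).
  by rewrite /G -setIUr setUv setIT.
apply: measurableU.
  apply: leb_borel; apply: measurable_realfun.open_measurable.
  rewrite openE => s [[sS Bs] [h h0 Hh]].
  exists (h / 2); first by rewrite /= divr_gt0.
  move=> t /=; rewrite ltr_norml => st.
  have [|tS at_] := Hh t; first lra.
  split; first by split => //; rewrite /= at_.
  exists (h / 2); first by rewrite divr_gt0.
  by move=> t' tt'; rewrite at_; apply: Hh; lra.
apply: (leb_countable _).1.
apply: sub_countable (traj_jumps_countable ty).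
by apply: subset_card_le => s [[sS _] ?]; split.
Qed.

(** Absolute continuity holds because a trajectory is Lipschitz on each [[0, c]]; the ODE holds off
    the countable set of [traj_jumps_countable]. *)
Lemma traj_solution S alpha y : (0 < S)%E -> traj f S alpha y ->
  solution f (y 0) S alpha y.
Proof.
move=> S0 ty; split => //.
  move=> c cS e e0; have [r yr] := traj_bounded f_lip ty cS.
  have [K K0 HK] := vfield_lip f_lip r.
  have K1 : 0 < K + 1 by lra.
  exists (e / (K + 1)); first by rewrite divr_gt0.
  move=> N u v uv _; rewrite ltr_pdivlMr// mulrC mulr_sumr => H.
  apply: le_lt_trans H; apply: ler_sum => i _.
  have [ui uvi vi] := uv i.
  apply: (traj_lip f_lip ty (fun a a1 => (HK a a1).1)) => //.
    by apply: tdom_le cS; rewrite // (le_trans ui).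
  by move=> s /andP[us sv]; apply: yr; rewrite (le_trans ui us) (le_trans sv vi).
have [mN N0] := leb_countable (traj_jumps_countable ty).
exists (tdom S `\` locally_constant S alpha); split=> // s /=.
move=> /not_implyP[sS ns]; split=> // -[h h0 Hh]; apply: ns.
exact: (traj_is_derive f_lip ty sS h0 Hh).
Qed.

End trajectory_solution.

Section shift.
Context {R : realType} {n m : nat}.
Variable f : 'I_m -> 'rV[R]_n -> 'rV[R]_n.
Implicit Types (alpha : R -> 'rV[R]_m) (y : R -> 'rV[R]_n).

(** Only values on [[s, s + h[] enter, so a piece may be attached at [s] whatever precedes it. *)
Lemma right_ode_shift alpha y alpha' y' (s c h : R) : 0 < h ->
  (forall s', s <= s' < s + h -> y' s' = y (s' - c) /\ alpha' s' = alpha (s' - c)) ->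
  right_ode f alpha y (s - c) -> right_ode f alpha' y' s.
Proof.
move=> h0 E [a [a1 [h1 h10 H1] H2]]; exists a; split => //.
  exists (Num.min h h1); first by rewrite lt_min h0.
  move=> s' /andP[ss']; rewrite -ltrBlDl lt_min => /andP[k1 k2].
  by rewrite (E s' _).2 ?H1//; lra.
move=> e e0; have [h2 h20 H3] := H2 e e0.
exists (Num.min h h2); first by rewrite lt_min h0.
move=> s' /andP[ss']; rewrite -ltrBlDl lt_min => /andP[k1 k2].
have -> : y' s = y (s - c) by apply: (E s _).1; lra.
have -> : y' s' = y (s' - c) by apply: (E s' _).1; lra.
have -> : s' - s = s' - c - (s - c) by ring.
by apply: H3; lra.
Qed.

Lemma left_cont_shift y y' (s c h : R) : 0 < h -> c < s ->
  (forall s', s - h < s' <= s -> y' s' = y (s' - c)) ->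
  left_cont y (s - c) -> left_cont y' s.
Proof.
move=> h0 cs E H e e0; have [h1 h10 H1] := H e e0.
exists (Num.min (s - c) (Num.min h h1)); first by rewrite !lt_min subr_gt0 h0 h10 cs.
move=> s' _; rewrite ltrBlDr -ltrBlDl !lt_min => /andP[/andP[k1 /andP[k2 k3]] k4].
rewrite (E s) ?(E s'); [|lra|lra].
by apply: H1; lra.
Qed.

End shift.

(** * Maximal trajectories *)

Section maximal.
Context {R : realType} {n m : nat}.
Variable f : 'I_m -> 'rV[R]_n -> 'rV[R]_n.
Hypothesis f_lip : lip_on_balls f.
Implicit Types (S : \bar R) (alpha : R -> 'rV[R]_m) (y : R -> 'rV[R]_n).

Lemma local_solution (a : 'rV[R]_m) (z : 'rV[R]_n) : `|a| <= 1 ->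
  exists h C Z, [/\ 0 < h, 0 <= C, Z 0 = z & forall s t, 0 <= s -> s <= t -> t <= h ->
    `|Z t - Z s| <= C * (t - s) /\
    `|Z t - Z s - (t - s) *: vfield f a (Z s)| <= C * (t - s) ^+ 2].
Proof.
move=> a1; pose r := `|z| + 1; have r0 : 0 <= r by rewrite addr_ge0.
have [K K0 /(_ a a1)[HK1 HK2]] := vfield_lip f_lip r.
(* Clamping to the ball of radius r makes the field globally Lipschitz. *)
pose cl (x : 'rV[R]_n) : 'rV[R]_n := \row_j Num.max (- r) (Num.min r (x ord0 j)).
have clr x : `|cl x| <= r.
  rewrite normv_le//; apply/forallP => j; rewrite mxE ler_norml le_max lexx/=.
  by rewrite ge_max ge_min lexx/= andbT; lra.
have cl_lip x x' : `|cl x - cl x'| <= `|x - x'|.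
  rewrite normv_le//; apply/forallP => j; rewrite !mxE.
  apply: le_trans (_ : `|x ord0 j - x' ord0 j| <= _); last first.
    by have := coord_le_normv (x - x') j; rewrite !mxE.
  move: (x ord0 j) (x' ord0 j) => u v.
  wlog uv : u v / u <= v => [W|].
    by have [/W//|/ltW/W] := leP u v; rewrite distrC (distrC v).
  rewrite distrC (distrC u) [leRHS]ger0_norm ?subr_ge0// ger0_norm.
    by case: (leP r u) => ?; case: (leP r v) => ?; rewrite /Num.max;
      do ?[case: ifPn; rewrite -?leNgt => ?]; lra.
  by case: (leP r u) => ?; case: (leP r v) => ?; rewrite /Num.max;
    do ?[case: ifPn; rewrite -?leNgt => ?]; lra.
have clE x : `|x| <= r -> cl x = x.
  move=> xr; apply/rowP => j; rewrite mxE.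
  have := le_trans (coord_le_normv x j) xr; rewrite ler_norml => /andP[? ?].
  by rewrite min_r// max_r.
(* With [K * h <= 1/2] the operator contracts and the displacement is at most 3/4, so [Z] stays in
   the ball of radius [r], where the clamping is the identity. *)
pose h := (2 * (K + 1))^-1; have K1 : 0 < 2 * (K + 1) by lra.
have h0 : 0 < h by rewrite invr_gt0.
have Kh : K * h <= 2^-1.
  rewrite -(@ler_pM2r _ (2 * (K + 1)))// -mulrA mulVf ?gt_eqF// mulrA mulVf; lra.
have [x x'|x|Z [Z0 HZ]] := @picard R n (fun x => vfield f a (cl x)) K K h z K0 K0 h0 Kh.
- by apply: le_trans (HK2 _ _ (clr _) (clr _)) _; rewrite ler_wpM2l.
- exact: HK1.
have lipZ s t : 0 <= s -> s <= t -> t <= h -> `|Z t - Z s| <= (K + 2^-1 * K) * (t - s).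
  move=> s0 st th; have ts0 : 0 <= t - s by rewrite subr_ge0.
  rewrite -[Z t - Z s](subrK ((t - s) *: vfield f a (cl (Z s)))).
  apply: le_trans (ler_normD _ _) _; rewrite mulrDl addrC; apply: lerD.
    by rewrite normrZ ger0_norm// mulrC ler_wpM2r// HK1.
  apply: le_trans (HZ _ _ s0 st th) _.
  rewrite expr2 mulrA ler_wpM2r// mulrAC ler_wpM2r//.
  by apply: le_trans Kh; rewrite ler_wpM2l//; lra.
have Zr s : 0 <= s -> s <= h -> `|Z s| <= r.
  move=> s0 sh; rewrite -[Z s](subrK z) (le_trans (ler_normD _ _))// /r addrC lerD2l.
  have := lipZ 0 s (lexx _) s0 sh; rewrite Z0 subr0 => /le_trans; apply.
  apply: (@le_trans _ _ ((K + 2^-1 * K) * h)); first by rewrite ler_wpM2l//; lra.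
  by rewrite mulrDl -mulrA; lra.
exists h, (K + 2^-1 * K + K * K), Z; split => //.
  by rewrite !addr_ge0// mulr_ge0.
move=> s t s0 st th; have ts0 : 0 <= t - s by rewrite subr_ge0.
have KK : 0 <= K * K by rewrite mulr_ge0.
split.
  by apply: le_trans (lipZ _ _ s0 st th) _; rewrite ler_wpM2r// lerDl.
have := HZ _ _ s0 st th; rewrite clE ?Zr ?(le_trans st)// => /le_trans; apply.
by rewrite ler_wpM2r ?sqr_ge0// lerDr; lra.
Qed.

Definition right_const alpha := forall s, 0 <= s -> exists a, `|a| <= 1 /\
  exists2 h, 0 < h & forall s', s < s' < s + h -> alpha s' = a.

(** The case [b = 0] is included: the hypotheses on [y] are then vacuous, and the lemma starts a
    trajectory at [z]. *)
Lemma traj_extend (b : R) alpha y z : 0 <= b -> right_const alpha ->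
  traj f b%:E alpha y -> (0 < b -> y s @[s --> b^'-] --> z) ->
  exists b' y', [/\ b < b', traj f b'%:E alpha y', y' b = z &
    forall s, s < b -> y' s = y s].
Proof.
move=> b0 ra ty yz; have [a [a1 [h1 h10 H1]]] := ra _ b0.
have [h2 [C [Z [h20 C0 Z0 HZ]]]] := local_solution z a1.
pose h := Num.min h1 h2; have h0 : 0 < h by rewrite lt_min h10.
have hh1 : h <= h1 by rewrite ge_min lexx.
have hh2 : h <= h2 by rewrite ge_min lexx orbT.
have C1 : 0 < C + 1 by rewrite ltr_wpDl.
pose y' s := if s < b then y s else Z (s - b).
have y'E s : b <= s -> y' s = Z (s - b) by rewrite /y' ltNge => ->.
exists (b + h), y'; split; last 2 first.
- by rewrite /y' ltxx subrr.
- by move=> s sb; rewrite /y' sb.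
- by rewrite ltrDl.
move=> s [s0]; rewrite lte_fin => sbh.
have [sb|bs] := ltP s b.
  have sS : tdom b%:E s by split; rewrite ?lte_fin.
  have [sode sl] := ty s sS; split.
    apply: (@right_ode_shift _ _ _ f alpha y alpha y' s 0 (b - s)).
    - by rewrite subr_gt0.
    - by move=> s' /andP[_]; rewrite addrC subrK subr0 /y' => ->.
    - by rewrite subr0.
  move=> s'0; apply: (@left_cont_shift _ _ y y' s 0 1) => //.
    by move=> s' /andP[_ ss']; rewrite subr0 /y' (le_lt_trans ss').
  by rewrite subr0; apply: sl.
have bs0 : 0 <= s - b by rewrite subr_ge0.
split.
  exists a; split=> //.
    exists (b + h - s); first by rewrite subr_gt0.
    by move=> s' /andP[ss']; rewrite addrC subrK => s'h; apply: H1; lra.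
  move=> e e0; exists (Num.min (b + h - s) (e / (C + 1))).
    by rewrite lt_min subr_gt0 sbh divr_gt0.
  move=> s' /andP[ss']; rewrite -ltrBlDl lt_min => /andP[k1 k2].
  rewrite !y'E//; last exact: le_trans ss'.
  have -> : s' - s = s' - b - (s - b) by ring.
  have [||_ H] := HZ _ (s' - b) bs0; [lra|lra|].
  apply: le_trans H _; rewrite expr2 mulrA ler_wpM2r//; first lra.
  have -> : s' - b - (s - b) = s' - s by ring.
  apply: (@le_trans _ _ ((C + 1) * (s' - s))); first by rewrite ler_wpM2r ?subr_ge0// lerDl.
  by rewrite mulrC -ler_pdivlMr// ltW.
move=> s0'; have [sb e e0|sb] := eqVneq s b.
  have b0' : 0 < b by rewrite -sb.
  have /cvgrPdist_lt/(_ e e0)[h3 /= h30 H3] := yz b0'.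
  exists h3 => // s' s'0 /andP[k1 k2].
  rewrite sb [y' b]y'E// subrr Z0.
  have [s'b|] := ltP s' b; last first.
    by move=> bs'; rewrite y'E// (_ : s' - b = 0) ?Z0 ?subrr ?normr0//; lra.
  rewrite /y' s'b distrC; apply: H3 => //=.
  by rewrite ger0_norm ?subr_ge0 ?(ltW s'b)//; lra.
have {}sb : b < s by rewrite lt_neqAle eq_sym sb.
move=> e e0; exists (Num.min (s - b) (e / (C + 1))).
  by rewrite lt_min subr_gt0 sb divr_gt0.
move=> s' s'0; rewrite ltrBlDr -ltrBlDl lt_min => /andP[/andP[k1 k2] k3].
rewrite !y'E//; last lra.
have [|||H _] := HZ (s' - b) (s - b); [lra|lra|lra|].
rewrite distrC; apply: le_lt_trans H _; have -> : s - b - (s' - b) = s - s' by ring.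
apply: (@le_lt_trans _ _ ((C + 1) * (s - s'))); first by rewrite ler_wpM2r ?subr_ge0// lerDl.
by rewrite mulrC -ltr_pdivlMr//.
Qed.

(** Zorn's lemma applies to the extension order. A maximal trajectory with finite [b] that stayed
    bounded would be continued by [traj_limit] and [traj_extend]. *)
Lemma maximal_traj alpha x : right_const alpha -> exists b y, [/\ (0 < b)%E, y 0 = x,
  traj f b alpha y & b = +oo%E \/ forall r, exists2 s, tdom b s & r < `|y s|].
Proof.
move=> ra.
pose P := {p : \bar R * (R -> 'rV[R]_n) | [/\ (0 < p.1)%E, p.2 0 = x & traj f p.1 alpha p.2]}.
pose le_ (p q : P) := `[< ((sval p).1 <= (sval q).1)%E /\
  forall s, tdom (sval p).1 s -> (sval q).2 s = (sval p).2 s >].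
have [b0 [y0 [b00 ty0 y00 _]]] : exists b' y', [/\ 0 < b', traj f b'%:E alpha y', y' 0 = x &
    forall s, s < 0 -> y' s = x].
  apply: (@traj_extend 0 alpha (fun=> x)) => //.
    by move=> s [s0]; rewrite lte_fin ltNge s0.
  by rewrite ltxx.
have p0P : [/\ (0 < (b0%:E, y0).1)%E, (b0%:E, y0).2 0 = x &
  traj f (b0%:E, y0).1 alpha (b0%:E, y0).2] by split.
pose p0 : P := exist _ (b0%:E, y0) p0P.
have tdomW (S S' : \bar R) s : (S <= S')%E -> tdom S s -> tdom S' s.
  by move=> SS' [s0 sS]; split => //; apply: lt_le_trans SS'.
have [|||[[b y] /= [bgt0 y00' ty]] pmax] := @ZL_preorder P p0 le_.
- by move=> t; apply/asboolP; split.
- move=> r s t /asboolP[k1 k2] /asboolP[k3 k4]; apply/asboolP; split.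
    exact: le_trans k3.
  by move=> u uS; rewrite k4 ?k2//; apply: tdomW uS.
- move=> A tot.
  have [[p1 Ap1]|nA] := pselect (exists p, A p); last first.
    by exists p0 => s As; case: nA; exists s.
  pose b := ereal_sup [set (sval p).1 | p in A].
  (* The union of the chain: two members defined at [s] agree there, since one extends the other. *)
  have /choice[w Hw] : forall s, exists z, forall p, A p -> tdom (sval p).1 s -> z = (sval p).2 s.
    move=> s; have [[p [Ap ps]]|np] := pselect (exists p, A p /\ tdom (sval p).1 s).
      exists ((sval p).2 s) => q Aq qs.
      by have [/asboolP[_ H]|/asboolP[_ H]] := tot _ _ Ap Aq; rewrite H.
    by exists 0 => p Ap ps; case: np; exists p.
  have bP p : A p -> ((sval p).1 <= b)%E by move=> Ap; apply: ereal_sup_ubound; exists p.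
  have qP : [/\ (0 < (b, w).1)%E, (b, w).2 0 = x & traj f (b, w).1 alpha (b, w).2].
    have [p1gt0 p10 _] := svalP p1; split=> /=.
    - exact: lt_le_trans p1gt0 (bP _ Ap1).
    - by rewrite (Hw 0 p1)//; split.
    - move=> s [s0 sb]; have [_ [p Ap <-] sp] := ereal_sup_gt sb.
      have [_ _ tp] := svalP p.
      have sS : tdom (sval p).1 s by [].
      have [ode lc] := tp _ sS; have [h h0 Hh] := tdom_right sS.
      split.
        apply: (@right_ode_shift _ _ _ f alpha (sval p).2 alpha w s 0 h) => //.
          move=> s' /andP[ss' s'h]; rewrite subr0; split=> //; apply: Hw => //.
          by apply: Hh => //; apply: le_trans ss'.
        by rewrite subr0.
      move=> sgt0; apply: (@left_cont_shift _ _ (sval p).2 w s 0 s) => //.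
        move=> s'; rewrite subrr => /andP[s'0 s's]; rewrite subr0; apply: Hw => //.
        exact: tdom_le (ltW s'0) s's sS.
      by rewrite subr0; apply: lc.
  exists (exist _ (b, w) qP) => p Ap; apply/asboolP; split=> /=; first exact: bP.
  by move=> s ps; apply: Hw.
exists b, y; split => //.
have [|bfin] := eqVneq b +oo%E; [by left|right=> r].
case: b bgt0 ty y00' pmax bfin => [b| |]// bgt0 ty y00' pmax _.
apply: contrapT => nb.
have yr s : 0 <= s < b -> `|y s| <= r.
  move=> /andP[s0 sb]; rewrite leNgt; apply/negP => ry; apply: nb; exists s => //.
have b_gt0 : 0 < b by rewrite -lte_fin.
have /cvg_ex[z yz] := traj_limit f_lip b_gt0 ty yr.
have [b' [y' [bb' ty' _ y'y]]] := traj_extend (ltW b_gt0) ra ty (fun=> yz).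
have qP : [/\ (0 < (b'%:E, y').1)%E, (b'%:E, y').2 0 = x &
    traj f (b'%:E, y').1 alpha (b'%:E, y').2].
  by split => //=; [rewrite lte_fin; exact: lt_trans b_gt0 bb'|rewrite y'y].
have /asboolP[/=] : le_ (exist _ (b'%:E, y') qP) (exist _ (b%:E, y) (And3 bgt0 y00' ty)).
  apply: pmax; apply/asboolP; split=> /=; first by rewrite lee_fin ltW.
  by move=> s [_]; rewrite lte_fin => /y'y.
by rewrite lee_fin leNgt bb'.
Qed.

Lemma abs_continuous_bounded (c : R) y : abs_continuous 0 c y ->
  exists r, forall s, 0 <= s <= c -> `|y s| <= r.
Proof.
move=> acy.
have cy : {within `[0, c], continuous y}.
  apply/subspace_continuousP => s /= /[!in_itv]/= /andP[s0 sc].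
  apply/cvgrPdist_lt => e e0; have [d d0 Hd] := acy e e0.
  have incr u v : 0 <= u -> u <= v -> v <= c -> v - u < d -> `|y v - y u| < e.
    move=> u0 uv vc uvd; have := Hd 1%N (fun=> u) (fun=> v); rewrite !big_ord1; apply => //.
    by move=> i j; rewrite !ord1.
  rewrite near_withinE; exists d => // s' /= ss' /[!in_itv]/= /andP[s'0 s'c].
  have [le|/ltW le] := leP s' s; first by apply: incr => //; move: ss'; rewrite ltr_norml; lra.
  by rewrite distrC; apply: incr => //; move: ss'; rewrite ltr_norml; lra.
have := continuous_compact cy (@segment_compact _ 0 c).
move=> /compact_bounded[M [_ HM]]; exists (M + 1) => s sc.
by apply: (HM (M + 1)); [rewrite ltrDl|exists s => //; rewrite /= in_itv].
Qed.

(** [maximal_traj] is maximal among trajectories, [multiflow] among Caratheodory solutions. A proper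
    extension of the second kind would be absolutely continuous up to [b], hence bounded, while the
    trajectory is unbounded. *)
Lemma multiflow_ex (V : 'rV[R]_n -> label (m := m)) x t : right_const (flow_ctrl V x t) ->
  exists b Y, multiflow f V x t b Y /\ traj f b (flow_ctrl V x t) Y.
Proof.
move=> rc; have [b [y [b0 y0 ty unb]]] := maximal_traj x rc.
exists b, y; split => //; split.
  by rewrite -{1}y0; apply: traj_solution.
move=> b' y' sol bb' yy'; have [by_|unb'] := unb.
  by move: bb'; rewrite by_ leye_eq => /eqP.
apply/eqP; rewrite eq_le bb' andbT leNgt; apply/negP => bb.
case: b b0 ty unb' yy' bb bb' {unb} => [b| |]// b0 ty unb yy' bb bb'; last first.
  by move: bb; rewrite ltNge leey.
have [r yr] := abs_continuous_bounded (sol_ac sol (conj (ltW b0) bb)).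
have [s sS] := unb r; rewrite -(yy' _ sS) ltNge => /negP; apply; apply: yr.
by rewrite sS.1 -lee_fin ltW// sS.2.
Qed.

End maximal.

(** * Sampling processes *)

Section oriented_controls.
Context {R : realType} {n m : nat}.
Implicit Types alpha : R -> 'rV[R]_m.

(** One-sided values at every real time, the value at [s] being free: this is stable under shift,
    reflection, sign and cutting, from which [octrl_pos] is built. *)
Definition piecewise_const alpha := forall s, exists a a' h,
  [/\ `|a| <= 1, `|a'| <= 1, 0 < h, forall s', s < s' < s + h -> alpha s' = a &
    forall s', s - h < s' < s -> alpha s' = a'].

Lemma piecewise_const_cst a : `|a| <= 1 -> piecewise_const (fun=> a).
Proof. by move=> a1 s; exists a, a, 1; split. Qed.

Lemma piecewise_const_shift alpha c : piecewise_const alpha ->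
  piecewise_const (fun s => alpha (s - c)).
Proof.
move=> H s; have [a [a' [h [a1 a'1 h0 H1 H2]]]] := H (s - c).
by exists a, a', h; split => // s' ss'; [apply: H1|apply: H2]; lra.
Qed.

Lemma piecewise_const_reflect alpha c : piecewise_const alpha ->
  piecewise_const (fun s => alpha (c - s)).
Proof.
move=> H s; have [a [a' [h [a1 a'1 h0 H1 H2]]]] := H (c - s).
by exists a', a, h; split => // s' ss'; [apply: H2|apply: H1]; lra.
Qed.

Lemma piecewise_constN alpha : piecewise_const alpha ->
  piecewise_const (fun s => - alpha s).
Proof.
move=> H s; have [a [a' [h [a1 a'1 h0 H1 H2]]]] := H s.
exists (- a), (- a'), h; rewrite !normrN.
by split => // s' ss'; [rewrite H1|rewrite H2].
Qed.

Lemma piecewise_const_if alpha beta c : piecewise_const alpha -> piecewise_const beta ->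
  piecewise_const (fun s => if s < c then alpha s else beta s).
Proof.
move=> Ha Hb s.
have [a [a' [h [a1 a'1 h0 H1 H2]]]] := Ha s.
have [b [b' [k [b1 b'1 k0 K1 K2]]]] := Hb s.
case: (ltgtP s c) => sc.
- exists a, a', (Num.min h (c - s)); split=> //; first by rewrite lt_min h0 subr_gt0.
    move=> s' /andP[ss']; rewrite -ltrBlDl lt_min => /andP[? ?].
    by rewrite ifT ?H1//; lra.
  move=> s' /andP[]; rewrite ltrBlDr -ltrBlDl lt_min => /andP[? ?] ?.
  by rewrite ifT ?H2//; lra.
- exists b, b', (Num.min k (s - c)); split=> //; first by rewrite lt_min k0 subr_gt0.
    move=> s' /andP[ss']; rewrite -ltrBlDl lt_min => /andP[? ?].
    by rewrite ifN ?K1// -?leNgt; lra.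
  move=> s' /andP[]; rewrite ltrBlDr -ltrBlDl lt_min => /andP[? ?] ?.
  by rewrite ifN ?K2// -?leNgt; lra.
- exists b, a', (Num.min h k); split=> //; first by rewrite lt_min h0.
    move=> s' /andP[ss']; rewrite -ltrBlDl lt_min => /andP[? ?].
    by rewrite ifN ?K1// -?leNgt; lra.
  move=> s' /andP[]; rewrite ltrBlDr -ltrBlDl lt_min => /andP[? ?] ?.
  by rewrite ifT ?H2//; lra.
Qed.

Lemma octrl_pos_le1 B g (t s : R) : `|octrl_pos (m := m) B g t s| <= 1.
Proof.
elim: B t s => [j|B1 IH1 B2 IH2] t s /=.
  case: onth => [i|]; last by rewrite normr0.
  rewrite normv_le//; apply/forallP => j'; rewrite mxE eqxx/=.
  by case: eqP => _; rewrite ?normr1 ?normr0.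
by do 3 ?[case: ifP => _]; rewrite ?normrN.
Qed.

Lemma octrl_pos_piecewise B g (t : R) : piecewise_const (octrl_pos (m := m) B g t).
Proof.
elim: B t => [j|B1 IH1 B2 IH2] t /=.
  apply: piecewise_const_cst; exact: (octrl_pos_le1 (Letter j) g 0 0).
apply: piecewise_const_if => //.
apply: piecewise_const_if; first exact: piecewise_const_shift.
by apply: piecewise_const_if; apply: piecewise_constN;
  apply: (@piecewise_const_shift (fun u => octrl_pos _ _ _ (_ - u)));
  apply: piecewise_const_reflect.
Qed.

Lemma flow_ctrl_right_const (V : 'rV[R]_n -> label (m := m)) x t :
  right_const (flow_ctrl V x t).
Proof.
have [H1 HP] : (forall s, `|octrl (V x) t s| <= 1) /\ piecewise_const (octrl (V x) t).
  rewrite /octrl; case: lab_sgn; split.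
  - by move=> s; exact: octrl_pos_le1.
  - exact: octrl_pos_piecewise.
  - by move=> s; rewrite normrN; exact: octrl_pos_le1.
  - by apply: piecewise_constN; apply: piecewise_const_reflect; exact: octrl_pos_piecewise.
have : piecewise_const (flow_ctrl V x t).
  rewrite (_ : flow_ctrl V x t = fun s => if s < t then octrl (V x) t s else octrl (V x) t t).
    by apply: piecewise_const_if => //; apply: piecewise_const_cst.
  by apply/funext => s; rewrite /flow_ctrl /Num.min; case: ifP.
by move=> H s _; have [a [a' [h [a1 _ h0 H3 _]]]] := H s; exists a; split => //; exists h.
Qed.

End oriented_controls.

Section concatenation.
Context {R : realType} {n m : nat}.
Implicit Types (alpha : R -> 'rV[R]_m) (y : R -> 'rV[R]_n).

Lemma nondecr_seq_le (p : nat -> R) : (forall j, p j <= p j.+1) ->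
  forall i j, (i <= j)%N -> p i <= p j.
Proof.
move=> pS i j /subnKC <-; elim: (j - i)%N => [|k IH]; first by rewrite addn0.
by rewrite addnS (le_trans IH).
Qed.

Lemma slot_ex (p : nat -> R) (s : R) N : p 0%N <= s -> s < p N ->
  exists j, p j <= s < p j.+1.
Proof.
move=> p0; elim: N => [|N IH] sp; first by move: p0; rewrite leNgt sp.
have [/IH//|ps] := ltP s (p N); by exists N; rewrite ps.
Qed.

Lemma slot_uniq (p : nat -> R) (s : R) i j : (forall j, p j <= p j.+1) ->
  p i <= s < p i.+1 -> p j <= s < p j.+1 -> i = j.
Proof.
move=> pS /andP[i1 i2] /andP[j1 j2].
case: (ltngtP i j) => // /(nondecr_seq_le pS) ij.
  by have := lt_le_trans i2 (le_trans ij j1); rewrite ltxx.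
by have := lt_le_trans j2 (le_trans ij i1); rewrite ltxx.
Qed.

(** [p] is only nondecreasing because stages may have length zero; [slot_uniq] makes the slot of a
    time unambiguous. *)
Lemma concat_ex (W : Type) (p : nat -> R) (Y : nat -> R -> W) : (forall j, p j <= p j.+1) ->
  exists y : R -> W, forall j s, p j <= s < p j.+1 -> y s = Y j (s - p j).
Proof.
move=> pS; pose idx s := xget 0%N [set j | p j <= s < p j.+1].
exists (fun s => Y (idx s) (s - p (idx s))) => j s sj.
suff -> : idx s = j by [].
apply: (slot_uniq pS _ sj).
by rewrite /idx; case: xgetP => [i _ //|/(_ j)/=]; rewrite sj.
Qed.

(** To the right of [s] only its own slot matters. At a junction, left continuity comes from the
    last nonempty slot before it, whose endpoint matches. *)
Lemma concat_traj (f : 'I_m -> 'rV[R]_n -> 'rV[R]_n) (p : nat -> R) (B : nat -> \bar R)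
    (A : nat -> R -> 'rV[R]_m) (Y : nat -> R -> 'rV[R]_n) alpha y :
  p 0%N = 0 -> (forall j, p j <= p j.+1) ->
  (forall j s, p j <= s < p j.+1 -> y s = Y j (s - p j)) ->
  (forall j s, p j <= s < p j.+1 -> alpha s = A j (s - p j)) ->
  (forall j, traj f (B j) (A j) (Y j)) ->
  forall j s, p j <= s < p j.+1 -> tdom (B j) (s - p j) ->
  (forall i, (i < j)%N -> tdom (B i) (p i.+1 - p i) /\ y (p i.+1) = Y i (p i.+1 - p i)) ->
  right_ode f alpha y s /\ (0 < s -> left_cont y s).
Proof.
move=> p0 pS yE aE tY j s /andP[ps sp] sB prev.
have [ode lc] := tY j _ sB; split.
  apply: (@right_ode_shift _ _ _ f (A j) (Y j) alpha y s (p j) (p j.+1 - s)) => //.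
    by rewrite subr_gt0.
  move=> s' /andP[ss']; rewrite addrC subrK => s'p.
  by rewrite (yE j) ?(aE j)//; apply/andP; split=> //; exact: le_trans ss'.
move=> s0; have [ps'|ps'] := eqVneq (p j) s; last first.
  have {}ps' : p j < s by rewrite lt_neqAle ps' ps.
  apply: (@left_cont_shift _ _ (Y j) y s (p j) (s - p j)) => //.
  - by rewrite subr_gt0.
  - by move=> s' /andP[k1 k2]; apply: yE; lra.
  - by apply: lc; rewrite subr_gt0.
move: s0; rewrite -{s ps sp sB ode lc}ps'.
(* Induction goes back over slots of length zero; at time 0 there is nothing to prove. *)
elim: j prev => [|j IH] prev; first by rewrite p0 ltxx.
have [<- | pj] := eqVneq (p j) (p j.+1).
  by apply: IH => i ij; apply: prev; exact: ltnW.
move=> s0; have {}pj : p j < p j.+1 by rewrite lt_neqAle pj pS.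
have [dB yp] := prev j (ltnSn j).
apply: (@left_cont_shift _ _ (Y j) y (p j.+1) (p j) (p j.+1 - p j)) => //.
- by rewrite subr_gt0.
- move=> s' /andP[k1]; rewrite le_eqVlt => /predU1P[->//|k2].
  by apply: yE; rewrite k2 andbT ltW//; lra.
- by apply: (tY j _ dB).2; rewrite subr_gt0.
Qed.

End concatenation.

Section sampling.
Context {R : realType} {n m : nat}.
Variables (f : 'I_m -> 'rV[R]_n -> 'rV[R]_n) (T : set 'rV[R]_n).
Hypothesis f_lip : lip_on_balls f.
Variables (k : nat) (V : 'rV[R]_n -> label (m := m)).
Hypothesis V_feedback : feedback_generator f T V k.

Lemma degree_gt0 B : (0 < degree B)%N.
Proof.
by elim: B => //= B1 + B2 _; rewrite /degree/= size_cat; case: (size _).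
Qed.

Lemma exit_time_inside (b : \bar R) Y s : 0 <= s -> (s%:E < exit_time T b Y)%E ->
  tdom b s /\ ~ T (Y s).
Proof.
move=> s0 /ereal_sup_gt[_ [t [t0 tb HY] <-]]; rewrite lte_fin => st; split.
  by split => //; apply: lt_le_trans tb; rewrite lte_fin.
by apply: HY; rewrite s0.
Qed.

(** Each step gets the largest length allowed for the degree in force, which settles the scaling.
    These lengths have a common positive lower bound, so the partition tends to infinity. *)
Lemma sampling_ex (d : k.-tuple R) x : (forall i, 0 < tnth d i) -> ~ T x ->
  exists p N S alpha y, [/\ sampling_process f T V x p N S alpha y,
    scaled V d p N y & traj f S alpha y].
Proof.
move=> d0 Tx.
pose w z := nth 0 d (degree (lab_br (V z))).-1.
have deg z : ~ T z -> ((degree (lab_br (V z))).-1 < k)%N.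
  by move=> /V_feedback[_ + _]; rewrite prednK// degree_gt0.
(* A lower bound of all components of [d]; the summand 1 keeps it positive in every case. *)
pose dm := (1 + \sum_i (tnth d i)^-1)^-1.
have sum0 : 0 <= \sum_i (tnth d i)^-1 by apply: sumr_ge0 => i _; rewrite invr_ge0 ltW.
have dm0 : 0 < dm by rewrite invr_gt0 ltr_pwDl.
have wdm z : ~ T z -> dm <= w z.
  move=> /deg kz; rewrite /w -(tnth_nth 0 d (Ordinal kz)) -[leRHS]invrK.
  rewrite lef_pV2 ?posrE ?invr_gt0 ?ltr_pwDl// (bigD1 (Ordinal kz))//=.
  rewrite addrCA lerDl addr_ge0//; apply: sumr_ge0 => i _; rewrite invr_ge0 ltW//.
have w0 z : ~ T z -> 0 < w z by move=> /wdm; apply: lt_le_trans.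
have /choice[bY HbY] : forall z, exists bY : \bar R * (R -> 'rV[R]_n),
    multiflow f V z (w z) bY.1 bY.2 /\ traj f bY.1 (flow_ctrl V z (w z)) bY.2.
  move=> z; have [b [Y H]] := multiflow_ex f_lip (flow_ctrl_right_const V z (w z)).
  by exists (b, Y).
pose E z := exit_time T (bY z).1 (bY z).2.
have Y0 z : (bY z).2 0 = z by have [[[]]] := HbY z.
pose stop z := (E z <= (w z)%:E)%E.
(* After a stop the point is repeated: the partition has infinitely many nodes even if the process
   ends. *)
pose nx z := if stop z then z else (bY z).2 (w z).
pose X j := iter j nx x.
have XT j : ~ T (X j).
  elim: j => [//|j IH]; rewrite /X iterS -/(X j) /nx; case: ifPn => //.
  by rewrite /stop -ltNge => /exit_time_inside -/(_ (ltW (w0 _ IH)))[].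
pose p j := \sum_(i < j) w (X i).
have pS j : p j.+1 = p j + w (X j) by rewrite /p big_ord_recr.
have pw j : p j.+1 - p j = w (X j) by rewrite pS addrAC subrr add0r.
have plt j : p j < p j.+1 by rewrite pS ltrDl w0.
have ple j : p j <= p j.+1 := ltW (plt j).
have p0 : p 0%N = 0 by rewrite /p big_ord0.
have pdm j : dm * j%:R <= p j.
  elim: j => [|j IH]; first by rewrite mulr0 p0.
  by rewrite pS -natr1 mulrDr mulr1 lerD// wdm.
have pub A : exists j, A < p j.
  exists (Num.trunc `|A / dm|).+1; apply: lt_le_trans (pdm _).
  rewrite mulrC -ltr_pdivrMr//; apply: le_lt_trans (ler_norm _) _.
  exact: truncnS_gt.
have pge0 j : 0 <= p j by rewrite -p0 nondecr_seq_le.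
have [y yE] := concat_ex (fun j => (bY (X j)).2) ple.
have [alpha aE] := concat_ex (fun j => flow_ctrl V (X j) (w (X j))) ple.
have yp j : y (p j) = X j by rewrite (yE j) ?lexx ?plt// subrr Y0.
have Y0S j : ~~ stop (X j) -> y (p j.+1) = (bY (X j)).2 (p j.+1 - p j).
  by move=> ns; rewrite yp pw /X iterS -/(X j) /nx (negbTE ns).
pose sg j := ((p j)%:E + E (X j))%E.
have sgE j : (sg j <= (p j.+1)%:E)%E = stop (X j).
  by rewrite /sg pS EFinD leeD2lE.
have [N HN1 HN2] : exists2 N, (forall j, step_reached N j -> N != Some j -> ~~ stop (X j)) &
    (if N is Some N' then stop (X N') else True).
  have [ex|nex] := pselect (exists j, stop (X j)).
    exists (Some (ex_minn ex)); case: ex_minnP => // N' sN' minN'.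
    move=> j /= jN'; apply: contraNN => /minN' N'j; apply/eqP; congr Some.
    by apply/eqP; rewrite eqn_leq N'j.
  by exists None => // j _ _; apply/negP => sj; apply: nex; exists j.
pose S := if N is Some N' then sg N' else +oo%E.
exists p, N, S, alpha, y; split.
- split => //.
  + split => //; apply/cvgryPge => A; have [j Aj] := pub A.
    by exists j => // i /= ji; rewrite (le_trans (ltW Aj))// nondecr_seq_le.
  + by rewrite -[0]p0 yp.
  exists sg; split.
  + move=> j _; rewrite /sampling_step yp pw; exists (bY (X j)).1, (bY (X j)).2; split.
    * by case: (HbY (X j)).
    * by [].
    * move=> s ps; rewrite lt_min lte_fin => /andP[sp _].
      by rewrite (yE j) ?(aE j)// ps sp.
    * by rewrite ltNge sgE => /Y0S; rewrite pw.
  + by move=> j rj Nj; rewrite ltNge sgE HN1.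
  + by rewrite /S; case: N {HN1} HN2 {S} => // N'; rewrite sgE.
- move=> j _ /=; rewrite yp pw -/(w (X j)) lexx andbT.
  apply: ler_piMl; first exact: ltW (w0 _ (XT j)).
  have k0 : (0 < k)%N := leq_ltn_trans (leq0n _) (deg _ (XT j)).
  by rewrite ler_pdivrMr ?ltr0n// mul1r ler_nat leq_pred.
move=> s [s0 sS].
have [N0 sN0] := pub s.
have [j js] : exists j, p j <= s < p j.+1 by apply: slot_ex sN0; rewrite p0.
have rj : step_reached N j.
  rewrite /S in sS; case: N HN1 HN2 {S} sS => //= N' _ stN' sS; rewrite leqNgt; apply/negP => Nj.
  have : (sg N' <= s%:E)%E.
    apply: (@le_trans _ _ (p N'.+1)%:E); first by rewrite sgE.
    by rewrite lee_fin; case/andP: js => + _; apply: le_trans; apply: nondecr_seq_le.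
  by rewrite leNgt sS.
have ssg : (s%:E < sg j)%E.
  have [Nj|Nj] := eqVneq N (Some j); first by move: sS; rewrite /S Nj.
  case/andP: js => _ sp; apply: (@lt_trans _ _ (p j.+1)%:E); first by rewrite lte_fin.
  by rewrite ltNge sgE HN1.
have sE : ((s - p j)%:E < E (X j))%E.
  by rewrite EFinB lteBlDr// addeC.
have sp0 : 0 <= s - p j by rewrite subr_ge0; case/andP: js.
apply: (concat_traj p0 ple yE aE (fun j => (HbY (X j)).2)) js (exit_time_inside sp0 sE).1 _.
move=> i ij; have [ri Ni] : step_reached N i /\ N != Some i.
  move: rj; clear -ij; case: N => //= N' jN; split; first exact: leq_trans (ltnW ij) jN.
  by apply/eqP => -[NE]; move: ij; rewrite ltnNge -NE jN.
have ns := HN1 _ ri Ni.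
split; last exact: Y0S.
rewrite pw; apply: (@exit_time_inside _ (bY (X i)).2 _ _ _).1.
  exact: ltW (w0 _ (XT i)).
by rewrite ltNge.
Qed.

End sampling.

(** * Lipschitz constants on balls from the regularity of the fields *)

Section locally_lipschitz.
Context {R : realType} {n m : nat}.

(** Mean value inequality along the segment from [z] to [x], which stays in the ball. Expanding [v]
    in the basis, with coordinates at most [|v|], produces the factor [n]. *)
Lemma bounded_derive_lip (g : 'rV[R]_n -> 'rV[R]_n) (r M : R) :
  (forall x, `|x| <= r -> differentiable g x) ->
  (forall (j : 'I_n) x, `|x| <= r -> `|'D_(delta_mx ord0 j) g x| <= M) -> 0 <= M ->
  forall x z, `|x| <= r -> `|z| <= r -> `|g x - g z| <= n%:R * M * `|x - z|.
Proof.
move=> dg gM M0 x z xr zr; set v := x - z.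
pose gam (t : R) := z + t *: v.
have gamr (t : R) : 0 <= t <= 1 -> `|gam t| <= r.
  move=> /andP[t0 t1]; rewrite /gam /v.
  have -> : z + t *: (x - z) = (1 - t) *: z + t *: x.
    by apply/rowP => i; rewrite !mxE; ring.
  apply: le_trans (ler_normD _ _) _; rewrite !normrZ !ger0_norm ?subr_ge0//.
  have H1 : (1 - t) * `|z| <= (1 - t) * r by rewrite ler_wpM2l// subr_ge0.
  have H2 : t * `|x| <= t * r by rewrite ler_wpM2l.
  by apply: le_trans (lerD H1 H2) _; rewrite -mulrDl subrK mul1r.
have dgam (t : R) : 0 <= t <= 1 -> is_derive t 1 (g \o gam) ('D_v g (gam t)).
  move=> t01; have dv := diff_derivable (v := v) (dg _ (gamr _ t01)).
  have E : (fun h : R => h^-1 *: ((g \o gam \o shift t) (h *: 1) - (g \o gam) t)) =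
           (fun h : R => h^-1 *: ((g \o shift (gam t)) (h *: v) - g (gam t))).
    apply/funext => h /=; congr (_ *: (g _ - _)).
    by rewrite /gam [h *: 1]mulr1 scalerDl addrCA.
  apply: DeriveDef; first by rewrite /derivable E.
  by rewrite /derive E.
have bnd (t : R) : 0 <= t <= 1 -> `|'D_v g (gam t)| <= n%:R * M * `|v|.
  move=> t01; rewrite deriveE; last exact: dg (gamr _ t01).
  rewrite {1}[v]row_sum_delta linear_sum.
  apply: le_trans (ler_norm_sum _ _ _) _.
  apply: (@le_trans _ _ (\sum_(i < n) (M * `|v|))); last first.
    by rewrite sumr_const card_ord -[in leRHS]mulrA mulr_natl.
  apply: ler_sum => i _; rewrite linearZ normrZ mulrC ler_pM//; last first.
    exact: coord_le_normv.
  by rewrite -deriveE ?gM ?gamr//; exact: dg (gamr _ t01).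
have K0 : 0 <= n%:R * M * `|v| by rewrite !mulr_ge0.
rewrite normv_le//; apply/forallP => j.
have H := @primitive_dist R (fun t => 'D_v g (gam t) ord0 j) (fun=> 0)
  (fun t => (g \o gam) t ord0 j) (fun=> 0) 0 1 _ ler01.
have {H} := H (n%:R * M * `|v|); rewrite !subr0 mulr1.
have -> : (g \o gam) 1 = g x by rewrite /= /gam scale1r /v addrC subrK.
have -> : (g \o gam) 0 = g z by rewrite /= /gam scale0r addr0.
rewrite !mxE; apply.
- move=> t t01; have [D1 D2] := dgam t t01.
  rewrite -D2 derive_mx// mxE; apply: derivableP.
  by move/derivable_mxP : D1; apply.
- by move=> t t01; rewrite subr0; apply: le_trans (coord_le_normv _ _) (bnd _ t01).
Qed.

(** For [j = 0] the Lipschitz clause bears on [f i] itself; for [j >= 1] the first derivatives are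
    bounded. The regularity is applied on the open ball of radius [|r| + 1], which contains the
    closed one of radius [r]. *)
Lemma class_C1b_lip (f : 'I_m -> 'rV[R]_n -> 'rV[R]_n) (j : nat) :
  (forall O : set 'rV[R]_n, open O -> O !=set0 -> bounded_set O ->
    forall i, class_C1b j O (f i)) -> lip_on_balls f.
Proof.
move=> reg r.
suff H i : exists2 L, 0 <= L & forall x z, `|x| <= r -> `|z| <= r ->
    `|f i x - f i z| <= L * `|x - z|.
  have [L HL] := choice (fun i => (let: ex_intro2 L a b := H i in ex_intro _ L (conj a b)) :
    exists L, 0 <= L /\ forall x z, `|x| <= r -> `|z| <= r -> `|f i x - f i z| <= L * `|x - z|).
  exists (\sum_i L i); first by apply: sumr_ge0 => i _; case: (HL i).
  move=> i x z xr zr; apply: le_trans ((HL i).2 _ _ xr zr) _; rewrite ler_wpM2r//.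
  by rewrite (bigD1 i)//= lerDl; apply: sumr_ge0 => k _; case: (HL k).
pose O := ball (0 : 'rV[R]_n) (`|r| + 1).
have r1 : 0 < `|r| + 1 by rewrite ltr_wpDl.
have OE x : O x <-> `|x| < `|r| + 1 by rewrite /O -ball_normE/= sub0r normrN.
have Or x : `|x| <= r -> O x.
  by move=> xr; apply/OE; rewrite (le_lt_trans (le_trans xr (ler_norm r)))// ltrDl.
have [|||[C1 C2] C3 C4] := reg O _ _ _ i.
- exact: ball_open.
- by exists 0; apply/OE; rewrite normr0.
- exists (`|r| + 1); split; first by rewrite realE ltW.
  by move=> M rM x /OE xr; exact: ltW (lt_trans xr rM).
case: j C1 C2 C3 C4 {reg} => [|j] C1 C2 C3 C4.
  have [M [_ HM]] := C4 [::] erefl.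
  have M1 : M < `|M| + 1 by rewrite (le_lt_trans (ler_norm _))// ltrDl.
  exists (`|M| + 1); first by rewrite addr_ge0.
  by move=> x z xr zr; apply: (HM _ M1 (x, z)); split; apply: Or.
have /choice[M HM] : forall i', exists M, 0 <= M /\
    forall x, `|x| <= r -> `|'D_(delta_mx ord0 i') (f i) x| <= M.
  move=> i'; have [M [_ HM]] := C3 [:: i'] isT.
  have M1 : M < `|M| + 1 by rewrite (le_lt_trans (ler_norm _))// ltrDl.
  exists (`|M| + 1); split; first by rewrite addr_ge0.
  by move=> x xr; apply: (HM _ M1); apply: Or.
have M0 : 0 <= \sum_i' M i' by apply: sumr_ge0 => i' _; case: (HM i').
exists (n%:R * \sum_i' M i'); first by rewrite mulr_ge0.
move=> x z xr zr; apply: bounded_derive_lip xr zr => //.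
  by move=> w wr; apply: (C1 [::] isT); apply: Or.
move=> i' w wr; apply: le_trans ((HM i').2 w wr) _.
by rewrite (bigD1 i')//= lerDl; apply: sumr_ge0 => k _; case: (HM k).
Qed.

End locally_lipschitz.

(** * Translation and concatenation of integrals *)

Section translation.
Context {R : realType}.

Lemma wlength_shift (c : R) (A : set R) : ocitv A ->
  ocitv ((fun x => x + c) @^-1` A) /\
  wlength idfun ((fun x => x + c) @^-1` A) = wlength idfun A.
Proof.
move=> [[a b] _ <-] /=.
have -> : (fun x => x + c) @^-1` `]a, b]%classic = `](a - c), (b - c)]%classic.
  by apply/seteqP; split => x /=; rewrite !in_itv/= ltrBlDr lerBrDr.
split; first exact: is_ocitv.
rewrite !wlength_itv/= !lte_fin ltrD2r; case: ifP => // _.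
by rewrite -!EFinB; congr EFin; ring.
Qed.

(** The measure is an infimum over coverings by half-open intervals, whose lengths translation
    preserves. The inequality for every shift, used also for the opposite one, gives equality. *)
Lemma leb_shift (c : R) (A : set R) :
  leb ((fun x => x + c) @^-1` A : set (lebR R)) = leb (A : set (lebR R)).
Proof.
have le_shift e (B : set R) :
    (leb ((fun x => (x + e)%R) @^-1` B : set (lebR R)) <= leb (B : set (lebR R)))%E.
  apply: le_ereal_inf_tmp => _ [F [mF BF] <-]; apply: ereal_inf_lbound.
  exists (fun k => (fun x => x + e) @^-1` F k).
    split=> [k|x /BF[k _ Fk]]; first by have [] := wlength_shift e (mF k).
    by exists k.
  by apply: eq_eseriesr => k _; have [] := wlength_shift e (mF k).
apply/eqP; rewrite eq_le le_shift/=.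
have := le_shift (- c) ((fun x => x + c) @^-1` A).
rewrite (_ : (fun x => x - c) @^-1` ((fun x => x + c) @^-1` A) = A)//.
by apply/seteqP; split=> x /=; rewrite subrK.
Qed.

(** Caratheodory's criterion is translated together with the test set [X]. *)
Lemma measurable_shift (c : R) :
  measurable_fun setT ((fun x => x + c) : lebR R -> lebR R).
Proof.
move=> _ A mA; rewrite setTI.
have HA : forall X : set R, leb (X : set (lebR R)) =
  (leb (X `&` A : set (lebR R)) + leb (X `&` ~` A : set (lebR R)))%E by exact: mA.
suff H : forall X : set R, leb (X : set (lebR R)) =
    (leb (X `&` ((fun x => (x + c)%R) @^-1` A) : set (lebR R)) +
     leb (X `&` ~` ((fun x => (x + c)%R) @^-1` A) : set (lebR R)))%E by exact: H.
move=> X; pose Z : set R := (fun x => x - c) @^-1` X.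
have -> : X = (fun x => x + c) @^-1` Z by apply/seteqP; split=> x; rewrite /Z/= addrK.
by rewrite leb_shift (HA Z) -(leb_shift c (Z `&` A)) -(leb_shift c (Z `&` ~` A)).
Qed.

Lemma integral_shift (c : R) (D : set R) (g : R -> \bar R) :
  measurable (D : set (lebR R)) -> measurable_fun (D : set (lebR R)) (fun s : lebR R => g s) ->
  (forall x, D x -> 0 <= g x)%E ->
  (\int[leb]_(x in (D : set (lebR R))) g x =
   \int[leb]_(x in ((fun x => (x + c)%R) @^-1` D : set (lebR R))) g (x + c)%R)%E.
Proof.
move=> mD mg g0.
rewrite -(@ge0_integral_pushforward _ _ _ _ _ _ (measurable_shift c) leb D g)//.
  have E : pushforward leb (fun x : lebR R => x + c : lebR R) = leb.
    by apply/funext => A; exact: leb_shift.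
  by rewrite E.
by move=> x /set_mem; exact: g0.
Qed.

Lemma integral_concat (p : nat -> R) (S : \bar R) (F : R -> \bar R) (G : nat -> R -> \bar R) :
  p 0%N = 0 -> (forall j, p j <= p j.+1) ->
  tdom S = \bigcup_j `[p j, p j.+1[%classic ->
  measurable_fun (tdom S : set (lebR R)) (fun s : lebR R => F s) ->
  (forall s, tdom S s -> 0 <= F s)%E ->
  (forall j s, p j <= s < p j.+1 -> F s = G j (s - p j)) ->
  (\int[leb]_(s in (tdom S : set (lebR R))) F s =
   \sum_(j <oo) \int[leb]_(s in ([set s | (0 <= s < p j.+1 - p j)%R] : set (lebR R))) G j s)%E.
Proof.
move=> p0 pS SE mF F0 FG.
have mI j : measurable (`[p j, p j.+1[%classic : set (lebR R)).
  by apply: leb_borel; exact: measurable_itv.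
have sub j : `[p j, p j.+1[%classic `<=` tdom S by rewrite SE => s sj; exists j.
rewrite SE ge0_integral_bigcup//.
- apply: eq_eseriesr => j _; rewrite (@integral_shift (p j) `[p j, p j.+1[%classic F)//.
  + rewrite (_ : _ @^-1` _ = [set s | (0 <= s < p j.+1 - p j)%R]).
      apply: eq_integral => s /set_mem/= => sp.
      by rewrite (FG j) ?addrK//; lra.
    by apply/seteqP; split=> s /=; rewrite !in_itv/=; lra.
  + by apply: measurable_funS mF => //; exact: leb_tdom.
  + by move=> s /sub; exact: F0.
- by rewrite -SE.
- by move=> s; rewrite -SE; exact: F0.
- apply/trivIsetP => i j _ _ ij; rewrite -subset0 => s [/=]; rewrite !in_itv/= => si sj.
  by move: ij; rewrite (slot_uniq pS si sj) eqxx.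
Qed.

End translation.

(** * Measurability of the running cost *)

Section running_cost.
Context {R : realType} {n m : nat}.
Variables (f : 'I_m -> 'rV[R]_n -> 'rV[R]_n) (l : 'rV[R]_n -> 'rV[R]_m -> R).
Hypothesis f_lip : lip_on_balls f.
Hypothesis l_cont : forall a, ctrl_set a -> continuous (fun x => l x a).

(** Off a countable set the control is locally constant, so continuity of [l] in the state alone
    makes the integrand continuous on the open set [D]. *)
Lemma cost_measurable S alpha y : traj f S alpha y ->
  (forall s, tdom S s -> ctrl_set (alpha s)) ->
  measurable_fun (tdom S : set (lebR R)) (fun s : lebR R => (l (y s) (alpha s))%:E).
Proof.
move=> ty aA; apply/measurable_EFinP => _ B mB; set A := (X in measurable X).
pose D : set R := tdom S `&` locally_constant S alpha.
have oD : open D.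
  rewrite openE => s [sS [h h0 Hh]].
  exists (h / 2); first by rewrite /= divr_gt0.
  move=> t /=; rewrite ltr_norml => st.
  have [|tS at_] := Hh t; first lra.
  split=> //; exists (h / 2); first by rewrite divr_gt0.
  by move=> t' tt'; rewrite at_; apply: Hh; lra.
have -> : A = (D `&` (fun s => l (y s) (alpha s)) @^-1` B) `|` (A `\` locally_constant S alpha).
  by rewrite /D setIAC -setIUr setUv setIT.
apply: measurableU; last first.
  apply: (leb_countable _).1.
  apply: sub_countable (traj_jumps_countable ty).
  by apply: subset_card_le => s [[sS _] ?]; split.
apply: leb_borel.
suff : measurable_fun D (fun s => l (y s) (alpha s)).
  by apply => //; exact: measurable_realfun.open_measurable.
apply: measurable_realfun.open_continuous_measurable_fun => // s /set_mem[sS [h h0 Hh]].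
have cy : {for s, continuous y}.
  apply/cvgrPdist_lt => e e0; have [h' h'0 Hh'] := traj_cont f_lip ty sS e0.
  exists (Num.min h h'); first by rewrite /= lt_min h0.
  move=> t /=; rewrite lt_min !ltr_norml => /andP[k1 k2].
  rewrite distrC; apply: Hh'; last lra.
  by have [|[]] := Hh t; first lra.
have : {for s, continuous ((fun x => l x (alpha s)) \o y)}.
  by apply: continuous_comp => //; apply: l_cont; exact: aA.
rewrite /prop_for /continuous_at; apply: cvg_trans; apply: near_eq_cvg.
exists h => // t /=; rewrite ltr_norml => st.
by have [|_ ->] := Hh t; first lra.
Qed.

End running_cost.

(** * The distance to the target and the function U *)

Section distance.
Context {R : realType} {n : nat}.
Implicit Types (T : set 'rV[R]_n) (x z : 'rV[R]_n).

Lemma enorm_ge0 x : 0 <= enorm x. Proof. exact: sqrtr_ge0. Qed.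

Lemma sqr_enorm x : enorm x ^+ 2 = \sum_i x ord0 i ^+ 2.
Proof. by rewrite sqr_sqrtr// sumr_ge0// => i _; rewrite sqr_ge0. Qed.

Lemma normv_le_enorm x : `|x| <= enorm x.
Proof.
rewrite normv_le ?enorm_ge0//; apply/forallP => i.
rewrite -(ler_pXn2r (ltn0Sn 1)) ?nnegrE ?enorm_ge0//.
rewrite real_normK ?num_real// sqr_enorm (bigD1 i)//= lerDl.
by apply: sumr_ge0 => j _; rewrite sqr_ge0.
Qed.

Lemma enormD x z : enorm (x + z) <= enorm x + enorm z.
Proof.
have e0 := enorm_ge0; have [x0|x0] := eqVneq (enorm x) 0.
  have : `|x| <= 0 by rewrite -x0 normv_le_enorm.
  by rewrite normr_le0 => /eqP ->; rewrite add0r lerDr.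
have [z0|z0] := eqVneq (enorm z) 0.
  have : `|z| <= 0 by rewrite -z0 normv_le_enorm.
  by rewrite normr_le0 => /eqP ->; rewrite addr0 lerDl.
have {}x0 : 0 < enorm x by rewrite lt_neqAle eq_sym x0 e0.
have {}z0 : 0 < enorm z by rewrite lt_neqAle eq_sym z0 e0.
rewrite -(ler_pXn2r (ltn0Sn 1)) ?nnegrE ?addr_ge0//.
rewrite sqrrD sqr_enorm.
set a := enorm x; set b := enorm z.
(* Cauchy-Schwarz, by summing [2 u v <= b / a u^2 + a / b v^2]; both norms are positive here. *)
have H : 2 * \sum_i x ord0 i * z ord0 i <= 2 * (a * b).
  rewrite mulr_sumr.
  have -> : 2 * (a * b) = \sum_i (b / a * x ord0 i ^+ 2 + a / b * z ord0 i ^+ 2).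
    rewrite big_split/= -!mulr_sumr -!sqr_enorm -/a -/b; field.
    by rewrite !gt_eqF.
  apply: ler_sum => i _; move: (x ord0 i) (z ord0 i) => u v.
  have : 0 <= (b * u - a * v) ^+ 2 / (a * b) by rewrite divr_ge0 ?sqr_ge0// mulr_ge0 ?ltW.
  have -> : (b * u - a * v) ^+ 2 / (a * b) = b / a * u ^+ 2 + a / b * v ^+ 2 - 2 * (u * v).
    by field; rewrite !gt_eqF.
  by rewrite subr_ge0.
have -> : \sum_i (x + z) ord0 i ^+ 2 =
    a ^+ 2 + 2 * (\sum_i x ord0 i * z ord0 i) + b ^+ 2.
  rewrite !sqr_enorm mulr_sumr -!big_split/=; apply: eq_bigr => i _.
  by rewrite mxE; ring.
by move: H; rewrite -mulr_natl; lra.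
Qed.

Lemma enorm_le_normv x : enorm x <= n%:R * `|x|.
Proof.
rewrite {1}[x]row_sum_delta.
apply: (@le_trans _ _ (\sum_(j < n) enorm (x ord0 j *: 'e_j))).
  elim/big_ind2 : _ => [|u a v b ua vb|//].
    by rewrite -[leRHS](normr0 R) /enorm big1 ?sqrtr0 ?normr0// => i _; rewrite mxE expr0n.
  exact: le_trans (enormD _ _) (lerD ua vb).
apply: (@le_trans _ _ (\sum_(j < n) `|x|)); last by rewrite sumr_const card_ord mulr_natl.
apply: ler_sum => j _; rewrite /enorm (bigD1 j)//= big1 => [|i ij].
  by rewrite !mxE !eqxx mulr1 addr0 sqrtr_sqr coord_le_normv.
by rewrite !mxE eqxx/= (negbTE ij) mulr0 expr0n.
Qed.

Lemma dist_leP T x c : (dist T x <= c%:E)%E <->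
  forall e, 0 < e -> exists2 t, T t & enorm (x - t) < c + e.
Proof.
split=> [dc e e0|H].
  have /ereal_inf_lt[_ [t Tt <-]] : (dist T x < (c + e)%:E)%E.
    by apply: le_lt_trans dc _; rewrite lte_fin ltrDl.
  by rewrite lte_fin; exists t.
apply/lee_addgt0Pr => e e0; have [t Tt xt] := H e e0.
by apply: ge_ereal_inf; exists (enorm (x - t))%:E; [exists t|rewrite lee_fin ltW].
Qed.

Lemma dist_ge0 T x : (0 <= dist T x)%E.
Proof. by apply: le_ereal_inf_tmp => _ [t _ <-]; rewrite lee_fin enorm_ge0. Qed.

Lemma dist_le_ge0 T x c : (dist T x <= c%:E)%E -> 0 <= c.
Proof. by move=> H; rewrite -lee_fin (le_trans (dist_ge0 T x)). Qed.

Lemma dist_bounded T x : T !=set0 -> exists c, (dist T x <= c%:E)%E.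
Proof.
by move=> [t Tt]; exists (enorm (x - t)); apply: ereal_inf_lbound; exists t.
Qed.

Lemma dist_lim T z c :
  (forall e, 0 < e -> exists2 x, (dist T x <= (c + e)%:E)%E & `|x - z| < e) -> (dist T z <= c%:E)%E.
Proof.
move=> H; apply/dist_leP => e e0.
(* Of the [n + 2] shares of [e], one is for the distance of [x], one for the choice of [t], and [n]
   for passing from the maximum norm to [enorm]. *)
have n1 : 0 < n%:R + 2 :> R by rewrite ltr_wpDl.
have [x xc xz] := H _ (divr_gt0 e0 n1).
have /dist_leP/(_ _ (divr_gt0 e0 n1))[t Tt xt] := xc.
exists t => //; rewrite (_ : z - t = (x - t) + (z - x)); last first.
  by apply/rowP => i; rewrite !mxE; ring.
apply: le_lt_trans (enormD _ _) _.
rewrite [ltRHS](_ : _ = c + e / (n%:R + 2) + e / (n%:R + 2) + n%:R * (e / (n%:R + 2))).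
  apply: ltr_leD => //; apply: le_trans (enorm_le_normv _) _.
  by rewrite ler_wpM2l// distrC ltW.
by field; rewrite gt_eqF.
Qed.

Lemma dist0_closed T x : closed T -> (dist T x <= 0%:E)%E -> T x.
Proof.
move=> cT /dist_leP H; apply: cT => B /nbhs_normP[e /= e0 eB].
have [t Tt xt] := H _ e0; exists t; split=> //; apply: eB => /=.
by apply: le_lt_trans (normv_le_enorm _) _; rewrite -(add0r e).
Qed.

Lemma dist_cvg0 T (U : Type) (F : set_system U) (y : U -> 'rV[R]_n) : Filter F ->
  (forall e, 0 < e -> \forall s \near F, (dist T (y s) <= e%:E)%E) ->
  dist T (y s) @[s --> F] --> 0%E.
Proof.
move=> FF H; apply/fine_cvgP; split.
  apply: filterS (H 1 ltr01) => s ds; rewrite ge0_fin_numE ?dist_ge0//.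
  by rewrite (le_lt_trans ds)// ltry.
apply/cvgrPdist_le => e e0; apply: filterS (H _ e0) => s ds /=.
have fd : dist T (y s) \is a fin_num.
  by rewrite ge0_fin_numE ?dist_ge0// (le_lt_trans ds)// ltry.
rewrite sub0r normrN ger0_norm ?fine_ge0 ?dist_ge0//.
by rewrite -lee_fin fineK.
Qed.

Lemma cvg0_dist T (U : Type) (F : set_system U) (y : U -> 'rV[R]_n) : Filter F ->
  dist T (y s) @[s --> F] --> 0%E ->
  forall e, 0 < e -> \forall s \near F, (dist T (y s) <= e%:E)%E.
Proof.
move=> FF /fine_cvgP[fd /cvgrPdist_le H] e e0.
apply: filterS2 fd (H _ e0) => s fs /=; rewrite sub0r normrN => se.
by rewrite -(fineK fs) lee_fin; apply: le_trans se; exact: ler_norm.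
Qed.

End distance.

(** * The region near the target and the behaviour of [U] there *)

Section geometry.
Context {R : realType} {n : nat}.
Variable T : set 'rV[R]_n.
Hypotheses (T_closed : closed T) (T_boundary : compact (boundary T)).

(** The point sits at the supremum of the parameters where the segment is outside [T]: it belongs to
    [T], as the complement is open, and is a limit of outside points. *)
Lemma segment_boundary x t : ~ T x -> T t -> exists2 s, 0 <= s <= 1 &
  boundary T (x + s *: (t - x)).
Proof.
move=> Tx Tt; pose g s := x + s *: (t - x).
pose E := [set s : R | 0 <= s <= 1 /\ ~ T (g s)].
have E0 : E 0 by split; rewrite ?lexx ?ler01// /g scale0r addr0.
have hE : has_sup E by split; [exists 0|exists 1 => s [/andP[]]].
have s0 : 0 <= sup E by apply: sup_upper_bound.
have s1 : sup E <= 1 by apply: ge_sup; [exists 0|move=> s [/andP[]]].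
have gc : continuous g.
  apply: (@continuous_lip _ _ _ _ `|t - x|) => // a b.
  by rewrite /g opprD addrACA subrr add0r -scalerBl normrZ mulrC.
exists (sup E); first by rewrite s0.
have Ts : T (g (sup E)).
  apply: contrapT => nT.
  have s1' : sup E < 1.
    rewrite lt_neqAle s1 andbT; apply/eqP => sE; apply: nT.
    by rewrite sE /g scale1r addrC subrK.
  have : nbhs (sup E) (g @^-1` ~` T).
    by apply: gc; apply: open_nbhs_nbhs; split=> //; exact: closed_openC.
  move=> /nbhs_normP[e /= e0 H].
  pose s := Num.min 1 (sup E + e / 2).
  have ss : sup E < s by rewrite lt_min s1' ltrDl divr_gt0.
  suff /(sup_upper_bound hE) : E s by rewrite leNgt ss.
  split; first by rewrite (le_trans s0 (ltW ss)) ge_min lexx.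
  apply: H => /=; rewrite ltr0_norm ?subr_lt0// opprB ltrBlDl.
  by rewrite gt_min ltrD2l; apply/orP; right; lra.
split; first exact: subset_closure.
move=> iT; have /nbhs_normP[e /= e0 H] : nbhs (sup E) (g @^-1` T).
  by apply: gc; exact: iT.
have [s [s01 nTs] es] := sup_adherent e0 hE.
have : s <= sup E by apply: sup_upper_bound => //; split.
move=> sE; apply: nTs; apply: H => /=; move: sE.
by rewrite -subr_ge0 => /ger0_norm ->; rewrite ltrBlDr -ltrBlDl.
Qed.

(** [T] may be unbounded, but the segment from [x] to a nearly closest point of [T] meets the
    compact boundary within [c + 1] of [x]. *)
Lemma dist_le_bounded c : exists r, forall x, ~ T x -> (dist T x <= c%:E)%E -> `|x| <= r.
Proof.
have [M [_ HM]] := compact_bounded T_boundary.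
exists (M + 1 + (c + 1)) => x Tx /dist_leP/(_ _ ltr01)[t Tt xt].
have [s /andP[s0 s1] bs] := segment_boundary Tx Tt.
rewrite -[x](subrK (x + s *: (t - x))) addrC.
apply: le_trans (ler_normD _ _) _; apply: lerD.
  by apply: (HM (M + 1)); rewrite ?ltrDl//.
rewrite opprD addrA subrr add0r normrN normrZ ger0_norm//.
apply: le_trans (ltW xt); apply: le_trans (normv_le_enorm _); rewrite distrC.
by rewrite ler_piMl.
Qed.

Variable U : 'rV[R]_n -> R.
Hypothesis U_prop : cont_proper_posdef (~` T) U.

Lemma U_cont x : closure (~` T) x -> forall e, 0 < e -> exists2 h, 0 < h &
  forall z, closure (~` T) z -> `|z - x| < h -> `|U z - U x| < e.
Proof.
case: U_prop => + _ _ => /subspace_continuousP Uc cx e e0.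
have /cvgrPdist_lt/(_ e e0) := Uc x cx.
rewrite near_withinE => /nbhs_normP[h /= h0 H]; exists h => // z cz zx.
by rewrite distrC; apply: H => //=; rewrite distrC.
Qed.

Lemma closureCT x : closure (~` T) x -> T x -> boundary (~` T) x.
Proof. by move=> cx Tx; split => // /interior_subset. Qed.

Lemma U_gt0 x : ~ T x -> 0 < U x.
Proof. by case: U_prop => _ _ [H _]; exact: H. Qed.

Lemma U_boundary x : closure (~` T) x -> T x -> U x = 0.
Proof. by move=> cx /(closureCT cx); case: U_prop => _ _ [_ H]; exact: H. Qed.

Lemma U_ge0 x : closure (~` T) x -> 0 <= U x.
Proof.
move=> cx; have [Tx|Tx] := pselect (T x); first by rewrite U_boundary.
exact: ltW (U_gt0 Tx).
Qed.

(** Compactness of the ball given by [dist_le_bounded]. Arbitrarily late indices are provided so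
    that [x k] can be compared with [z] while other quantities tend to their limits. *)
Lemma dist_le_cluster (x : nat -> 'rV[R]_n) c :
  (forall k, ~ T (x k)) -> (forall k, (dist T (x k) <= c%:E)%E) ->
  exists2 z, closure (~` T) z & forall e, 0 < e -> forall N, exists k,
    [/\ (N <= k)%N, `|x k - z| < e & `|U (x k) - U z| < e].
Proof.
move=> Tx dx; have [r Hr] := dist_le_bounded c.
pose K : set 'rV[R]_n := [set z | `|z| <= r].
have cK : compact K.
  apply: bounded_closed_compact.
    by exists r; split; [exact: num_real|move=> M rM z /= zr; exact: le_trans zr (ltW rM)].
  apply: (@closed_comp _ _ (fun z : 'rV[R]_n => `|z|) [set v : R | v <= r]).
    by move=> z _; exact: norm_continuous.
  exact: closed_le.
have [|z [_ zc]] := cK (x k @[k --> \oo]) _.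
  by exists 0%N => // k _; exact: Hr (Tx k) (dx k).
have zcl : closure (~` T) z.
  move=> B zB; have [|w [Tw Bw]] := zc (~` T) B _ zB.
    by exists 0%N => // k _; exact: Tx.
  by exists w.
exists z => // e e0 N; have [h h0 Hh] := U_cont zcl e0.
have [||w [[k Nk <-] kz]] := zc (x @` [set k | (N <= k)%N]) (ball z (Num.min e h)).
- by exists N => // k Nk; exists k.
- by apply: nbhsx_ballx; rewrite lt_min e0.
move: kz; rewrite -ball_normE/= distrC lt_min => /andP[ke kh].
exists k; split=> //; apply: Hh => //; exact: subset_closure (Tx k).
Qed.

Lemma U_le c : exists M, forall x, ~ T x -> (dist T x <= c%:E)%E -> U x <= M.
Proof.
apply: contrapT => nM.
have /choice[x Hx] : forall k : nat, exists x, [/\ ~ T x, (dist T x <= c%:E)%E & k%:R < U x].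
  move=> k; apply: contrapT => nx; apply: nM; exists k%:R => x Tx dx.
  by rewrite leNgt; apply/negP => kx; apply: nx; exists x.
have [k|k|z zc] := @dist_le_cluster x c _ _; [by case: (Hx k)|by case: (Hx k)|].
move=> /(_ 1 ltr01 (Num.trunc `|U z + 1|).+1)[k [Nk _]].
case: (Hx k) => _ _ kU; rewrite ltr_norml => /andP[_].
rewrite ltrBlDr addrC => /(lt_trans kU); apply/negP; rewrite -leNgt.
apply: le_trans (ler_norm _) (ltW _); apply: lt_le_trans (truncnS_gt _) _.
by rewrite ler_nat.
Qed.

(** Otherwise points with [U >= c] and distance tending to 0 would cluster at a point of [T] in the
    closure of its complement, where [U] vanishes. *)
Lemma U_small c : 0 < c -> exists2 d, 0 < d &
  forall x, ~ T x -> (dist T x <= d%:E)%E -> U x < c.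
Proof.
move=> c0; apply: contrapT => nd.
have /choice[x Hx] : forall k : nat, exists x,
    [/\ ~ T x, (dist T x <= (k.+1%:R^-1)%:E)%E & c <= U x].
  move=> k; apply: contrapT => nx; apply: nd; exists k.+1%:R^-1 => // x Tx dx.
  by rewrite ltNge; apply/negP => kx; apply: nx; exists x.
have [k|k|z zc zx] := @dist_le_cluster x 1 _ _.
- by case: (Hx k).
- case: (Hx k) => _ + _ => /le_trans; apply; rewrite lee_fin invf_le1//.
  by rewrite ler1n.
have Tz : T z.
  apply: dist0_closed => //; apply: dist_lim => e e0.
  have [k [Nk kz _]] := zx e e0 (Num.trunc e^-1); exists (x k) => //.
  case: (Hx k) => _ + _ => /le_trans; apply; rewrite lee_fin add0r.
  rewrite -[leRHS]invrK lef_pV2 ?posrE ?invr_gt0//.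
  by apply: ltW (lt_le_trans (truncnS_gt _) _); rewrite ler_nat ltnS.
have [k [_ _]] := zx c c0 0%N; rewrite (U_boundary zc Tz) subr0.
by case: (Hx k) => _ _ /le_lt_trans H /(le_lt_trans (ler_norm _))/H; rewrite ltxx.
Qed.

(** [w d] is the supremum of [U] over the points outside [T] within [d], plus [d] to make it
    positive. It turns bounds on the distance into bounds on [U]. *)
Lemma U_modulus : exists w : R -> R, [/\ forall d, 0 < d -> 0 < w d,
  forall d x, ~ T x -> (dist T x <= d%:E)%E -> U x <= w d & w d @[d --> 0^'+] --> 0].
Proof.
pose E d := [set v | v = 0 \/ exists2 x, ~ T x /\ (dist T x <= d%:E)%E & v = U x].
have hE d : has_sup (E d).
  split; first by exists 0; left.
  have [M HM] := U_le d; exists (Num.max 0 M) => v [->|[x [Tx dx] ->]].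
    by rewrite le_max lexx.
  by rewrite le_max (HM _ Tx dx) orbT.
have E0 d : 0 <= sup (E d) by apply: sup_upper_bound => //; left.
exists (fun d => sup (E d) + d); split.
- by move=> d d0; rewrite ltr_wpDl.
- move=> d x Tx dx; apply: (@le_trans _ _ (sup (E d))).
    by apply: sup_upper_bound => //; right; exists x.
  by rewrite lerDl; exact: dist_le_ge0 dx.
apply/cvgrPdist_le => e e0; have e20 : 0 < e / 2 by rewrite divr_gt0.
have [d d0 Hd] := U_small e20.
near=> s; rewrite sub0r normrN ger0_norm; last by rewrite addr_ge0//; near: s; exact: nbhs_right_ge.
rewrite [leRHS](_ : _ = e / 2 + e / 2); last by field.
apply: lerD; last by near: s; exact: nbhs_right_le.
apply: ge_sup; first by exists 0; left.
move=> v [->|[x [Tx dx] ->]]; first exact: ltW.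
apply: ltW; apply: Hd => //; apply: le_trans dx _; rewrite lee_fin.
near: s; exact: nbhs_right_le.
Unshelve. all: by end_near. Qed.

End geometry.

(** * Functions of class K-infinity *)

Section class_Kinf_theory.
Context {R : realType}.
Variable g : R -> R.
Hypothesis gK : class_Kinf g.

Lemma Kinf_lt s t : 0 <= s -> s < t -> g s < g t.
Proof. by case: gK => _ _ H _; exact: H. Qed.

Lemma Kinf_le s t : 0 <= s -> s <= t -> g s <= g t.
Proof. by move=> s0; rewrite le_eqVlt => /predU1P[->//|/(Kinf_lt s0)/ltW]. Qed.

Lemma Kinf_lt_inv s t : 0 <= t -> g s < g t -> s < t.
Proof.
move=> t0 st; rewrite ltNge; apply/negP => /(Kinf_le t0).
by rewrite leNgt st.
Qed.

Lemma Kinf_inj s t : 0 <= s -> 0 <= t -> g s = g t -> s = t.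
Proof.
move=> s0 t0 st; apply/eqP; case: (ltgtP s t) => // /Kinf_lt; rewrite st ltxx.
  by move/(_ s0).
by move/(_ t0).
Qed.

Lemma Kinf_gt0 s : 0 < s -> 0 < g s.
Proof. by case: gK => g0 _ _ _ s0; rewrite -g0 Kinf_lt. Qed.

Lemma Kinf_cont s : 0 <= s -> forall e, 0 < e -> exists2 h, 0 < h &
  forall t, 0 <= t -> `|t - s| < h -> `|g t - g s| < e.
Proof.
move=> s0 e e0; case: gK => _ /subspace_continuousP/(_ s s0) + _ _.
move=> /cvgrPdist_lt/(_ e e0); rewrite near_withinE => -[h /= h0 H].
exists h => // t t0 ts; rewrite distrC; apply: H => //.
by rewrite /= distrC.
Qed.

Lemma Kinf_small e : 0 < e -> exists2 h, 0 < h & forall t, 0 <= t <= h -> g t < e.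
Proof.
move=> e0; have [h h0 H] := Kinf_cont (lexx 0) e0.
exists (h / 2); first by rewrite divr_gt0.
move=> t /andP[t0 th]; have := H t t0; case: gK => -> _ _ _.
rewrite !subr0 ger0_norm// => /(_ _)/(le_lt_trans (ler_norm _)); apply; lra.
Qed.

Lemma Kinf_onto v : 0 <= v -> exists2 s, 0 <= s & g s = v.
Proof.
move=> v0; case: (gK) => g0 gc _ /(_ v)[b b0 vb].
have gc' : {within `[0, b], continuous g}.
  apply: continuous_subspaceW gc => s /=; rewrite in_itv/= => /andP[].
  by [].
have [|s] := IVT b0 gc' (v := v).
  by rewrite g0 ge_min le_max v0/= (ltW vb) orbT.
by rewrite in_itv/= => /andP[s0 _] gs; exists s.
Qed.

End class_Kinf_theory.

Section lebesgue_intervals.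
Context {R : realType}.

Lemma leb_co (a b : R) : measurable ([set s | a <= s < b] : set (lebR R)).
Proof.
apply: leb_borel; rewrite (_ : [set s | _] = `[a, b[%classic); first exact: measurable_itv.
by apply/seteqP; split=> s /=; rewrite in_itv.
Qed.

Lemma leb_cc (a b : R) : measurable ([set s | a <= s <= b] : set (lebR R)).
Proof.
apply: leb_borel; rewrite (_ : [set s | _] = `[a, b]%classic); first exact: measurable_itv.
by apply/seteqP; split=> s /=; rewrite in_itv.
Qed.

End lebesgue_intervals.

(** * Concatenation of stages *)

Section stage.
Context {R : realType} {n m : nat}.
Variables (f : 'I_m -> 'rV[R]_n -> 'rV[R]_n) (T : set 'rV[R]_n).
Variable l : 'rV[R]_n -> 'rV[R]_m -> R.
Hypotheses (f_lip : lip_on_balls f) (T_closed : closed T) (T_boundary : compact (boundary T)).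
Variables (k : nat) (V : 'rV[R]_n -> label (m := m)) (U : 'rV[R]_n -> R).
Variables (d : R -> R -> k.-tuple R) (Gam phi : R -> R) (Tm : R -> R -> R).
Hypothesis stab : stabilizes f T V U d Gam phi Tm.

Lemma U_traj_cont S alpha y : traj f S alpha y -> (forall s, tdom S s -> ~ T (y s)) ->
  forall t, tdom S t -> forall e, 0 < e -> exists2 h, 0 < h &
  forall s, tdom S s -> t - h < s < t + h -> `|U (y s) - U (y t)| < e.
Proof.
move=> ty yT t tS e e0.
have yC s : tdom S s -> closure (~` T) (y s) by move=> sS; apply: subset_closure; exact: yT.
have [h1 h10 H1] := U_cont (stab_U stab) (yC _ tS) e0.
have [h h0 H] := traj_cont f_lip ty tS h10.
exists h => // s sS ts; apply: H1; first exact: yC.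
by apply: H => //; case: sS.
Qed.

(** A finite end means approach to the target, where [U] tends to 0. Hence hitting times fall before
    the end and not in the extension. *)
Lemma finite_hits x S alpha y c : admissible_pair f T x S alpha y -> (S < +oo)%E ->
  0 < c -> exists2 s, tdom S s & U (y s) <= c.
Proof.
move=> adm Sfin c0; have := sol_dom (adm_sol adm).
case: S adm Sfin => [b| |]// adm bfin; rewrite lte_fin => b0.
have [del del0 Hdel] := U_small T_closed T_boundary (stab_U stab) c0.
have near_b := cvg0_dist _ (adm_end adm bfin) del0.
near b^'- => s.
have sS : tdom b%:E s.
  split; first by near: s; exact: nbhs_left_ge.
  by rewrite lte_fin; near: s; exact: nbhs_left_lt.
exists s => //; apply/ltW/Hdel; first exact: (adm_out adm sS).
near: s; exact: near_b.
Unshelve. all: by end_near. Qed.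

(** [t] is the hitting time of the level [phi r]. The alternative on [U (y t)] says that the level
    is not overshot, except possibly at time 0; the cost estimate relies on it because [Psi]
    decreases in its second variable. *)
Lemma stage_ex r rad x : 0 < r < rad -> ~ T x -> (dist T x <= rad%:E)%E ->
  exists S alpha y, [/\ traj f S alpha y, admissible_pair f T x S alpha y,
    forall s, tdom S s -> (dist T (y s) <= (Gam rad)%:E)%E,
    forall tau s, 0 < tau -> tau <= s -> tdom S s -> U (y tau) <= phi r ->
      (dist T (y s) <= r%:E)%E &
    exists t, [/\ tdom S t, t <= Tm rad r, U (y t) <= phi r, t = 0 \/ phi r <= U (y t) &
      forall Lam Psi, cost_regulated f l T V U d phi Lam Psi ->
       (cost l alpha y t <= (Lam rad * Psi (U x) (U (y t)))%:E)%E]].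
Proof.
move=> /andP[r0 rrad] Tx dx; have rad0 := lt_trans r0 rrad.
have rr : 0 < r < rad by rewrite r0.
have [p [N [S [alpha [y [sp sc ty]]]]]] :=
  sampling_ex f_lip (stab_feedback stab) (stab_d stab rad0 r0) Tx.
have [adm dy hit inv] := stab_proc stab rr sp sc dx.
have creg Lam Psi := fun H : cost_regulated f l T V U d phi Lam Psi =>
  H _ _ _ _ _ _ _ _ rr sp sc dx.
set ye := ext S y in dy hit inv creg.
have yeE s : tdom S s -> ye s = y s by move=> [_ sS]; rewrite /ye /ext sS.
have yT := adm_out adm.
have Uy := U_traj_cont ty yT.
exists S, alpha, y; split => //.
  by move=> s sS; rewrite -yeE//; apply: dy; case: sS.
  move=> tau s tau0 ts sS Ut; rewrite -yeE//; apply: (inv tau) => //.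
  by rewrite yeE//; apply: tdom_le sS => //; exact: ltW.
pose H := hitting_time U ye (phi r).
have H0 : (0 <= H)%E by apply: le_ereal_inf_tmp => _ [s [s0 _] <-]; rewrite lee_fin.
have Hfin : H \is a fin_num by rewrite ge0_fin_numE// (le_lt_trans hit)// ltry.
pose t := fine H; have tH : t%:E = H by rewrite fineK.
have Hle s : tdom S s -> U (y s) <= phi r -> t <= s.
  move=> sS Us; rewrite -lee_fin tH; apply: ereal_inf_lbound.
  by exists s => //; split; [case: sS|rewrite yeE].
have t0 : 0 <= t by rewrite -lee_fin tH.
have phir : 0 < phi r := Kinf_gt0 (stab_phi stab) r0.
have S0 := sol_dom (adm_sol adm).
have tS : tdom S t.
  have [Sfin|] := boolP (S < +oo)%E; last first.
    by rewrite ltNge negbK leye_eq => /eqP ->; split=> //; rewrite ltry.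
  have [s sS Us] := finite_hits adm Sfin phir.
  exact: tdom_le t0 (Hle _ sS Us) sS.
exists t; split=> //.
- by rewrite -lee_fin tH.
(* Were [U] above [phi r] at [t], continuity would keep it there for a while, against the definition
   of the infimum. *)
- rewrite leNgt; apply/negP => rU.
  have e0 : 0 < U (y t) - phi r by rewrite subr_gt0.
  have [h h0 Hh] := Uy t tS _ e0; have [h' h'0 Hh'] := tdom_right tS.
  have : (H < (t + Num.min h h')%:E)%E by rewrite -tH lte_fin ltrDl lt_min h0.
  move=> /ereal_inf_lt[_ [s [s0 Us] <-]]; rewrite lte_fin -ltrBlDl lt_min => /andP[sh sh'].
  have sS : tdom S s by apply: Hh' => //; rewrite -ltrBlDl.
  rewrite yeE// in Us; have ts := Hle _ sS Us.
  have := Hh s sS; rewrite ltr_norml => /(_ _)/andP[|k1 k2]; first lra.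
  by move: Us; rewrite leNgt => /negP; apply; lra.
- have [|tn0] := eqVneq t 0; [by left|right].
  have {}tn0 : 0 < t by rewrite lt_neqAle eq_sym tn0.
  rewrite leNgt; apply/negP => rU.
  have e0 : 0 < phi r - U (y t) by rewrite subr_gt0.
  have [h h0 Hh] := Uy t tS _ e0.
  (* An earlier time at which [U] would still be below the level. *)
  pose s := t - Num.min h t / 2.
  have ht : 0 < Num.min h t by rewrite lt_min h0.
  have hh : Num.min h t <= h by rewrite ge_min lexx.
  have htt : Num.min h t <= t by rewrite ge_min lexx orbT.
  have sS : tdom S s by apply: tdom_le tS; rewrite /s; lra.
  have := Hh s sS; rewrite ltr_norml => /(_ _)/andP[|k1 k2]; first by rewrite /s; lra.
  have : t <= s by apply: Hle => //; lra.
  by rewrite /s; lra.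
- move=> Lam Psi /creg/=; rewrite -/H -/t (yeE _ tS) => /(le_trans _); apply.
  by rewrite /ext; case: tS => _ ->.
Qed.

(* Property (iii) concerns positive times only, so it is applied to r + e at a small
   positive time, both of which then tend to 0. *)
Lemma U_le_phi_dist x r : T !=set0 -> ~ T x -> 0 < r -> U x <= phi r -> (dist T x <= r%:E)%E.
Proof.
move=> T0 Tx r0 Ux; apply/lee_addgt0Pr => e e0.
have [c dc] := dist_bounded x T0.
pose r' := r + e; pose rad := Num.max (r' + 1) c.
have r'rad : 0 < r' < rad by rewrite /rad lt_max addr_gt0//= ltrDl ltr01.
have dx : (dist T x <= rad%:E)%E by apply: le_trans dc _; rewrite lee_fin /rad le_max lexx orbT.
have [S [alpha [y [ty adm _ inv _]]]] := stage_ex r'rad Tx dx.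
have y0 := sol_init (adm_sol adm).
have S0 : tdom S 0 by split=> //; exact: sol_dom (adm_sol adm).
have Ux' : U x < phi r'.
  by apply: le_lt_trans Ux _; apply: (Kinf_lt (stab_phi stab)); rewrite ?ltW// /r'; lra.
have e'0 : 0 < phi r' - U x by rewrite subr_gt0.
have [h h0 Hh] := U_traj_cont ty (adm_out adm) S0 e'0.
have [h1 h10 Hh1] := tdom_right S0.
apply: dist_lim => e1 e10; have [h2 h20 Hh2] := traj_cont f_lip ty S0 e10.
pose s := Num.min h (Num.min h1 h2) / 2.
have m0 : 0 < Num.min h (Num.min h1 h2) by rewrite !lt_min h0 h10.
have m1 : Num.min h (Num.min h1 h2) <= h by rewrite ge_min lexx.
have m2 : Num.min h (Num.min h1 h2) <= h1 by rewrite !ge_min lexx !orbT.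
have m3 : Num.min h (Num.min h1 h2) <= h2 by rewrite !ge_min lexx !orbT.
have s0 : 0 < s by rewrite divr_gt0.
have sS : tdom S s by apply: Hh1; rewrite /s; lra.
exists (y s); last by rewrite -y0; apply: Hh2; rewrite /s; lra.
apply: (@le_trans _ _ r'%:E); last by rewrite lee_fin /r'; lra.
apply: (inv s s) => //.
have := Hh s sS; rewrite y0 ltr_norml => /(_ _)/andP[|k1 k2]; first by rewrite /s; lra.
lra.
Qed.

(** The ends [p] of the stages are exposed because settling times are counted in stages. Their
    supremum [S] may be finite or infinite. In the cost clause, [U x <= phi (rho 0)] serves the
    first stage; the later ones start below their level by construction. *)
Lemma chain_ex (rho : nat -> R) x : T !=set0 -> ~ T x -> (forall i, 0 < rho i.+1 < rho i) ->
  (forall e, 0 < e -> exists i, rho i < e) -> (dist T x <= (rho 0%N)%:E)%E ->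
  exists S alpha y (p : nat -> R), [/\ admissible_pair f T x S alpha y,
   p 0%N = 0 /\ forall i, p i.+1 <= p i + Tm (rho i) (rho i.+1),
   forall i s, 0 <= s -> p i <= s -> (dist T (ext S y s) <= (Gam (rho i))%:E)%E,
   dist T (ext S y s) @[s --> +oo] --> 0%E &
   forall Lam Psi, cost_factors k Lam Psi -> cost_regulated f l T V U d phi Lam Psi ->
     (forall x a, ctrl_set a -> 0 <= l x a) ->
     (forall a, ctrl_set a -> continuous (fun x => l x a)) -> U x <= phi (rho 0%N) ->
     (\int[leb]_(s in (tdom S : set (lebR R))) (l (y s) (alpha s))%:E <=
      \sum_(0 <= i <oo) (Lam (rho i) * Psi (phi (rho i)) (phi (rho i.+1)))%:E)%E].
Proof.
move=> T0 Tx rho_decr rho_small dx.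
have phiK := stab_phi stab; have GamK := stab_Gam stab.
have rho0 i : 0 < rho i by have /andP[r1 r2] := rho_decr i; exact: lt_trans r2.
have rho_le i j : (i <= j)%N -> rho j <= rho i.
  move=> /subnKC <-; elim: (j - i)%N => [|q IH]; first by rewrite addn0.
  by rewrite addnS; apply: le_trans IH; apply: ltW; case/andP: (rho_decr (i + q)%N).
pose stage i z (D : \bar R * (R -> 'rV[R]_m) * (R -> 'rV[R]_n) * R) :=
  let: (b, alpha, y, t) := D in
  [/\ traj f b alpha y, admissible_pair f T z b alpha y,
    forall s, tdom b s -> (dist T (y s) <= (Gam (rho i))%:E)%E, tdom b t &
    [/\ t <= Tm (rho i) (rho i.+1), U (y t) <= phi (rho i.+1), t = 0 \/ phi (rho i.+1) <= U (y t) &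
      forall Lam Psi, cost_regulated f l T V U d phi Lam Psi ->
       (cost l alpha y t <= (Lam (rho i) * Psi (U z) (U (y t)))%:E)%E]].
(* The choice ranges over all pairs; an unsuitable point gets the horizon [-oo], for which being a
   trajectory is vacuous. *)
have /choice[D HD] : forall q : nat * 'rV[R]_n, exists D, traj f D.1.1.1 D.1.1.2 D.1.2 /\
    (~ T q.2 -> (dist T q.2 <= (rho q.1)%:E)%E -> stage q.1 q.2 D).
  move=> [i z]; have [[Tz dz]|nz] := pselect (~ T z /\ (dist T z <= (rho i)%:E)%E).
    have [S [alpha [y [ty ay dy _ [t [t1 t2 t3 t4 t5]]]]]] := stage_ex (rho_decr i) Tz dz.
    by exists (S, alpha, y, t); split=> //= _ _; split.
  exists (-oo%E, fun=> 0, fun=> 0, 0); split=> /=; last by move=> Tz dz; case: nz.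
  by move=> s [].
pose B i z := (D (i, z)).1.1.1; pose A i z := (D (i, z)).1.1.2.
pose Y i z := (D (i, z)).1.2; pose t i z := (D (i, z)).2.
have stE i z : ~ T z -> (dist T z <= (rho i)%:E)%E -> stage i z (B i z, A i z, Y i z, t i z).
  by move=> Tz dz; have := (HD (i, z)).2 Tz dz; rewrite /B /A /Y /t /=;
    case: (D _) => [[[? ?] ?] ?].
pose X := fix X i := if i is i'.+1 then Y i' (X i') (t i' (X i')) else x.
have HX i : [/\ ~ T (X i), (dist T (X i) <= (rho i)%:E)%E & (0 < i)%N -> U (X i) <= phi (rho i)].
  elim: i => [|i [IH1 IH2 _]]; first by split.
  have [_ ay _ tS [_ Ut _ _]] := stE _ _ IH1 IH2.
  have TX : ~ T (X i.+1) by exact: (adm_out ay tS).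
  by split=> //; apply: (U_le_phi_dist T0 TX (rho0 _)).
have stX i := stE i (X i) (let: And3 a _ _ := HX i in a) (let: And3 _ b _ := HX i in b).
have Y0 i : Y i (X i) 0 = X i.
  by have [_ ay _ _ _] := stX i; exact: sol_init (adm_sol ay).
pose p i := \sum_(j < i) t j (X j).
have pS i : p i.+1 = p i + t i (X i) by rewrite /p big_ord_recr.
have pt i : p i.+1 - p i = t i (X i) by rewrite pS addrAC subrr add0r.
have t0 i : 0 <= t i (X i) by have [_ _ _ tS _] := stX i; case: tS.
have ple i : p i <= p i.+1 by rewrite pS lerDl.
have p0 : p 0%N = 0 by rewrite /p big_ord0.
have pge0 i : 0 <= p i by rewrite -p0 nondecr_seq_le.
(* Equal times mean stages of length zero, which do not move the point. *)
have Xeq i j : (i <= j)%N -> p j = p i -> X j = X i.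
  move=> /subnKC <-; elim: (j - i)%N => [|q IH]; first by rewrite addn0.
  rewrite addnS => pq.
  have pq' : p (i + q)%N = p i.
    by apply/eqP; rewrite eq_le -{1}pq ple/= (nondecr_seq_le ple)// leq_addr.
  have tq : t (i + q)%N (X (i + q)%N) = 0 by rewrite -pt pq pq' subrr.
  by rewrite -IH//= tq Y0.
(* A stage has length 0 if U already lies below its target level, but as U > 0
   off T this cannot happen forever. *)
have pinf i : exists2 j, (i <= j)%N & p i < p j.
  have Ui : 0 < U (X i) by have [Ti _ _] := HX i; exact: (U_gt0 (stab_U stab)).
  have [h h0 Hh] := Kinf_small phiK Ui; have [j0 rj0] := rho_small _ h0.
  pose j := maxn i.+1 j0; exists j; first exact: leq_trans (leqnSn i) (leq_maxl _ _).
  have ij : (i <= j)%N by exact: leq_trans (leqnSn i) (leq_maxl _ _).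
  rewrite lt_neqAle (nondecr_seq_le ple)// andbT; apply/eqP => pij.
  have [_ _ /(_ _)] := HX j; rewrite (Xeq i j)// => /(_ (leq_trans (ltn0Sn i) (leq_maxl _ _))).
  rewrite leNgt Hh// ltW//= ltW//; apply: le_lt_trans rj0; apply: rho_le; exact: leq_maxr.
have [y yE] := concat_ex (fun j => Y j (X j)) ple.
have [alpha aE] := concat_ex (fun j => A j (X j)) ple.
pose S := ereal_sup [set (p i)%:E | i in setT].
have pSlt i : ((p i)%:E < S)%E.
  have [j _ pij] := pinf i; apply: (@lt_le_trans _ _ (p j)%:E); first by rewrite lte_fin.
  by apply: ereal_sup_ubound; exists j.
have slot s : tdom S s -> exists j, p j <= s < p j.+1.
  move=> [s0 /ereal_sup_gt[_ [N _ <-]]]; rewrite lte_fin => sN.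
  by apply: slot_ex sN; rewrite p0.
have SE : tdom S = \bigcup_j `[p j, p j.+1[%classic.
  apply/seteqP; split=> s; first by move=> /slot[j sj]; exists j => //=; rewrite in_itv.
  move=> [j _ /=]; rewrite in_itv/= => /andP[ps sp]; split; first exact: le_trans ps.
  by apply: lt_trans (pSlt j.+1); rewrite lte_fin.
have slotB j s : p j <= s < p j.+1 -> tdom (B j (X j)) (s - p j).
  move=> /andP[ps sp]; have [_ _ _ tS _] := stX j; apply: tdom_le tS; first by rewrite subr_ge0.
  by rewrite -pt lerD2r ltW.
(* The slot containing [p i] may have a later index [j]; the slots between are empty, so
   [X j = X i]. *)
have yp i : y (p i) = X i.
  have [j pj] := slot _ (conj (pge0 i) (pSlt i)); rewrite (yE j)//.
  case/andP: pj => pji pij.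
  have ij : (i <= j)%N.
    by rewrite leqNgt; apply/negP => /(nondecr_seq_le ple); rewrite leNgt pij.
  have pp : p j = p i by apply/eqP; rewrite eq_le pji nondecr_seq_le.
  by rewrite pp subrr Y0; apply: Xeq.
have ty : traj f S alpha y.
  move=> s /slot[j sj].
  apply: (concat_traj p0 ple yE aE (fun j => (HD (j, X j)).1)) sj (slotB _ _ sj) _.
  move=> i _; rewrite yp pt; split=> //.
  by have [_ _ _ tS _] := stX i.
have S0 : (0 < S)%E by have := pSlt 0%N; rewrite p0.
have y0 : y 0 = x by rewrite -p0 yp.
have yT s : tdom S s -> ~ T (y s).
  move=> /slot[j sj]; rewrite (yE j)//.
  by have [_ ay _ _ _] := stX j; exact: (adm_out ay (slotB _ _ sj)).
have yA s : tdom S s -> ctrl_set (alpha s).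
  move=> /slot[j sj]; rewrite (aE j)//.
  by have [_ ay _ _ _] := stX j; exact: (adm_ctrl ay (slotB _ _ sj)).
have yd i s : p i <= s -> tdom S s -> (dist T (y s) <= (Gam (rho i))%:E)%E.
  move=> pis /slot[j sj]; rewrite (yE j)//.
  have [_ _ dy _ _] := stX j; apply: le_trans (dy _ (slotB _ _ sj)) _.
  rewrite lee_fin; apply: (Kinf_le GamK) => //; first exact: ltW.
  apply: rho_le; rewrite leqNgt; apply/negP => /(nondecr_seq_le ple) ji.
  by case/andP: sj => _; rewrite ltNge (le_trans ji).
have Gsmall e : 0 < e -> exists i, Gam (rho i) <= e.
  move=> e0; have [h h0 Hh] := Kinf_small GamK e0; have [i ri] := rho_small _ h0.
  by exists i; apply: ltW; apply: Hh; rewrite !ltW.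
have yend : (S < +oo)%E -> dist T (y s) @[s --> (fine S)^'-] --> 0%E.
  move=> Sfin; have Sf : S \is a fin_num by rewrite ge0_fin_numE// ltW.
  apply: dist_cvg0 => e e0; have [i Gi] := Gsmall e e0.
  have piS : p i < fine S by rewrite -lte_fin fineK.
  near=> s.
  have ps : p i <= s by near: s; exact: nbhs_left_ge.
  apply: le_trans (yd i s ps _) _; last by rewrite lee_fin.
  split; first exact: le_trans ps.
  by rewrite -(fineK Sf) lte_fin; near: s; exact: nbhs_left_lt.
have adm : admissible_pair f T x S alpha y.
  split; [exact: yA|by move=> i; exact: (traj_measurable i ty)| |exact: yT|exact: yend].
  by rewrite -{1}y0; exact: traj_solution.
have extT : (S < +oo)%E -> forall s, (S <= s%:E)%E -> (dist T (ext S y s) <= 0%:E)%E.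
  move=> Sfin s Ss; rewrite /ext ltNge Ss /=.
  have Sf : S \is a fin_num by rewrite ge0_fin_numE// ltW.
  (* Bounded distance outside [T] bounds [y], so the left limit used by [ext] exists by
     [traj_limit]. *)
  have [r Hr] := dist_le_bounded T_closed T_boundary (Gam (rho 0%N)).
  have b0 : 0 < fine S by rewrite -lte_fin fineK.
  have tyb : traj f (fine S)%:E alpha y by rewrite fineK.
  have yr u : 0 <= u < fine S -> `|y u| <= r.
    move=> /andP[u0 ub]; have uS : tdom S u by split; rewrite // -(fineK Sf) lte_fin.
    by apply: Hr; [exact: yT|apply: yd => //; rewrite p0].
  have yc := traj_limit f_lip b0 tyb yr.
  apply: dist_lim => e e0; rewrite add0r.
  have n1 : \forall s \near (fine S)^'-, (dist T (y s) <= e%:E)%E.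
    by apply: cvg0_dist e0; exact: yend.
  move/cvgrPdist_lt : yc => /(_ e e0) n2.
  have [u [u1 u2]] : exists u, (dist T (y u) <= e%:E)%E /\
      `|lim (y s @[s --> (fine S)^'-]) - y u| < e.
    by near (fine S)^'- => u; exists u; split; near: u; [exact: n1|exact: n2].
  by exists (y u) => //; rewrite distrC.
have dext i s : 0 <= s -> p i <= s -> (dist T (ext S y s) <= (Gam (rho i))%:E)%E.
  move=> s0 ps; have [sS|Ss] := boolP (s%:E < S)%E.
    by rewrite /ext sS; apply: yd.
  have Ss' : (S <= s%:E)%E by rewrite leNgt.
  apply: le_trans (extT _ s Ss') _; first by rewrite (le_lt_trans Ss')// ltry.
  by rewrite lee_fin ltW// (Kinf_gt0 GamK).
exists S, alpha, y, p; split=> //.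
- split=> // i; rewrite pS lerD2l.
  by have [_ _ _ _ []] := stX i.
- apply: dist_cvg0 => e e0; have [i Gi] := Gsmall e e0.
  near=> s; apply: le_trans (dext i s _ _) _; last by rewrite lee_fin.
    by near: s; apply: nbhs_pinfty_ge; rewrite num_real.
  by near: s; apply: nbhs_pinfty_ge; rewrite num_real.
move=> Lam Psi cf creg l0 lc Ux.
have lA j u : tdom (B j (X j)) u -> 0 <= l (Y j (X j) u) (A j (X j) u).
  by move=> uB; apply: l0; have [_ ay _ _ _] := stX j; exact: (adm_ctrl ay uB).
have UX i : U (X i) <= phi (rho i).
  by case: i => [//|i]; have [_ _] := HX i.+1; apply.
have UX0 i : 0 < U (X i) by have [Ti _ _] := HX i; exact: (U_gt0 (stab_U stab)).
have phi0 i : 0 < phi (rho i) by exact: (Kinf_gt0 phiK).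
rewrite (integral_concat p0 ple SE (F := fun s => (l (y s) (alpha s))%:E)
  (G := fun j u => (l (Y j (X j) u) (A j (X j) u))%:E)); last 3 first.
- exact: cost_measurable ty yA.
- by move=> s sS; rewrite lee_fin; apply: l0; exact: yA.
- by move=> j s sj; rewrite (yE j)// (aE j).
apply: lee_nneseries => [j _ _|j _].
  by apply: integral_ge0 => u /andP[u0 ut]; rewrite lee_fin; apply: lA; have [_ _ _ tS _] := stX j;
    apply: tdom_le tS; rewrite // -pt ltW.
have [tyj ay _ tS [_ _ Ut Hc]] := stX j; rewrite pt.
(* A stage of length zero costs nothing; the lower bound [Uge] holds for the others. *)
have [tj|tj] := eqVneq (t j (X j)) 0.
  rewrite tj (_ : [set s | _] = set0); last first.
    by apply/seteqP; split=> s //= /andP[s0]; rewrite ltNge s0.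
  rewrite integral_set0 lee_fin mulr_ge0 ?(Psi_ge0 cf)//.
  by rewrite ltW// (Lam_gt0 cf).
have Uge : phi (rho j.+1) <= U (Y j (X j) (t j (X j))).
  by case: Ut => // tj'; rewrite tj' eqxx in tj.
apply: (@le_trans _ _ (cost l (A j (X j)) (Y j (X j)) (t j (X j)))).
  rewrite /cost; apply: (ge0_subset_integral leb) => //=.
  - exact: leb_co.
  - exact: leb_cc.
  - apply: measurable_funS (cost_measurable f_lip lc tyj (adm_ctrl ay)); first exact: leb_tdom.
    by move=> u /andP[u0 ut]; apply: tdom_le tS.
  - by move=> u /andP[u0 ut]; rewrite lee_fin; apply: lA; apply: tdom_le tS.
  - by move=> u /= /andP[u0 /ltW ut]; rewrite u0.
apply: le_trans (Hc _ _ creg) _; rewrite lee_fin ler_wpM2l//.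
  by rewrite ltW// (Lam_gt0 cf).
(* Lowering the second argument to [phi (rho j.+1)] and raising the first to [phi (rho j)] can only
   increase [Psi]. *)
apply: (@le_trans _ _ (Psi (U (X j)) (phi (rho j.+1)))).
  move: Uge; rewrite le_eqVlt => /predU1P[->//|/(Psi_decr cf)H].
  by apply/ltW/H.
by apply: (Psi_incr cf).
Unshelve. all: by end_near. Qed.

End stage.

(** * Controllability *)

Section controllability.
Context {R : realType} {n m : nat}.
Variables (f : 'I_m -> 'rV[R]_n -> 'rV[R]_n) (T : set 'rV[R]_n).

Lemma dist_nonempty x c : (dist T x <= c%:E)%E -> T !=set0.
Proof. by move=> /dist_leP/(_ 1 ltr01)[t Tt _]; exists t. Qed.

(** The time [t] comes before [x], so choice collects it into a function of the two radii. A point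
    at finite distance forces [T] to be nonempty; for irrelevant arguments the value 1 serves. *)
Lemma GAC_pointwise (P : 'rV[R]_n -> \bar R -> (R -> 'rV[R]_m) -> (R -> 'rV[R]_n) -> Prop)
    (G : R -> R) :
  (forall rad, 0 < rad -> 0 < G rad) -> G rad @[rad --> 0^'+] --> 0 ->
  (forall r rad, 0 < r < rad -> T !=set0 ->
    exists2 t, 0 < t & forall x, ~ T x -> (dist T x <= rad%:E)%E ->
    exists S alpha y, [/\ admissible_pair f T x S alpha y,
      forall s, 0 <= s -> (dist T (ext S y s) <= (G rad)%:E)%E,
      forall s, t <= s -> (dist T (ext S y s) <= r%:E)%E,
      dist T (ext S y s) @[s --> +oo] --> 0%E & P x S alpha y]) ->
  GAC_such_that f T P.
Proof.
move=> G0 Glim H.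
have /choice[St HSt] : forall q : R * R, exists t, 0 < t /\ (0 < q.2 < q.1 ->
    forall x, ~ T x -> (dist T x <= (q.1)%:E)%E ->
    exists S alpha y, [/\ admissible_pair f T x S alpha y,
      forall s, 0 <= s -> (dist T (ext S y s) <= (G q.1)%:E)%E,
      forall s, t <= s -> (dist T (ext S y s) <= (q.2)%:E)%E,
      dist T (ext S y s) @[s --> +oo] --> 0%E & P x S alpha y]).
  move=> [rad r]; have [[rr T0]|nr] := pselect (0 < r < rad /\ T !=set0).
    by have [t t0 Ht] := H _ _ rr T0; exists t.
  exists 1; split=> //= rr x Tx dx; case: nr; split=> //; exact: dist_nonempty dx.
exists G, (fun rad r => St (rad, r)); split=> //.
  by move=> rad r _; have [] := HSt (rad, r).
by move=> r rad x rr Tx dx; have [_ /(_ rr x Tx dx)] := HSt (rad, r).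
Qed.

End controllability.

Section sample_stabilizable_GAC.
Context {R : realType} {n m : nat}.
Variables (f : 'I_m -> 'rV[R]_n -> 'rV[R]_n) (T : set 'rV[R]_n).
Variable l : 'rV[R]_n -> 'rV[R]_m -> R.
Hypotheses (f_lip : lip_on_balls f) (T_closed : closed T) (T_boundary : compact (boundary T)).

Lemma inv_expn2_small (a e : R) : 0 < e -> exists i, a / 2 ^+ i < e.
Proof.
move=> e0; have /cvgrPdist_lt : a * (2^-1 ^+ i) @[i --> \oo] --> a * 0.
  by apply: cvgMr; apply: cvg_expr; rewrite ger0_norm ?invr_ge0//; lra.
rewrite mulr0 => /(_ _ e0)[N _ /(_ N (leqnn N))].
by rewrite /= sub0r normrN exprVn => /(le_lt_trans (ler_norm _)) ?; exists N.
Qed.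

Lemma Kinf_cvg0 (g : R -> R) : class_Kinf g -> g s @[s --> 0^'+] --> 0.
Proof.
move=> gK; apply/cvgrPdist_le => e e0; have [h h0 Hh] := Kinf_small gK e0.
near=> s.
have s0 : 0 < s by near: s; exact: nbhs_right_gt.
rewrite sub0r normrN ger0_norm ?(ltW (Kinf_gt0 gK s0))//.
by apply: ltW; apply: Hh; rewrite (ltW s0)/=; near: s; exact: nbhs_right_le.
Unshelve. all: by end_near. Qed.

(** The first stage already settles: [rho1] is chosen with [Gam rho1 <= r], and from its end on
    [chain_ex] keeps the distance below [Gam rho1]. The halvings that follow give convergence to the
    target. *)
Lemma sample_stabilizable_GAC k : sample_stabilizable f T k -> GAC f T.
Proof.
move=> [V [U [d [Gam [phi [Tm stab]]]]]].
have GamK := stab_Gam stab.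
apply: (GAC_pointwise (G := Gam)); [exact: (Kinf_gt0 GamK)|exact: Kinf_cvg0|].
move=> r rad /andP[r0 rrad] T0; have rad0 := lt_trans r0 rrad.
have [h h0 Hh] := Kinf_small GamK r0.
pose rho1 := Num.min h (rad / 2).
have rho10 : 0 < rho1 by rewrite lt_min h0 divr_gt0.
have rho1r : rho1 < rad.
  by apply: (@le_lt_trans _ _ (rad / 2)); [rewrite ge_min lexx orbT|lra].
have Grho : Gam rho1 <= r by apply: ltW; apply: Hh; rewrite ltW//= ge_min lexx.
pose rho i := if i is i'.+1 then rho1 / 2 ^+ i' else rad.
have rho_decr i : 0 < rho i.+1 < rho i.
  have p2 j : 0 < rho1 / 2 ^+ j by rewrite divr_gt0// exprn_gt0.
  rewrite p2; case: i => [|i] /=; first by rewrite expr0 divr1.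
  by rewrite exprSr invfM mulrA ltr_pdivrMr// ltr_pMr// ltr1n.
have rho_small e : 0 < e -> exists i, rho i < e.
  by move=> e0; have [i Hi] := inv_expn2_small rho1 e0; exists i.+1.
exists (Tm rad rho1); first exact: (stab_Tm_gt0 stab).
move=> x Tx dx.
have [S [alpha [y [p [adm [p0 pS] dy dlim _]]]]] :=
  chain_ex l f_lip T_closed T_boundary stab T0 Tx rho_decr rho_small dx.
have rho_1 : rho 1%N = rho1 by rewrite /rho expr0 divr1.
have p1 : p 1%N <= Tm rad rho1 by have := pS 0%N; rewrite p0 add0r rho_1.
exists S, alpha, y; split=> //.
  by move=> s s0; apply: (dy 0%N) => //; rewrite p0.
move=> s ts; have Tm0 := stab_Tm_gt0 stab rad0 rho10.
apply: (@le_trans _ _ (Gam (rho 1%N))%:E); last by rewrite rho_1 lee_fin.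
by apply: dy; [exact: le_trans (ltW Tm0) ts|exact: le_trans p1 ts].
Qed.

Section inverse.
Variable phi : R -> R.
Hypothesis phiK : class_Kinf phi.
Let phii (v : R) : R := 'pinv_(fun=> 0) [set s | 0 <= s] phi v.

Lemma pinv_Kinf v : 0 <= v -> 0 <= phii v /\ phi (phii v) = v.
Proof.
move=> v0; have [s s0 <-] := Kinf_onto phiK v0.
have inj : {in [set s : R | 0 <= s] &, injective phi}.
  by move=> a b /set_mem a0 /set_mem b0; exact: Kinf_inj.
by rewrite /phii pinvKV// ?inE//.
Qed.

Lemma pinv_Kinf_lt a b : 0 <= a -> a < b -> phii a < phii b.
Proof.
move=> a0 ab; have [_ pa] := pinv_Kinf a0; have [pb0 pb] := pinv_Kinf (ltW (le_lt_trans a0 ab)).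
by apply: (Kinf_lt_inv phiK pb0); rewrite pa pb.
Qed.

Lemma pinv_Kinf_le a b : 0 <= a -> a <= b -> phii a <= phii b.
Proof. by move=> a0; rewrite le_eqVlt => /predU1P[->//|/(pinv_Kinf_lt a0)/ltW]. Qed.

Lemma pinv_Kinf0 : phii 0 = 0.
Proof.
have [p0 pE] := pinv_Kinf (lexx 0); apply: (Kinf_inj phiK) => //.
by rewrite pE; case: phiK.
Qed.

Lemma pinv_Kinf_gt0 a : 0 < a -> 0 < phii a.
Proof. by move=> /(pinv_Kinf_lt (lexx 0)); rewrite pinv_Kinf0. Qed.

Lemma pinv_Kinf_cont v : 0 < v -> {for v, continuous phii}.
Proof.
move=> v0; apply/cvgrPdist_lt => e e0; have [p0 pE] := pinv_Kinf (ltW v0).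
have pv0 := pinv_Kinf_gt0 v0.
(* [a] lies less than [e] below [phii v] and is nonnegative, where [phi] increases; [w] gets trapped
   between [phi a] and [phi (phii v + e)]. *)
pose a := phii v - Num.min e (phii v) / 2.
have m0 : 0 < Num.min e (phii v) by rewrite lt_min e0.
have m1 : Num.min e (phii v) <= e by rewrite ge_min lexx.
have m2 : Num.min e (phii v) <= phii v by rewrite ge_min lexx orbT.
have a0 : 0 <= a by rewrite /a; lra.
have av : phi a < v by rewrite -pE; apply: (Kinf_lt phiK); rewrite // /a; lra.
have vb : v < phi (phii v + e) by rewrite -{1}pE; apply: (Kinf_lt phiK); rewrite // ltrDl.
near=> w.
have w0 : 0 < w by near: w; exact: lt_nbhsr.
have [pw0 pwE] := pinv_Kinf (ltW w0).
have aw : phi a < w by near: w; exact: lt_nbhsr.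
have wb : w < phi (phii v + e) by near: w; exact: lt_nbhsl.
rewrite -pwE in aw; rewrite -pwE in wb.
have := Kinf_lt_inv phiK pw0 aw; have := Kinf_lt_inv phiK (ltW (addr_gt0 pv0 e0)) wb.
by rewrite ltr_norml /a; lra.
Unshelve. all: by end_near. Qed.

End inverse.

(** * The bound [W] and controllability with regulated cost *)

Section regulated_cost.
Variables (k : nat) (U : 'rV[R]_n -> R) (phi Lam : R -> R) (Psi : R -> R -> R).
Variables (u : int -> R) (Phi : R -> R).
Hypotheses (U_prop : cont_proper_posdef (~` T) U) (phiK : class_Kinf phi).
Hypotheses (cf : cost_factors k Lam Psi) (cs : cost_sequence Psi u).
Hypothesis (Phi_app : Phi_approx Psi u Phi).
Let phii (v : R) : R := 'pinv_(fun=> 0) [set s | 0 <= s] phi v.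
Let w (v : R) := if v == 0 then 0 else Lam (phii v) * Phi v.
Let PhiK : class_Kinf Phi := Phi_app.1.

Lemma W_profile_gt0 v : 0 < v -> 0 < w v.
Proof.
move=> v0; rewrite /w gt_eqF// mulr_gt0 ?(Lam_gt0 cf) ?(Kinf_gt0 PhiK)//.
exact: pinv_Kinf_gt0.
Qed.

(** The delicate point is 0, where no limit of [Lam] is prescribed: as [Lam] increases,
    [Lam (phii v)] stays below [Lam (phii 1)] for [v <= 1], while [Phi v] tends to 0. *)
Lemma W_profile_cont v : 0 <= v -> forall e, 0 < e -> exists2 h, 0 < h &
  forall v', 0 <= v' -> `|v' - v| < h -> `|w v' - w v| < e.
Proof.
rewrite le_eqVlt => /predU1P[<-|v0] e e0.
  pose M := Lam (phii 1).
  have M0 : 0 < M by apply: (Lam_gt0 cf); apply: pinv_Kinf_gt0.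
  have [h h0 Hh] := Kinf_small PhiK (divr_gt0 e0 M0).
  exists (Num.min 1 h); first by rewrite lt_min ltr01.
  move=> v' v'0; rewrite /w eqxx !subr0 (ger0_norm v'0) lt_min => /andP[v'1 v'h].
  case: eqP => [_|/eqP v'n]; first by rewrite normr0.
  have {}v'0 : 0 < v' by rewrite lt_neqAle eq_sym v'n.
  have Lv := Lam_gt0 cf (pinv_Kinf_gt0 phiK v'0).
  have Pv := Kinf_gt0 PhiK v'0.
  rewrite ger0_norm; last by rewrite mulr_ge0// ltW.
  apply: (@le_lt_trans _ _ (M * Phi v')).
    rewrite (ler_wpM2r (ltW Pv))//; apply: (Lam_incr cf); first exact: pinv_Kinf_gt0.
    by apply: (pinv_Kinf_le phiK); exact: ltW.
  by rewrite mulrC -ltr_pdivlMr// Hh// !ltW.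
have cw : {for v, continuous (fun v => Lam (phii v) * Phi v)}.
  apply: continuousM.
    apply: (@continuous_comp _ _ _ phii Lam); first exact: pinv_Kinf_cont.
    by apply: (Lam_cont cf); exact: pinv_Kinf_gt0.
  apply/cvgrPdist_lt => e1 e10; have [h h0 Hh] := Kinf_cont PhiK (ltW v0) e10.
  near=> t; rewrite distrC; apply: Hh.
    by apply: ltW; near: t; exact: lt_nbhsr.
  by rewrite distrC; near: t; apply: (@cvgr_dist_lt _ R); [exact: cvg_id|].
move/cvgrPdist_lt : cw => /(_ e e0) [h /= h0 Hh].
exists (Num.min h v); first by rewrite lt_min h0.
move=> v' v'0; rewrite lt_min => /andP[v'h v'v].
have v'gt0 : 0 < v' by move: v'v; rewrite ltr_norml; lra.
by rewrite /w !gt_eqF// distrC; apply: Hh => /=; rewrite distrC.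
Unshelve. all: by end_near. Qed.

Lemma W_bound_pos_definite : cont_proper_posdef (~` T) (W_bound Lam phi Phi U).
Proof.
have wE x : W_bound Lam phi Phi U x = w (U x) by [].
have Wc x : closure (~` T) x -> forall e, 0 < e -> exists2 h, 0 < h &
    forall z, closure (~` T) z -> `|z - x| < h -> `|w (U z) - w (U x)| < e.
  move=> cx e e0; have [h h0 Hh] := W_profile_cont (U_ge0 U_prop cx) e0.
  have [h' h'0 Hh'] := U_cont U_prop cx h0; exists h' => // z cz zx.
  by apply: Hh; [exact: (U_ge0 U_prop cz)|exact: Hh'].
split.
- apply/subspace_continuousP => x cx; apply/cvgrPdist_lt => e e0.
  have [h h0 Hh] := Wc x cx e e0.
  rewrite near_withinE; apply: filterS (nbhsx_ballx x h h0) => z.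
  rewrite -ball_normE/= => xz cz.
  by rewrite distrC; apply: Hh => //; rewrite distrC.
- move=> K cK K0.
  have [M [_ HM]] := compact_bounded cK.
  have L0 : 0 < Lam (phii 1) by apply: (Lam_gt0 cf); apply: pinv_Kinf_gt0.
  (* Where [U x] exceeds both 1 and [N], the value of [W] is above [M + 1]. So the preimage of [K]
     lies in a compact set where [U] is bounded, and closedness remains. *)
  have [N N0 HN] : exists2 N, 0 <= N & (M + 1) / Lam (phii 1) < Phi N by case: PhiK => _ _ _; apply.
  have [_ Up _] := U_prop.
  have cU := Up `[0, Num.max 1 N]%classic (@segment_compact _ _ _).
  apply: subclosed_compact (cU _) _; last 2 first.
  + by move=> v /=; rewrite in_itv/= => /andP[].
  + move=> x [cx]; rewrite /preimage/= wE => Kx; split=> //=; rewrite in_itv/= (U_ge0 U_prop cx)/=.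
    rewrite leNgt; apply/negP; rewrite gt_max => /andP[U1 UN].
    have U0 : 0 < U x := lt_trans ltr01 U1.
    have : w (U x) <= M + 1.
      by apply: le_trans (ler_norm _) (HM (M + 1) _ _ Kx); rewrite ltrDl.
    rewrite leNgt => /negP; apply; rewrite /w gt_eqF//.
    apply: (@lt_le_trans _ _ (Lam (phii 1) * Phi (U x))).
      rewrite mulrC -ltr_pdivrMr//; apply: lt_trans HN _.
      exact: (Kinf_lt PhiK).
    rewrite ler_wpM2r ?(ltW (Kinf_gt0 PhiK U0))//; apply: (Lam_incr cf); first exact: pinv_Kinf_gt0.
    by apply: (pinv_Kinf_le phiK); rewrite ?ltW.
  move=> x Hx.
  have cx : closure (~` T) x.
    by apply: closed_closure; apply: closure_subset Hx => z [].
  split=> //; apply: (compact_closed (@Rhausdorff R) cK).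
  move=> B /nbhs_normP[e /= e0 eB]; have [h h0 Hh] := Wc x cx e e0.
  have [z [[cz Kz] xz]] := Hx (ball x h) (nbhsx_ballx x h h0).
  exists (w (U z)); split=> //; apply: eB => /=; rewrite distrC; apply: Hh => //.
  by move: xz; rewrite -ball_normE/= distrC.
- split=> x; first by move=> Tx; rewrite wE W_profile_gt0//; exact: (U_gt0 U_prop Tx).
  by move=> bx; rewrite wE; case: (U_prop) => _ _ [_ ->//]; rewrite /w eqxx.
Qed.

Hypothesis l_ge0 : forall x a, ctrl_set a -> 0 <= l x a.
Hypothesis l_cont : forall a, ctrl_set a -> continuous (fun x => l x a).

Lemma addz_nat (i : int) (M c : nat) : (M + `|i| <= c)%N ->
  exists2 c' : nat, i + c%:Z = c'%:Z & (M <= c')%N.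
Proof. by move=> H; exists `|(i + c%:Z)%R|%N; clear -H; lia. Qed.

Lemma lez_nat_diff (i j : int) : i <= j -> exists a : nat, j = i + a%:Z.
Proof. by move=> H; exists `|(j - i)%R|%N; clear -H; lia. Qed.

Lemma useq_slot v : 0 < v -> exists i : int, u (i + 1) < v <= u i.
Proof.
move=> v0; have /cvgryPgt/(_ v)[N _ HN] := useq_ninfty cs.
have /cvgrPdist_lt/(_ v v0)[M _ HM] := useq_pinfty cs.
(* Opposite signs turn the decreasing [u] and the intervals closed above into the slots of
   [slot_ex]. *)
have [||j] := @slot_ex _ (fun j => - u (- N%:Z + j%:Z)) (- v) (N + M)%N.
- by rewrite addr0 lerN2 ltW//; apply: HN => /=.
- rewrite ltrN2 PoszD addrA addNr add0r; apply: le_lt_trans (ler_norm _) _.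
  by have := HM M (leqnn M); rewrite /= sub0r normrN.
rewrite lerN2 ltrN2 => /andP[k1 k2]; exists (- N%:Z + j%:Z); rewrite k1 andbT.
by rewrite -addrA -PoszD addn1.
Qed.

(** As [U x <= wU rad], the first level gives the overshoot bound [Gam (phii (wU rad))]. For a
    settling time uniform in [x], all later levels are read in one sequence [uu] starting above
    [wU rad]; at most [b] stages bring the level down to [uu b]. *)
Lemma sample_stabilizable_cost_GAC :
  sample_stabilizable_cost f l T k U phi Lam Psi -> GAC_cost f l T (W_bound Lam phi Phi U).
Proof.
move=> [_ [V [d [Gam [Tm [stab creg]]]]]]; split; first exact: W_bound_pos_definite.
have GamK := stab_Gam stab.
have [wU [wU0 UwU wUlim]] := U_modulus T_closed T_boundary U_prop.
have p0 v := @pinv_Kinf_gt0 phi phiK v; have ple := pinv_Kinf_le phiK.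
have plt := pinv_Kinf_lt phiK.
have pE v : 0 < v -> phi (phii v) = v by move=> /ltW /(pinv_Kinf phiK)[].
have u0 := useq_gt0 cs.
apply: (GAC_pointwise (G := fun rad => Gam (phii (wU rad)))).
- by move=> rad rad0; apply: (Kinf_gt0 GamK); apply: p0; exact: wU0.
- apply/cvgrPdist_le => e e0; have [h h0 Hh] := Kinf_small GamK e0.
  have ph := Kinf_gt0 phiK h0.
  move/cvgrPdist_lt : wUlim => /(_ _ ph) wsmall.
  near=> s.
  have s0 : 0 < s by near: s; exact: nbhs_right_gt.
  have pw := p0 _ (wU0 _ s0).
  rewrite sub0r normrN ger0_norm ?(ltW (Kinf_gt0 GamK pw))//.
  apply: ltW; apply: Hh; rewrite (ltW pw)/=; apply: ltW; apply: (Kinf_lt_inv phiK (ltW h0)).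
  rewrite pE ?wU0//; have : `|0 - wU s| < phi h by near: s.
  by rewrite sub0r normrN => /(le_lt_trans (ler_norm _)).
move=> r rad /andP[r0 rrad] T0; have rad0 := lt_trans r0 rrad.
have [i1 /andP[_ wi1]] := useq_slot (wU0 _ rad0).
pose uu c := u (i1 + c%:Z).
have uu_lt c c' : (c < c')%N -> uu c' < uu c.
  by move=> cc'; apply: (useq_decr cs); rewrite ltrD2l ltz_nat.
have uu_le c c' : (c <= c')%N -> uu c' <= uu c.
  by rewrite leq_eqVlt => /predU1P[->//|/uu_lt/ltW].
have uu_small e : 0 < e -> exists2 c0, (0 < c0)%N & forall c, (c0 <= c)%N -> uu c < e.
  move=> e0; have /cvgrPdist_lt/(_ e e0)[M _ HM] := useq_pinfty cs.
  exists (M + `|i1|)%N.+1 => // c cM.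
  have [c' ic Mc'] := addz_nat (ltnW cM).
  rewrite /uu ic; apply: le_lt_trans (ler_norm _) _.
  by have := HM c' Mc'; rewrite /= sub0r normrN.
have [h h0 Hh] := Kinf_small GamK r0.
have [b b0 Hb] := uu_small _ (Kinf_gt0 phiK h0).
have Gb : Gam (phii (uu b)) <= r.
  apply: ltW; apply: Hh; rewrite (ltW (p0 _ (u0 _)))/=; apply: ltW.
  by apply: (Kinf_lt_inv phiK (ltW h0)); rewrite pE ?u0// Hb.
(* It bounds each stage counted below, since [Tm] increases in its first argument and decreases in
   the second. *)
pose B := Tm (phii (uu 0%N)) (phii (uu b)).
have B0 : 0 < B by apply: (stab_Tm_gt0 stab); apply: p0; exact: u0.
exists (b%:R * B); first by rewrite mulr_gt0// ltr0n.
move=> x Tx dx; set v := U x.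
have v0 : 0 < v := U_gt0 U_prop Tx.
have vw : v <= wU rad := UwU _ _ Tx dx.
(* The same [xget] as in [Phi0], so that the tails of the two series match. *)
pose i0 := xget 0 [set i : int | u (i + 1) < v <= u i].
have /andP[i0v vi0] : u (i0 + 1) < v <= u i0.
  by rewrite /i0; case: xgetP => [i _ //|]; have [i Hi] := useq_slot v0; move=> /(_ i).
have [a i0E] : exists a : nat, i0 = i1 + a%:Z.
  have i10 : i1 < i0 + 1.
    rewrite ltNge; apply/negP => ii.
    have uii : u i1 <= u (i0 + 1).
      by move: ii; rewrite le_eqVlt => /predU1P[->//|/(useq_decr cs)/ltW].
    by have := lt_le_trans i0v (le_trans vw (le_trans wi1 uii)); rewrite ltxx.
  by move: i10; rewrite ltzD1; exact: lez_nat_diff.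
have i0S j : u (i0 + 1 + j%:Z) = uu (a + 1 + j)%N by rewrite /uu i0E !PoszD !addrA.
have i01 : u (i0 + 1) = uu (a + 1)%N by have := i0S 0%N; rewrite addr0 addn0.
(* [U x] itself, then the terms of [u] strictly below it. *)
pose lev j := if j is j'.+1 then uu (a + 1 + j')%N else v.
have lev0 j : 0 < lev j by case: j => [|j] //=; exact: u0.
have lev_lt j : lev j.+1 < lev j.
  by case: j => [|j] /=; [rewrite addn0 -i01|apply: uu_lt; rewrite ltn_add2l].
pose rho j := phii (lev j).
have rho_decr i : 0 < rho i.+1 < rho i.
  by rewrite p0 ?lev0//=; apply: plt => //; exact: ltW.
have rho_small e : 0 < e -> exists i, rho i < e.
  move=> e0; have [c c0 Hc] := uu_small _ (Kinf_gt0 phiK e0).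
  exists c.+1; apply: (Kinf_lt_inv phiK (ltW e0)); rewrite pE ?lev0//= Hc//.
  by rewrite leq_addl.
have dx0 : (dist T x <= (rho 0%N)%:E)%E.
  by apply: (U_le_phi_dist l f_lip T_closed T_boundary stab T0 Tx); rewrite ?p0// pE.
have [S [alpha [y [p [adm [pz pS] dy dlim Hcost]]]]] :=
  chain_ex l f_lip T_closed T_boundary stab T0 Tx rho_decr rho_small dx0.
have rho_le i j : (i <= j)%N -> rho j <= rho i.
  move=> /subnKC <-; elim: (j - i)%N => [|q IH]; first by rewrite addn0.
  by rewrite addnS; apply: le_trans IH; apply: ltW; case/andP: (rho_decr (i + q)%N).
have rho00 : rho 0%N <= phii (uu 0%N).
  by apply: ple; [exact: ltW|apply: le_trans vw _; rewrite /uu addr0].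
exists S, alpha, y; split=> //.
- move=> s s0; apply: le_trans (dy 0%N s s0 _) _; first by rewrite pz.
  rewrite lee_fin; apply: (Kinf_le GamK); first exact: ltW (p0 _ v0).
  by apply: ple => //; exact: ltW.
- move=> s ts; have s0 : 0 <= s by apply: le_trans ts; rewrite mulr_ge0// ltW.
  have [q [Gq pq]] : exists q, Gam (rho q) <= r /\ p q <= b%:R * B.
    (* If [b <= a], the initial level is already at most [uu b]; otherwise stage [b - a] starts
       exactly at [uu b]. *)
    have [ba|ab] := leqP b a.
      exists 0%N; split; last by rewrite pz mulr_ge0// ltW.
      apply: le_trans Gb; apply: (Kinf_le GamK); first exact: ltW (p0 _ v0).
      apply: ple; first exact: ltW.
      by apply: le_trans vi0 _; rewrite i0E; exact: uu_le.
    exists (b - a)%N; have baE : rho (b - a)%N = phii (uu b).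
      move: (ab); rewrite -subn_gt0 /rho; case E : (b - a)%N => [//|j] _ /=.
      by rewrite -addnA add1n -E subnKC// ltnW.
    split; first by rewrite baE.
    have H j : (j <= b - a)%N -> p j <= j%:R * B.
      elim: j => [|j IH] jb; first by rewrite pz mul0r.
      apply: le_trans (pS j) _; rewrite -natr1 mulrDl mul1r; apply: lerD.
        by apply: IH; exact: ltnW.
      have [r1 r2] : 0 < rho j /\ 0 < rho j.+1.
        by case/andP: (rho_decr j) => r1 r2; split => //; exact: lt_trans r2.
      have r3 : rho j <= phii (uu 0%N) by apply: le_trans rho00; exact: rho_le.
      have r4 : phii (uu b) <= rho j.+1 by rewrite -baE; exact: rho_le.
      apply: le_trans (stab_Tm_incr stab r1 r3 r2) _.
      by apply: (stab_Tm_decr stab) => //; apply: p0; exact: u0.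
    apply: le_trans (H _ (leqnn _)) _; rewrite ler_wpM2r ?(ltW B0)// ler_nat leq_subr//.
  by apply: le_trans (dy q s s0 (le_trans pq ts)) _; rewrite lee_fin.
have pr0 : phi (rho 0%N) = v by rewrite pE.
have Ux : U x <= phi (rho 0%N) by rewrite pr0.
apply: le_trans (Hcost _ _ cf creg l_ge0 l_cont Ux) _.
have pr j : phi (rho j) = lev j by rewrite pE.
have L0 : 0 < Lam (rho 0%N) by apply: (Lam_gt0 cf); exact: p0.
have Psi0 j : 0 <= Psi (lev j) (lev j.+1) by apply: (Psi_ge0 cf).
(* [Lam] is largest at the first level and factors out. *)
apply: (@le_trans _ _ (\sum_(0 <= i <oo) ((Lam (rho 0%N))%:E * (Psi (lev i) (lev i.+1))%:E))%E).
  apply: lee_nneseries => [i _ _|i _].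
    by rewrite !pr lee_fin mulr_ge0// ltW// (Lam_gt0 cf)// p0.
  rewrite !pr -EFinM lee_fin ler_wpM2r//; apply: (Lam_incr cf); first exact: p0.
  exact: rho_le.
rewrite nneseriesZl; last by move=> i _; rewrite lee_fin.
rewrite /W_bound -/v gt_eqF// EFinM lee_pmul2l//.
apply: le_trans (Phi_app.2 v (ltW v0)); rewrite /Phi0 gt_eqF// -/i0.
(* The first stage contributes [Psi v (u (i0 + 1))], the others [Psi_tail] from [i0 + 1]: together
   [Phi0]. *)
rewrite nneseries_recl//; last by move=> i _; rewrite lee_fin.
rewrite /lev/= addn0 -i01 leeD2l// /Psi_tail.
rewrite -(nneseries_addn 1); last by move=> i; rewrite lee_fin; exact: (Psi0 i).
apply: lee_nneseries => [i _ _|i _]; first by rewrite lee_fin; exact: (Psi0 (i + 1)%N).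
rewrite addn1/= i0S lee_fin -addrA (_ : i%:Z + 1 = i.+1%:Z) ?i0S//.
by rewrite -addn1.
Unshelve. all: by end_near. Qed.

End regulated_cost.

End sample_stabilizable_GAC.

Lemma lipschitz_near_continuous (R : realType) (n : nat) (g : 'rV[R]_n -> R) :
  (forall x : 'rV[R]_n, exists2 N, nbhs x N & [lipschitz g z | z in N]) -> continuous g.
Proof.
move=> gl x; have [N Nx [M [_ HM]]] := gl x.
have Nxx := nbhs_singleton Nx; pose K := `|M| + 1; have K0 : 0 < K by rewrite ltr_wpDl.
apply/(@cvgrPdist_lt _ _ _ (nbhs x) (nbhs_filter x)) => e e0.
apply: filterS2 (Nx) (nbhsx_ballx x (e / K) (divr_gt0 e0 K0)) => z Nz.
rewrite -ball_normE/= ltr_pdivlMr// mulrC; apply: le_lt_trans.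
apply: (HM K _ (x, z)); first by rewrite (le_lt_trans (ler_norm _))// ltrDl.
by split; [exact: Nxx|].
Qed.

Unset Implicit Arguments.

Theorem theorem3p1 (R : realType) (n m k : nat)
  (f : 'I_m -> 'rV[R]_n -> 'rV[R]_n) (T : set 'rV[R]_n)
  (l : 'rV[R]_n -> 'rV[R]_m -> R)
  (k_ge1 : (1 <= k)%N)
  (l_ge0 : forall x a, ctrl_set a -> 0 <= l x a)
  (T_closed : closed T) (T_boundary : compact (boundary T))
  (l_lip : forall a, ctrl_set a -> forall x : 'rV[R]_n,
    exists2 N, nbhs x N & [lipschitz l z a | z in N])
  (f_reg : forall O : set 'rV[R]_n, open O -> O !=set0 -> bounded_set O ->
    forall i, class_C1b k.-1 O (f i)) :
  (sample_stabilizable f T k -> GAC f T) /\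
  (forall (U : 'rV[R]_n -> R) (phi Lam : R -> R) (Psi : R -> R -> R)
     (u : int -> R) (Phi : R -> R),
     sample_stabilizable_cost f l T k U phi Lam Psi ->
     cost_sequence Psi u -> Phi_approx Psi u Phi ->
     GAC_cost f l T (W_bound Lam phi Phi U)).
Proof.
have f_lip : lip_on_balls f := class_C1b_lip f_reg.
split; first exact: (sample_stabilizable_GAC l f_lip T_closed T_boundary).
move=> U phi Lam Psi u Phi stab cs Phi_app.
have [[cf _] [V [d [Gam [Tm [st _]]]]]] := stab.
apply: (sample_stabilizable_cost_GAC f_lip T_closed T_boundary (stab_U st) (stab_phi st) cf cs
  Phi_app l_ge0 _ stab).
by move=> a Ca; apply: lipschitz_near_continuous; exact: l_lip.
Qed.
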